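(* Let $M\in\mathbb{N}$, $r\in\{1,\dots,M\}$, and let $C\in\mathbb{R}^{M\times M}$ be deterministic with singular values $\lambda_1\ge\dots\ge\lambda_M\ge 0$. Let $E$ be an $M\times M$ random matrix whose entries $E_{ij}$ are centered i.i.d. real random variables with variance $\sigma^2>0$ and finite fourth moment $m_4=\mathbb{E}E_{11}^4$. Put $X=C+E$, let $\pi_r\in\mathcal{S}_{M,r}$ be a maximizer of $\|\tilde\pi_r C\|_{S_2}$ over $\tilde\pi_r\in\mathcal{S}_{M,r}$, and let $$Z_{\hat\pi_r}:=\sup_{\tilde\pi_r\in\mathcal{S}_{M,r}}\Big(\|\tilde\pi_r X\|_{S_2}^2-\|\pi_r X\|_{S_2}^2\Big).$$ Then there is a universal constant $K>0$ (independent of $M,r,C$ and of the distribution of the entries) such that $$\mathbb{E}Z_{\hat\pi_r}\le K\, r(M-r)\min(\mathrm{I},\mathrm{II},\mathrm{III}),$$ where $$\mathrm{I}=\sigma^2+\sqrt{m_4}+\frac{\lambda_1}{\sqrt M}\big(\sigma+m_4^{1/4}\big),$$ $$\mathrm{II}=\frac{\lambda_1^2}{\lambda_r^2-\lambda_{r+1}^2}\big(\sigma^2+\sqrt{m_4}\big)\ \text{ if }\lambda_r>\lambda_{r+1},\qquad \mathrm{II}=\infty\ \text{ if }\lambda_r=\lambda_{r+1},$$ $$\mathrm{III}=\frac{\lambda_1^2}{\lambda_r^2}\big(\sigma^2+\sqrt{m_4}\big)+\sqrt{\frac{\lambda_1^2\sum_{i=r+1}^{2r}\lambda_i^2}{r(M-r)\lambda_r^2}}\big(\sigma+m_4^{1/4}\big)\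 \text{ if }\lambda_r>0,\qquad \mathrm{III}=\infty\ \text{ if }\lambda_r=0.$$
   Context: $\mathcal{S}_{M,r}$ denotes the set of all orthogonal projections of rank $r$ onto subspaces of $\mathbb{R}^M$ (symmetric idempotent $M\times M$ matrices of rank $r$). $\|\cdot\|_{S_2}$ is the Hilbert–Schmidt (Frobenius) norm. Convention: $\lambda_i:=0$ for $i>M$. *)

(* Defs.v *)
From HB Require Import structures.
From mathcomp Require Import all_boot all_order all_algebra.
From mathcomp Require Import all_classical all_reals all_analysis.
Set Implicit Arguments. Unset Strict Implicit. Unset Printing Implicit Defensive.
Import Order.TTheory GRing.Theory Num.Theory.
Local Open Scope classical_set_scope.
Local Open Scope ring_scope.

Definition orthogonal_mx (R : realType) (n : nat) (U : 'M[R]_n) : Prop :=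
  U *m U^T = 1%:M.

Definition proj_rank (R : realType) (M r : nat) : set 'M[R]_M :=
  [set A | A^T = A /\ A *m A = A /\ \rank A = r].

Definition hs_norm2 (R : realType) (m n : nat) (A : 'M[R]_(m, n)) : R :=
  \sum_(i < m) \sum_(j < n) A i j ^+ 2.
Definition hs_norm (R : realType) (m n : nat) (A : 'M[R]_(m, n)) : R :=
  Num.sqrt (hs_norm2 A).

(* lam 1 >= ... >= lam M >= 0 are the singular values of C (1-indexed;
   lam 0 is unused), with the convention lam i = 0 for i > M.  Being the
   singular values means: C = U diag(lam 1, ..., lam M) V^T for some
   orthogonal U, V (singular value decomposition). *)
Definition singular_values (R : realType) (M : nat) (C : 'M[R]_M)
    (lam : nat -> R) : Prop :=
  (forall i, (M < i)%N -> lam i = 0) /\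
  (forall i, (0 < i <= M)%N -> 0 <= lam i) /\
  (forall i j, (0 < i)%N -> (i <= j)%N -> (j <= M)%N -> lam j <= lam i) /\
  exists U V : 'M[R]_M, orthogonal_mx U /\ orthogonal_mx V /\
    C = U *m diag_mx (\row_(i < M) lam i.+1) *m V^T.

Definition mutually_independent d (T : measurableType d) (R : realType)
    (P : probability T R) (I : finType) (X : I -> T -> R) : Prop :=
  forall (J : {set I}) (B : I -> set R), (forall i, measurable (B i)) ->
    P (\bigcap_(i in [set i | i \in J]) (X i @^-1` B i)) =
    (\prod_(i in J) P (X i @^-1` B i))%E.

Definition same_law d (T : measurableType d) (R : realType)
    (P : probability T R) (X Y : T -> R) : Prop :=
  forall B : set R, measurable B -> P (X @^-1` B) = P (Y @^-1` B).

(* Main.v *)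
Require Import Defs.
From HB Require Import structures.
From mathcomp Require Import all_boot all_order all_algebra.
From mathcomp Require Import all_classical all_reals all_analysis.
From mathcomp Require Import measurable_realfun.
From mathcomp Require Import ring lra zify.
Set Implicit Arguments.
Unset Strict Implicit.
Unset Printing Implicit Defensive.
Import Order.TTheory GRing.Theory Num.Theory.
Import numFieldNormedType.Exports.
Local Open Scope ring_scope.

(** Since [pi_r] maximizes [|pi C|] and [E |pi X|^2 - |pi C|^2] depends only on
    the rank of [pi], the projection [pi_r] may be replaced in expectation by the
    spectral projection [P0] onto the top [r] left singular vectors of [C].  For
    every [Q] of rank [r], the excess [|QX|^2 - |P0 X|^2] splits into a
    nonpositive curvature term [|QC|^2 - |P0 C|^2], a term linear in the noise
    and a term quadratic in the noise.  Bounding the last two by the operator norm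
    of the noise gives I.  The curvature term is at most [-(lam_r^2 - lam_(r+1)^2)]
    times [|(1 - Q) P0|^2], and absorbing the linear term in it gives II; replacing
    the gap by [lam_r^2] costs the sum of [lam_i^2] over [r < i <= 2r] and gives III.

    What remains is [E |E|_op^2 <= K M sqrt m4].  The entries are truncated at
    [4 p m4^(1/4)] with [p] of order [M^(1/3)].  The large parts are controlled by
    Schur's test.  For the bounded centered parts, [E tr ((A A^T)^p)] is a sum over
    closed walks using no edge exactly once; counting pairs of walks with the same
    coincidence pattern compares that sum with the same trace moment of a [2p] by
    [2p] matrix of independent entries uniform on [2, -1, -1], which is bounded by
    an exponential moment and a union bound over a grid. *)

(** The obstacle is that only four moments are available while the constant must be universal: a
    union bound over a net of the M-dimensional sphere would need exponential moments. The order of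
    [p] comes from two constraints that meet. Write L = m4^(1/4). The discarded part of an entry has
    first moment at most m4 / tau^3, which must not exceed L / M, so tau^3 has to be at least M L^3.
    In the trace sum a vertex has M choices and, when kept entries are bounded by b L, brings a
    saving of 1 / b^2; comparison with walks on 2p letters requires M <= b^2 p. With tau = 4 p L and
    b = 8 p both constraints read M <= 64 p^3. The comparison matrix has size 2p, the order of the
    moment taken, so the union bound over exp(O(p)) grid points costs only a constant after a p-th
    root. That [p] is a power of two is due to the trace estimates, which iterate squaring. Finally,
    min(r, M - r) times M is at most 2 r (M - r), which turns the M of the operator norm into the
    announced factor. *)

Section hilbert_schmidt.
Context {R : realType}.

Definition hs_dot m n (A B : 'M[R]_(m, n)) : R := \tr (A *m B^T).

Lemma hs_dotE m n (A B : 'M[R]_(m, n)) :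
  hs_dot A B = \sum_i \sum_j A i j * B i j.
Proof.
apply: eq_bigr => i _; rewrite mxE; apply: eq_bigr => j _.
by rewrite mxE.
Qed.

Lemma hs_norm2E m n (A : 'M[R]_(m, n)) : hs_norm2 A = hs_dot A A.
Proof.
by rewrite hs_dotE; apply: eq_bigr => i _; apply: eq_bigr => j _; rewrite expr2.
Qed.

Lemma hs_norm2_ge0 m n (A : 'M[R]_(m, n)) : 0 <= hs_norm2 A.
Proof. by apply: sumr_ge0 => i _; apply: sumr_ge0 => j _; exact: sqr_ge0. Qed.

Lemma hs_normX2 m n (A : 'M[R]_(m, n)) : hs_norm A ^+ 2 = hs_norm2 A.
Proof. by rewrite /hs_norm sqr_sqrtr // hs_norm2_ge0. Qed.

Lemma hs_norm2_tr m n (A : 'M[R]_(m, n)) : hs_norm2 A^T = hs_norm2 A.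
Proof.
rewrite /hs_norm2 exchange_big /=; apply: eq_bigr => i _; apply: eq_bigr => j _.
by rewrite mxE.
Qed.

Lemma hs_dotC m n (A B : 'M[R]_(m, n)) : hs_dot A B = hs_dot B A.
Proof. by rewrite /hs_dot -mxtrace_tr trmx_mul trmxK. Qed.

Lemma hs_dotDl m n (A B C : 'M[R]_(m, n)) :
  hs_dot (A + B) C = hs_dot A C + hs_dot B C.
Proof. by rewrite /hs_dot mulmxDl mxtraceD. Qed.

Lemma hs_dotZl m n a (A C : 'M[R]_(m, n)) : hs_dot (a *: A) C = a * hs_dot A C.
Proof. by rewrite /hs_dot -scalemxAl mxtraceZ. Qed.

Lemma hs_dotMl m n k (A : 'M[R]_(m, k)) B (C : 'M[R]_(m, n)) :
  hs_dot (A *m B) C = hs_dot B (A^T *m C).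
Proof. by rewrite /hs_dot -mulmxA mxtrace_mulC trmx_mul trmxK mulmxA. Qed.

Lemma hs_dotMr m n k (A : 'M[R]_(m, k)) B (C : 'M[R]_(m, n)) :
  hs_dot (A *m B) C = hs_dot A (C *m B^T).
Proof. by rewrite /hs_dot trmx_mul trmxK mulmxA. Qed.

Lemma hs_norm2D m n (A B : 'M[R]_(m, n)) :
  hs_norm2 (A + B) = hs_norm2 A + 2 * hs_dot A B + hs_norm2 B.
Proof.
rewrite !hs_norm2E hs_dotDl [hs_dot A _]hs_dotC [hs_dot B _]hs_dotC !hs_dotDl.
rewrite (hs_dotC B A); ring.
Qed.

Lemma hs_norm2Z m n a (A : 'M[R]_(m, n)) : hs_norm2 (a *: A) = a ^+ 2 * hs_norm2 A.
Proof. rewrite !hs_norm2E hs_dotZl hs_dotC hs_dotZl; ring. Qed.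

Lemma hs_norm2_eq0 m n (A : 'M[R]_(m, n)) : hs_norm2 A = 0 -> A = 0.
Proof.
move=> A0; apply/matrixP => i j; rewrite mxE; apply/eqP; rewrite -sqrf_eq0.
apply/eqP/le_anti; rewrite sqr_ge0 andbT -A0 /hs_norm2 (bigD1 i) //= (bigD1 j) //=.
by rewrite -addrA lerDl addr_ge0 ?sumr_ge0 // => k _; rewrite ?sqr_ge0 // sumr_ge0 // => l _;
  exact: sqr_ge0.
Qed.

Lemma hs_CauchySchwarz m n (A B : 'M[R]_(m, n)) :
  hs_dot A B ^+ 2 <= hs_norm2 A * hs_norm2 B.
Proof.
have [B0|B0] := eqVneq (hs_norm2 B) 0.
  by rewrite B0 mulr0 (hs_norm2_eq0 B0) /hs_dot trmx0 mulmx0 mxtrace0 expr0n.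
have Bp : 0 < hs_norm2 B by rewrite lt_def B0 hs_norm2_ge0.
have := hs_norm2_ge0 (hs_norm2 B *: A + (- hs_dot A B) *: B).
rewrite hs_norm2D !hs_norm2Z hs_dotZl (hs_dotC A) hs_dotZl (hs_dotC B A).
set a := hs_norm2 A; set b := hs_norm2 B; set c := hs_dot A B => H.
rewrite -subr_ge0 -(pmulr_rge0 _ Bp) -/b; apply: le_trans H _.
by rewrite le_eqVlt; apply/orP; left; apply/eqP; ring.
Qed.

Lemma hs_dot_le m n (A B : 'M[R]_(m, n)) a b : 0 <= a -> 0 <= b ->
  hs_norm2 A <= a ^+ 2 -> hs_norm2 B <= b ^+ 2 -> `|hs_dot A B| <= a * b.
Proof.
move=> a0 b0 Aa Bb; rewrite -ler_sqr ?nnegrE ?mulr_ge0 // real_normK ?num_real //.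
by rewrite exprMn; apply: le_trans (hs_CauchySchwarz A B) _; apply: ler_pM;
  rewrite ?hs_norm2_ge0.
Qed.

(** [N] bounds the square of the operator norm, with rows acting from the left. As a predicate it
    accepts any majorant, so the random bounds below can be chosen integrable without forming a
    supremum. *)
Definition op_le m n (A : 'M[R]_(m, n)) (N : R) :=
  forall x : 'rV[R]_m, hs_norm2 (x *m A) <= N * hs_norm2 x.

Lemma hs_norm2_rows m n (A : 'M[R]_(m, n)) : hs_norm2 A = \sum_i hs_norm2 (row i A).
Proof.
apply: eq_bigr => i _; rewrite /hs_norm2 big_ord1; apply: eq_bigr => j _.
by rewrite mxE.
Qed.

Lemma op_leM m n k (A : 'M[R]_(m, n)) N (x : 'M[R]_(k, m)) :
  op_le A N -> hs_norm2 (x *m A) <= N * hs_norm2 x.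
Proof.
move=> AN; rewrite hs_norm2_rows (hs_norm2_rows x) mulr_sumr.
by apply: ler_sum => i _; rewrite row_mul.
Qed.

Lemma op_le_trace m n (A : 'M[R]_(m, n)) : op_le A (hs_norm2 A).
Proof.
move=> x; rewrite {1}/hs_norm2 big_ord1 -(hs_norm2_tr A) (hs_norm2_rows A^T) mulr_suml.
apply: ler_sum => j _.
have := hs_CauchySchwarz x (row j A^T); rewrite mulrC hs_dotE big_ord1 mxE.
by under eq_bigr => k _ do rewrite !mxE.
Qed.

Lemma op_leD m n (A B : 'M[R]_(m, n)) a b :
  op_le A a -> op_le B b -> op_le (A + B) (2 * (a + b)).
Proof.
move=> Aa Bb x; rewrite mulmxDr -mulrA mulrDl.
have := hs_norm2_ge0 (x *m A + (-1) *: (x *m B)).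
rewrite !hs_norm2D hs_norm2Z hs_dotC hs_dotZl hs_dotC => H.
have := Aa x; have := Bb x; lra.
Qed.

Lemma op_le_ext m n (A : 'M[R]_(m, n)) a b : a <= b -> op_le A a -> op_le A b.
Proof.
by move=> ab Aa x; apply: le_trans (Aa x) _; rewrite ler_wpM2r ?hs_norm2_ge0.
Qed.

(* The iteration [|xA|^4 = <x, xS>^2 <= |x|^2 |xS|^2] with [S = A A^T] replaces
   the spectral theorem, at the price of exponents that are powers of two. *)
Lemma op_pow_trace s m n (A : 'M[R]_(m, n)) (x : 'rV[R]_m) :
  hs_norm2 (x *m A) ^+ (2 ^ s) <=
  \tr ((A *m A^T) ^+ (2 ^ s)) * hs_norm2 x ^+ (2 ^ s).
Proof.
elim: s n A => [|s IH] n A.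
  by rewrite expn0 !expr1 -/(hs_dot A A) -hs_norm2E op_le_trace.
set S := A *m A^T.
have Ssym : S^T = S by rewrite trmx_mul trmxK.
have H : hs_norm2 (x *m A) ^+ 2 <= hs_norm2 x * hs_norm2 (x *m S).
  rewrite hs_norm2E hs_dotMr -mulmxA hs_dotC hs_dotC.
  exact: hs_CauchySchwarz.
have SS : S *m S^T = S ^+ 2 by rewrite Ssym expr2.
have := IH _ S; rewrite SS -exprM -expnS => IHS.
rewrite expnS exprM; apply: (@le_trans _ _ ((hs_norm2 x * hs_norm2 (x *m S)) ^+ (2 ^ s))).
  by rewrite lerXn2r ?nnegrE ?sqr_ge0 ?mulr_ge0 ?hs_norm2_ge0.
rewrite exprMn -expnS; apply: le_trans (ler_wpM2l _ IHS) _.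
  by rewrite exprn_ge0 ?hs_norm2_ge0.
by rewrite mulrCA -exprD addnn -mul2n -expnS.
Qed.

(** Converse direction to [op_pow_trace]. Squaring again replaces the spectral theorem, since [S]
    inherits the hypothesis with [N ^+ 2]. The hypothesis is bilinear because that is what rounding
    both vectors to a grid yields. *)
Lemma trace_pow_le s m n (A : 'M[R]_(m, n)) (N : R) : 0 <= N ->
  (forall x y, hs_dot (x *m A) y ^+ 2 <= N * (hs_norm2 (x : 'rV_m) * hs_norm2 y)) ->
  \tr ((A *m A^T) ^+ (2 ^ s)) <= m%:R * N ^+ (2 ^ s).
Proof.
move=> N0; have opA k l (B : 'M[R]_(k, l)) (K : R) : 0 <= K ->
    (forall x y, hs_dot (x *m B) y ^+ 2 <= K * (hs_norm2 (x : 'rV_k) * hs_norm2 y)) ->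
    op_le B K.
  move=> K0 HB x; have [->|x0] := eqVneq (hs_norm2 (x *m B)) 0.
    by rewrite mulr_ge0 ?hs_norm2_ge0.
  have xp : 0 < hs_norm2 (x *m B) by rewrite lt_def x0 hs_norm2_ge0.
  by rewrite -(ler_pM2r xp) -mulrA; have := HB x (x *m B); rewrite -hs_norm2E expr2.
elim: s n A N N0 => [|s IH] n A N N0 HA.
  rewrite expn0 !expr1 -/(hs_dot A A) -hs_norm2E.
  rewrite -[A in hs_norm2 A]mul1mx mulrC (le_trans (op_leM _ (opA _ _ _ _ N0 HA))) //.
  rewrite ler_wpM2l // /hs_norm2 -[leRHS]mulr1 mulr_natl -[X in _ *+ X]card_ord -sumr_const.
  apply: ler_sum => i _; rewrite (bigD1 i) //= !mxE eqxx expr1n big1 ?addr0 // => j ji.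
  by rewrite mxE eq_sym (negbTE ji) expr0n.
set S := A *m A^T; have Ssym : S^T = S by rewrite trmx_mul trmxK.
have SS : S *m S^T = S ^+ 2 by rewrite Ssym expr2.
have := IH _ S (N ^+ 2) (exprn_ge0 _ N0).
rewrite SS -!exprM -!expnS; apply => x y.
rewrite mulmxA hs_dotMr trmxK.
apply: (le_trans (hs_CauchySchwarz _ _)); rewrite expr2 mulrACA.
by apply: ler_pM; rewrite ?hs_norm2_ge0 //; apply: opA.
Qed.

(** In the full-rank factorization of [A] into [col_base A] and [row_base A], idempotence forces the
    reversed product to be an identity matrix, of size the rank; the trace is cyclic. *)
Lemma mxtrace_idem n (A : 'M[R]_n) : A *m A = A -> \tr A = (\rank A)%:R.
Proof.
move=> AA; rewrite -[A in \tr A]mulmx_base mxtrace_mulC.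
suff -> : row_base A *m col_base A = 1%:M by rewrite mxtrace1.
apply: (row_free_inj (row_base_free A)); apply: (row_full_inj (col_base_full A)).
by rewrite mul1mx -(mulmxA (row_base A)) mulmx_base mulmxA mulmx_base AA.
Qed.

End hilbert_schmidt.

Section projections.
Context {R : realType} {M : nat}.
Implicit Types P Q : 'M[R]_M.

Definition is_proj P := P^T = P /\ P *m P = P.

Lemma is_proj_compl P : is_proj P -> is_proj (1%:M - P).
Proof.
move=> [Pt PP]; split; first by rewrite linearB /= Pt trmx1.
by rewrite mulmxBl mul1mx mulmxBr mulmx1 PP subrr subr0.
Qed.

Lemma hs_norm2_proj P : is_proj P -> hs_norm2 P = \tr P.
Proof. by move=> [Pt PP]; rewrite hs_norm2E /hs_dot Pt PP. Qed.

Lemma hs_norm2_projM P n (A : 'M[R]_(M, n)) : is_proj P ->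
  hs_norm2 (P *m A) = \tr (P *m (A *m A^T)).
Proof.
move=> [Pt PP]; rewrite hs_norm2E hs_dotMl mulmxA Pt PP /hs_dot trmx_mul Pt.
by rewrite (mxtrace_mulC P) mulmxA.
Qed.

Lemma hs_norm2_projM_le P n (A : 'M[R]_(M, n)) : is_proj P ->
  hs_norm2 (P *m A) <= hs_norm2 A.
Proof.
move=> Pp; have Pp' := is_proj_compl Pp.
rewrite -subr_ge0 hs_norm2_projM // [X in X - _](_ : _ = \tr (A *m A^T)); last first.
  by rewrite hs_norm2E.
by rewrite -linearB /= -{1}[A *m A^T]mul1mx -mulmxBl -hs_norm2_projM ?hs_norm2_ge0.
Qed.

Lemma hs_dot_projM P n (A B : 'M[R]_(M, n)) : is_proj P ->
  hs_dot (P *m A) (P *m B) = \tr (P *m (A *m B^T)).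
Proof.
move=> [Pt PP]; rewrite hs_dotC hs_dotMl mulmxA Pt PP hs_dotC /hs_dot.
by rewrite mulmxA.
Qed.

End projections.

(** * Closed walks and trace moments *)

Section trace_expansion.
Context {R : realType} {n : nat}.

Lemma big_tuple_cons (T : finType) k (F : T -> k.-tuple T -> R) :
  \sum_x \sum_s F x s = \sum_(u : k.+1.-tuple T) F (thead u) (behead_tuple u).
Proof.
rewrite pair_big /= [RHS](reindex (fun q : T * k.-tuple T => [tuple of q.1 :: q.2])) /=.
  apply: eq_bigr => -[x s] _ /=; rewrite theadE; congr F.
  by apply: val_inj.
exists (fun u : k.+1.-tuple T => (thead u, behead_tuple u)) => [[x s] _|u _] /=.
  by rewrite theadE; congr pair; exact: val_inj.
by rewrite [RHS]tuple_eta.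
Qed.

Lemma mx_pow_path (S : 'M[R]_n) k a b : (S ^+ k.+1) a b =
  \sum_(s : k.-tuple 'I_n) \prod_(t < k.+1) S (nth a (a :: s) t) (nth a (rcons s b) t).
Proof.
elim: k a b => [|k IH] a b.
  rewrite expr1 (big_pred1 [tuple]) ?big_ord1 // => s.
  by rewrite /= [s]tuple0; apply/esym/eqP; exact: val_inj.
rewrite exprS mxE.
transitivity (\sum_x \sum_(s : k.-tuple 'I_n) \prod_(t < k.+2)
   S (nth a (a :: x :: s) t) (nth a (rcons (x :: s) b) t)); last first.
  by rewrite big_tuple_cons; apply: eq_bigr => u _; rewrite [in RHS](tuple_eta u).
apply: eq_bigr => x _; rewrite IH mulr_sumr; apply: eq_bigr => s _.
rewrite [RHS]big_ord_recl /=; congr (_ * _); apply: eq_bigr => t _ /=.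
by congr (S _ _); apply: set_nth_default; rewrite /= ?size_rcons size_tuple.
Qed.

Lemma mxtrace_pow (S : 'M[R]_n) p : (0 < p)%N ->
  \tr (S ^+ p) = \sum_(i : {ffun 'I_p -> 'I_n}) \prod_t S (i t) (i (ordS t)).
Proof.
case: p => // k _; rewrite /mxtrace; under eq_bigr => a _ do rewrite mx_pow_path.
rewrite (big_tuple_cons (fun a s => \prod_(t < k.+1)
   S (nth a (a :: s) t) (nth a (rcons s a) t))).
rewrite (reindex (fun f : {ffun 'I_k.+1 -> 'I_n} => [tuple f t | t < k.+1])); last first.
  exists (fun u : k.+1.-tuple 'I_n => [ffun t => tnth u t]) => [f _|u _].
    by apply/ffunP => t; rewrite ffunE tnth_mktuple.
  by apply: eq_from_tnth => t; rewrite tnth_mktuple ffunE.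
apply: eq_bigr => f _; set u := [tuple f t | t < k.+1].
have uE : u = thead u :: behead u :> seq _ by rewrite {1}(tuple_eta u).
apply: eq_bigr => t _.
have fE (z : 'I_k.+1) : f z = nth (thead u) u z by rewrite -tnth_nth tnth_mktuple.
clearbody u; rewrite !fE /= -uE; congr (S _ _).
rewrite nth_rcons size_behead size_tuple /=.
have [tk|kt] := ltnP t k; first by rewrite modn_small // nth_behead.
have -> : t = k :> nat by apply/eqP; rewrite eqn_leq kt -ltnS ltn_ord.
by rewrite eqxx modnn uE.
Qed.

End trace_expansion.

Section closed_walks.
Variable p : nat.

(** Time indices of the edges of a closed bipartite walk: from row vertex [i t] to column vertex
    [j t], then on to [i (ordS t)]. These are the two factors that [A *m A^T] contributes at time
    [t]. *)
Definition walk_template : seq ('I_p * 'I_p) :=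
  [seq (t, t) | t <- enum 'I_p] ++ [seq (ordS t, t) | t <- enum 'I_p].

Definition walk_edges (S T : finType) (i : {ffun 'I_p -> S}) (j : {ffun 'I_p -> T}) :=
  [seq (i x.1, j x.2) | x <- walk_template].

(** Written through equalities between values of [i] and of [j] only, so that it depends on nothing
    but the coincidence patterns of the two maps. *)
Definition no_simple_edge (S T : finType) (i : {ffun 'I_p -> S}) (j : {ffun 'I_p -> T}) :=
  all (fun x => 1 < count (fun y => (i y.1 == i x.1) && (j y.2 == j x.2)) walk_template)%N
    walk_template.

Lemma size_walk_edges (S T : finType) (i : {ffun 'I_p -> S}) (j : {ffun 'I_p -> T}) :
  size (walk_edges i j) = p.*2.
Proof.
rewrite size_map size_cat (size_map (fun t => (t, t))) (size_map (fun t => (ordS t, t))).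
by rewrite size_enum_ord addnn.
Qed.

Lemma no_simple_edgeP (S T : finType) (i : {ffun 'I_p -> S}) (j : {ffun 'I_p -> T}) :
  reflect (forall e, count_mem e (walk_edges i j) != 1%N) (no_simple_edge i j).
Proof.
have cE x : count_mem (i x.1, j x.2) (walk_edges i j) =
    count (fun y => (i y.1 == i x.1) && (j y.2 == j x.2)) walk_template.
  by rewrite count_map; apply: eq_count => y; rewrite /= xpair_eqE.
apply: (iffP allP) => [H e|H x xt].
  have [/mapP[x xt ->]|] := boolP (e \in walk_edges i j).
    by rewrite cE; have := H _ xt; case: (count _ _) => [|[]].
  by rewrite -has_pred1 has_count -eqn0Ngt => /eqP ->.
rewrite -cE; have := H (i x.1, j x.2).
have : (0 < count_mem (i x.1, j x.2) (walk_edges i j))%N.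
  by rewrite -has_count has_pred1; apply/mapP; exists x.
by case: (count _ _) => [|[]].
Qed.

Lemma mxtrace_walks (R : realType) n (A : 'M[R]_n) : (0 < p)%N ->
  \tr ((A *m A^T) ^+ p) = \sum_(i : {ffun 'I_p -> 'I_n}) \sum_(j : {ffun 'I_p -> 'I_n})
     \prod_(e <- walk_edges i j) A e.1 e.2.
Proof.
move=> p0; rewrite mxtrace_pow //; apply: eq_bigr => i _.
under eq_bigr => t _ do rewrite mxE.
rewrite bigA_distr_bigA /=; apply: eq_bigr => j _.
rewrite /walk_edges big_map big_cat (big_map (fun t => (t, t))).
rewrite (big_map (fun t => (ordS t, t))) /= !big_enum /= -big_split /=.
by apply: eq_bigr => t _; rewrite mxE.
Qed.

(** Independence needs one factor per matrix entry, the edge count only the entries visited; this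
    passes between the two groupings. *)
Lemma prod_count (R : realType) (T : finType) (F : T -> nat -> R) (s : seq T) :
  (forall e, F e 0%N = 1) ->
  \prod_e F e (count_mem e s) = \prod_(e <- undup s) F e (count_mem e s).
Proof.
move=> F0; rewrite [RHS]big_uniq ?undup_uniq //= [RHS]big_mkcond /=.
apply: eq_bigr => e _; rewrite mem_undup; case: ifPn => //.
by rewrite -has_pred1 has_count -eqn0Ngt => /eqP ->.
Qed.

End closed_walks.

(* Along the walk every vertex other than the first is entered through an edge
   that is new whenever the vertex is. *)
Lemma walk_vertices_le p (S T : finType) (i : {ffun 'I_p -> S}) (j : {ffun 'I_p -> T}) :
  (0 < p)%N ->
  (#|codom i| + #|codom j| <= (size (undup (walk_edges i j))).+1)%N.
Proof.
case: p i j => // k i j _.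
(* Periodic extension of the walk to all times. [vI l], [vJ l] and [eE l] hold what has been visited
   after [l] double steps, latest first, so that each induction step is a cons. *)
pose i' (t : nat) := i (inord (t %% k.+1)); pose j' (t : nat) := j (inord (t %% k.+1)).
pose vI l := [seq i' t | t <- rev (iota 0 l.+1)].
pose vJ l := [seq j' t | t <- rev (iota 0 l)].
pose eE := fix eE l := if l is l'.+1 then (i' l, j' l') :: (i' l', j' l') :: eE l' else [::].
have vIS l : vI l.+1 = i' l.+1 :: vI l by rewrite /vI -[l.+2]addn1 iotaD rev_cat.
have vJS l : vJ l.+1 = j' l :: vJ l by rewrite /vJ -[l.+1]addn1 iotaD rev_cat.
have in_i l : i' l \in vI l by case: l => [|l]; rewrite ?vIS inE eqxx.
have eEin l e : e \in eE l -> (e.1 \in vI l) && (e.2 \in vJ l).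
  elim: l => // l IH; rewrite vIS vJS /= !inE => /orP[/eqP->|/orP[/eqP->|/IH/andP[-> ->]]] /=.
  - by rewrite !eqxx.
  - by rewrite in_i eqxx orbT.
  - by rewrite !orbT.
have step l : (size (undup (vI l)) + size (undup (vJ l)) <= (size (undup (eE l))).+1)%N.
  elim: l => [//|l IH].
  have H2 : i' l.+1 \notin vI l -> (i' l.+1, j' l) \notin (i' l, j' l) :: eE l.
    move=> iN; rewrite inE negb_or xpair_eqE eqxx andbT; apply/andP; split.
      by apply: contra iN => /eqP ->.
    by apply: contra iN => /eEin/andP[].
  have H1 : j' l \notin vJ l -> (i' l, j' l) \notin eE l.
    by move=> jN; apply: contra jN => /eEin/andP[].
  have sz (W : eqType) (x : W) s : size (undup (x :: s)) = ((x \notin s) + size (undup s))%N.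
    by rewrite /=; case: ifP.
  rewrite vIS vJS [eE l.+1]/= !sz; move: H1 H2.
  case: (j' l \notin vJ l) => [/(_ isT) ->|_]; case: (i' l.+1 \notin vI l) => [/(_ isT) ->|_];
    lia.
have vIm x : (x \in vI k.+1) = (x \in codom i).
  apply/mapP/codomP => [[t _ ->]|[t ->]]; first by exists (inord (t %% k.+1)).
  exists (val t); first by rewrite mem_rev mem_iota /= add0n ltnS ltnW.
  rewrite /i'; congr (i _); apply: val_inj; rewrite /= modn_small ?inordK //.
have vJm x : (x \in vJ k.+1) = (x \in codom j).
  apply/mapP/codomP => [[t _ ->]|[t ->]]; first by exists (inord (t %% k.+1)).
  exists (val t); first by rewrite mem_rev mem_iota /= add0n.
  rewrite /j'; congr (j _); apply: val_inj; rewrite /= modn_small ?inordK //.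
have eEm l : {subset eE l <= walk_edges i j}.
  elim: l => // l IH e; rewrite !inE => /orP[/eqP->|/orP[/eqP->|/IH//]].
    apply/mapP; exists (ordS (inord (l %% k.+1)), inord (l %% k.+1)).
      by rewrite mem_cat orbC map_f // mem_enum.
    rewrite /=; congr (i _, _); apply: val_inj => /=.
    rewrite !inordK ?ltn_mod // -addn1 -modnDml.
    by rewrite addn1.
  apply/mapP; exists (inord (l %% k.+1), inord (l %% k.+1)) => //.
  by rewrite mem_cat map_f // mem_enum.
have cardE' (W : finType) (s : seq W) (f : {ffun 'I_k.+1 -> W}) :
    (forall x, (x \in s) = (x \in codom f)) -> #|codom f| = size (undup s).
  move=> sf; rewrite -(card_uniqP (undup_uniq s)); apply: eq_card => x.
  by rewrite mem_undup sf.
rewrite (cardE' _ (vI k.+1)) // (cardE' _ (vJ k.+1)) //.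
apply: leq_trans (step k.+1) _; rewrite ltnS uniq_leq_size ?undup_uniq // => e.
by rewrite !mem_undup; exact: eEm.
Qed.

Lemma prodr_const_seq (R : realType) (I : Type) (s : seq I) (c : R) :
  \prod_(e <- s) c = c ^+ size s.
Proof. by rewrite big_const_seq count_predT iter_mulr_1. Qed.

(** * Coincidence patterns of walks and transfer to a smaller alphabet *)

Section kernels.
Variable p : nat.

Definition same_kernel (S T : eqType) (f : 'I_p -> S) (g : 'I_p -> T) :=
  [forall s, forall t, (f s == f t) == (g s == g t)].

Lemma same_kernelP (S T : eqType) (f : 'I_p -> S) (g : 'I_p -> T) :
  reflect (forall s t, (f s == f t) = (g s == g t)) (same_kernel f g).
Proof.
apply: (iffP forallP) => [H s t|H s]; first by have /forallP/(_ t)/eqP := H s.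
by apply/forallP => t; rewrite H.
Qed.

Lemma same_kernelC (S T : eqType) (f : 'I_p -> S) (g : 'I_p -> T) :
  same_kernel f g = same_kernel g f.
Proof. by apply/same_kernelP/same_kernelP => H s t; rewrite H. Qed.

(** A map with the kernel of [f] is an injective relabelling of the values of [f]. *)
Lemma card_same_kernel (S T : finType) (f : {ffun 'I_p -> S}) :
  #|[set g : {ffun 'I_p -> T} | same_kernel f g]| = #|T| ^_ #|codom f|.
Proof.
pose D := {x : S | x \in codom f}.
pose Phi (h : {ffun D -> T}) : {ffun 'I_p -> T} :=
  [ffun t => h (exist _ (f t) (codom_f f t))].
have surj (d : D) : {t | d = exist _ (f t) (codom_f f t)}.
  by exists (iinv (valP d)); apply: val_inj; rewrite /= f_iinv.
have -> : #|codom f| = #|{: D}| by rewrite card_sig; apply: eq_card => x; rewrite inE.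
rewrite -card_inj_ffuns -(card_imset (f := Phi)); last first.
  move=> h h' /ffunP hh; apply/ffunP => d; have [t ->] := surj d.
  by have := hh t; rewrite !ffunE.
apply: eq_card => g; rewrite inE; apply/same_kernelP/imsetP => [fg|[h hinj ->] s t].
  exists [ffun d : D => g (iinv (valP d))].
    rewrite inE; apply/injectiveP => d d'; rewrite !ffunE => /eqP; rewrite -fg !f_iinv.
    by move=> /eqP; exact: val_inj.
  apply/ffunP => t; rewrite !ffunE; apply/eqP; rewrite -fg f_iinv //.
have hI : injective h by apply/injectiveP; move: hinj; rewrite inE.
rewrite !ffunE (inj_eq hI).
by rewrite -val_eqE.
Qed.

Lemma same_kernel_card (S T : finType) (f : {ffun 'I_p -> S}) (g : {ffun 'I_p -> T}) :
  same_kernel f g -> #|codom f| = #|codom g|.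
Proof.
have le (S' T' : finType) (u : {ffun 'I_p -> S'}) (v : {ffun 'I_p -> T'}) :
    same_kernel u v -> (#|codom v| <= #|codom u|)%N.
  move=> /same_kernelP uv.
  pose h (x : {x : S' | x \in codom u}) := v (iinv (valP x)).
  have -> : #|codom u| = #|{: {x : S' | x \in codom u}}|.
    by rewrite card_sig; apply: eq_card => x; rewrite inE.
  apply: leq_trans (leq_image_card h predT); apply: subset_leq_card.
  apply/fintype.subsetP => y /codomP[t ->]; apply/codomP; exists (exist _ (u t) (codom_f u t)).
  by apply/eqP; rewrite -uv f_iinv.
by move=> fg; apply/eqP; rewrite eqn_leq !le // same_kernelC.
Qed.

Lemma leq_ffact n k : (k <= n -> (n - k) ^ k <= n ^_ k)%N.
Proof.
elim: k n => // k IH [//|n] kn; rewrite ffactnS expnS leq_mul //=; first exact: leq_subr.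
by rewrite subSS in IH *; exact: IH.
Qed.

Lemma ffact_leq_expn n k : (n ^_ k <= n ^ k)%N.
Proof. by elim: k => // k IH; rewrite ffactnSr expnSr leq_mul ?leq_subr. Qed.

(* Double counting of the pairs of maps with equal kernels. *)
Lemma kernel_transfer (R : realType) N (a : R) (G : {ffun 'I_p -> 'I_N} -> R)
    (H : {ffun 'I_p -> 'I_p.*2} -> R) : (0 < p)%N -> 0 < a -> N%:R <= a * p%:R ->
  (forall g, 0 <= H g) ->
  (forall (f : {ffun 'I_p -> 'I_N}) (g : {ffun 'I_p -> 'I_p.*2}), same_kernel f g -> G f = H g) ->
  \sum_f G f / a ^+ #|codom f| <= \sum_g H g.
Proof.
move=> p0 a0 Na H0 GH.
have cp (T : finType) (f : {ffun 'I_p -> T}) : (#|codom f| <= p)%N.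
  by rewrite -[X in (_ <= X)%N]card_ord; exact: leq_image_card.
(* The alphabet size 2p enters here: at most p values are used, so each successive choice still has
   at least p letters left. *)
have ge k : (k <= p)%N -> (p ^ k <= p.*2 ^_ k)%N.
  move=> kp; apply: leq_trans (leq_ffact (leq_trans kp _)); last by rewrite -addnn leq_addr.
  by case: k kp => // k kp; rewrite leq_exp2r // -addnn -addnBA // leq_addr.
pose w k : R := (a ^+ k * (p.*2 ^_ k)%:R)^-1.
have pk k : (k <= p)%N -> 0 < (p.*2 ^_ k)%:R :> R.
  by move=> kp; rewrite ltr0n; apply: leq_trans (ge _ kp); rewrite expn_gt0 p0.
(* Each [f] shares its weight equally among the maps into the small alphabet with its kernel. *)
have GE f : G f / a ^+ #|codom f| =
    \sum_(g : {ffun 'I_p -> 'I_p.*2} | same_kernel f g) H g * w #|codom g|.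
  rewrite (eq_bigr (fun=> G f * w #|codom f|)); last first.
    by move=> g fg; rewrite (GH _ _ fg) (same_kernel_card fg).
  rewrite sumr_const (_ : #|_| = p.*2 ^_ #|codom f|)%N; last first.
    by rewrite -[X in _ = X ^_ _]card_ord -card_same_kernel; apply: eq_card => g; rewrite inE.
  rewrite -mulr_natr /w -mulrA; congr (_ * _).
  by rewrite invfM -mulrA mulVf ?mulr1 // gt_eqF // pk.
under eq_bigr => f _ do rewrite GE.
rewrite (exchange_big_dep predT) //=; apply: ler_sum => g _.
rewrite sumr_const -[leRHS]mulr1 -mulrnAr ler_wpM2l //.
rewrite (_ : #|_| = N ^_ #|codom g|)%N; last first.
  rewrite -[X in _ = X ^_ _]card_ord -card_same_kernel; apply: eq_card => f.
  by rewrite inE same_kernelC.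
(* A given [g] with k values receives [N ^_ k] shares, and [N ^_ k] <= N^k <= a^k p^k <= a^k
   (2p)^_k. *)
rewrite -mulr_natr mulrC ler_pdivrMr ?mul1r ?mulr_gt0 ?exprn_gt0 ?pk //.
apply: (@le_trans _ _ ((N ^ #|codom g|)%:R)).
  by rewrite ler_nat ffact_leq_expn.
rewrite natrX (le_trans (lerXn2r _ _ _ Na)) ?nnegrE ?ler0n ?mulr_ge0 ?(ltW a0) //.
by rewrite exprMn ler_wpM2l ?exprn_ge0 ?(ltW a0) // -natrX ler_nat ge.
Qed.

Lemma no_simple_edge_kernel (S S' T T' : finType) (i : {ffun 'I_p -> S})
    (i' : {ffun 'I_p -> S'}) (j : {ffun 'I_p -> T}) (j' : {ffun 'I_p -> T'}) :
  same_kernel i i' -> same_kernel j j' -> no_simple_edge i j = no_simple_edge i' j'.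
Proof.
move=> /same_kernelP ii /same_kernelP jj; apply: eq_all => x.
by congr (1 < _)%N; apply: eq_count => y; rewrite ii jj.
Qed.

(** [kernel_transfer] is applied to the row map for each fixed column map, and then to the column
    map. *)
Lemma walk_count_transfer (R : realType) N (a : R) :
  (0 < p)%N -> 0 < a -> N%:R <= a * p%:R ->
  \sum_(i : {ffun 'I_p -> 'I_N}) \sum_(j : {ffun 'I_p -> 'I_N})
    (no_simple_edge i j)%:R / a ^+ (#|codom i| + #|codom j|) <=
  \sum_(i : {ffun 'I_p -> 'I_p.*2}) \sum_(j : {ffun 'I_p -> 'I_p.*2})
    (no_simple_edge i j)%:R.
Proof.
move=> p0 a0 Na; rewrite exchange_big [leRHS]exchange_big /=.
have kxx (T : finType) (f : {ffun 'I_p -> T}) : same_kernel f f by exact/same_kernelP.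
pose G (j : {ffun 'I_p -> 'I_N}) : R :=
  \sum_(i : {ffun 'I_p -> 'I_p.*2}) (no_simple_edge i j)%:R.
apply: (@le_trans _ _ (\sum_j G j / a ^+ #|codom j|)); last first.
  apply: (kernel_transfer p0 a0 Na) => [g|f g fg]; first exact: sumr_ge0.
  by apply: eq_bigr => i _; rewrite (no_simple_edge_kernel (kxx _ i) fg).
apply: ler_sum => j _.
under eq_bigr => i _ do rewrite exprD invfM mulrA.
rewrite -mulr_suml ler_wpM2r ?invr_ge0 ?exprn_ge0 ?(ltW a0) //.
apply: (kernel_transfer p0 a0 Na) => // f g fg.
by rewrite (no_simple_edge_kernel fg (kxx _ j)).
Qed.

(** A simple edge contributes a factor of mean zero. Otherwise every distinct edge saves a factor
    [b ^+ 2], and a walk has at least as many distinct edges as vertices minus one; the possibly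
    missing edge is the isolated [b ^+ 2] on the right. *)
Lemma walk_moment_le (R : realType) N (mu : 'I_N * 'I_N -> nat -> R) (L b : R)
    (i j : {ffun 'I_p -> 'I_N}) : (0 < p)%N -> 0 < L -> 1 <= b ->
  (forall e, mu e 0%N = 1) -> (forall e, mu e 1%N = 0) ->
  (forall e n, (1 < n)%N -> `|mu e n| <= L ^+ n * b ^+ n / b ^+ 2) ->
  \prod_e mu e (count_mem e (walk_edges i j)) <=
  L ^+ p.*2 * b ^+ p.*2 * b ^+ 2 *
    ((no_simple_edge i j)%:R / (b ^+ 2) ^+ (#|codom i| + #|codom j|)).
Proof.
move=> p0 L0 b1 mu0 mu1 mun; have b0 : 0 < b by exact: lt_le_trans b1.
case: no_simple_edgeP => [ns|/asboolP]; last first.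
  rewrite asboolE => /existsNP[e /negP]; rewrite negbK => /eqP e1.
  by rewrite (bigD1 e) //= e1 mu1 !mul0r mulr0.
rewrite prod_count //; set s := walk_edges i j in ns *.
apply: le_trans (ler_norm _) _; rewrite normr_prod.
apply: (@le_trans _ _ (\prod_(e <- undup s) ((L * b) ^+ count_mem e s / b ^+ 2))).
  rewrite big_seq [leRHS]big_seq; apply: ler_prod => e; rewrite mem_undup => es.
  rewrite normr_ge0 exprMn mun //.
  by have := ns e; move: es; rewrite -has_pred1 has_count; case: (count _ _) => [|[]].
rewrite big_split /= prodr_undup_exp_count !prodr_const_seq size_walk_edges mul1r exprMn.
rewrite -[leRHS]mulrA ler_wpM2l ?mulr_ge0 ?exprn_ge0 ?(ltW L0) ?(ltW b0) //.
have c1 : 1 <= b ^+ 2 by rewrite exprn_ege1.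
have cp : 0 < b ^+ 2 by rewrite exprn_gt0.
rewrite exprVn ler_pdivlMr ?exprn_gt0 // mulrC ler_pdivrMr ?exprn_gt0 // -exprS.
exact/ler_weXn2l/walk_vertices_le.
Qed.

End kernels.

(** * Spectral projections and the excess risk *)

Section singular_values_facts.
Context {R : realType} {M : nat} {C : 'M[R]_M} {lam : nat -> R}.
Hypothesis svC : singular_values C lam.

Lemma lam_ge0 i : (0 < i)%N -> 0 <= lam i.
Proof.
case: svC => lam0 [lamp _] i0; have [iM|Mi] := leqP i M; first by rewrite lamp ?i0.
by rewrite lam0.
Qed.

Lemma lam_anti i j : (0 < i)%N -> (i <= j)%N -> lam j <= lam i.
Proof.
move=> i0 ij; case: svC => lam0 [_ [lamd _]]; have [jM|Mj] := leqP j M; first exact: lamd.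
by rewrite lam0 // lam_ge0.
Qed.

Lemma lam2_anti i j : (0 < i)%N -> (i <= j)%N -> lam j ^+ 2 <= lam i ^+ 2.
Proof.
move=> i0 ij; rewrite lerXn2r ?nnegrE ?lam_ge0 //; first exact: leq_trans ij.
exact: lam_anti.
Qed.

End singular_values_facts.

Lemma mxtrace_mul_diag (R : realType) n (A : 'M[R]_n) (d : 'rV[R]_n) :
  \tr (A *m diag_mx d) = \sum_i A i i * d 0 i.
Proof.
apply: eq_bigr => i _; rewrite mxE (bigD1 i) //= !mxE eqxx mulr1n big1 ?addr0 // => j ji.
by rewrite !mxE (negbTE ji) mulr0n mulr0.
Qed.

Lemma sum_ord_geq (R : realType) (m n : nat) (F : nat -> R) :
  \sum_(i < n | (m <= i)%N) F i = \sum_(m <= i < n) F i.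
Proof. by rewrite big_geq_mkord. Qed.

Section top_projection.
Context {R : realType} {M : nat} {C : 'M[R]_M} {lam : nat -> R} {U V : 'M[R]_M}.
Hypotheses (oU : orthogonal_mx U) (oV : orthogonal_mx V).
Hypothesis CE : C = U *m diag_mx (\row_(i < M) lam i.+1) *m V^T.
Hypothesis svC : singular_values C lam.
Variable r : nat.
Hypotheses (r1 : (1 <= r)%N) (rM : (r <= M)%N).

Let U1 : U^T *m U = 1%:M. Proof. exact: mulmx1C. Qed.
Let V1 : V^T *m V = 1%:M. Proof. exact: mulmx1C. Qed.

Definition top_proj : 'M[R]_M := U *m pid_mx r *m U^T.

Let pidE : (pid_mx r : 'M[R]_M) = diag_mx (\row_(i < M) (i < r)%N%:R).
Proof.
apply/matrixP => i j; rewrite !mxE -val_eqE /=.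
by case: (_ == _); rewrite /= ?mulr1n ?mulr0n.
Qed.

Lemma top_proj_is_proj : is_proj top_proj.
Proof.
split; first by rewrite !trmx_mul trmxK tr_pid_mx mulmxA.
rewrite /top_proj !mulmxA -[_ *m U^T *m U]mulmxA U1 mulmx1.
by rewrite -[U *m _ *m _]mulmxA mul_pid_mx minnn (minn_idPr rM).
Qed.

Lemma top_proj_rank : \rank top_proj = r.
Proof.
have uU : U \in unitmx by case/mulmx1_unit: oU.
have uUt : U^T \in unitmx by rewrite unitmx_tr.
rewrite /top_proj mxrankMfree ?row_free_unit //.
by rewrite eqmxMfull ?row_full_unit // rank_pid_mx.
Qed.

Lemma top_proj_trace : \tr top_proj = r%:R.
Proof. by rewrite mxtrace_idem ?top_proj_rank //; case: top_proj_is_proj. Qed.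

Lemma op_le_singular : op_le C (lam 1%N ^+ 2).
Proof.
move=> x; rewrite CE !mulmxA.
have normV m (y : 'M[R]_(m, M)) W : W^T *m W = 1%:M -> hs_norm2 (y *m W^T) = hs_norm2 y.
  by move=> W1; rewrite !hs_norm2E hs_dotMr trmxK -mulmxA W1 mulmx1.
rewrite normV // -[x in leRHS](mulmx1 x) -U1.
rewrite (_ : hs_norm2 (x *m (U^T *m U)) = hs_norm2 (x *m U)); last first.
  by rewrite U1 mulmx1 -[LHS](normV _ _ _ U^T) trmxK.
rewrite /hs_norm2 !big_ord1 mulr_sumr; apply: ler_sum => j _.
rewrite mul_mx_diag !mxE exprMn mulrC ler_wpM2r ?sqr_ge0 //.
exact: (lam2_anti svC).
Qed.

Variable Q : 'M[R]_M.
Hypotheses (pQ : is_proj Q) (tQ : \tr Q = r%:R).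

(** The squared norm |Q u_i|^2 for the left singular vector u_i. These numbers lie in [0,1], sum to
    [r], and are all that the comparison of |QC| with |P0 C| sees of [Q]. *)
Let q (i : 'I_M) : R := (U^T *m Q *m U) i i.

Let rotQ : is_proj (U^T *m Q *m U).
Proof.
case: pQ => Qt QQ; split; first by rewrite !trmx_mul trmxK Qt mulmxA.
rewrite !mulmxA -[_ *m U *m U^T]mulmxA (oU : U *m U^T = _) mulmx1.
by rewrite -[U^T *m Q *m Q]mulmxA QQ.
Qed.

Let diag_proj (A : 'M[R]_M) i : is_proj A -> 0 <= A i i.
Proof.
move=> [At AA]; rewrite -AA mxE; apply: sumr_ge0 => j _.
by rewrite -{2}At mxE -expr2 sqr_ge0.
Qed.

Let q01 i : 0 <= q i <= 1.
Proof.
rewrite diag_proj //=; have := diag_proj i (is_proj_compl rotQ).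
by rewrite /q; move: (U^T *m Q *m U) => W; rewrite !mxE eqxx subr_ge0.
Qed.

Let sumq : \sum_i q i = r%:R.
Proof.
rewrite -[LHS]/(\tr (U^T *m Q *m U)) mxtrace_mulC mulmxA.
by rewrite (oU : U *m U^T = _) mul1mx.
Qed.

Let traceC : \tr (Q *m (C *m C^T)) = \sum_(i < M) lam i.+1 ^+ 2 * q i.
Proof.
rewrite CE !trmx_mul trmxK !mulmxA -[_ *m V^T *m V]mulmxA V1 mulmx1 tr_diag_mx.
rewrite mxtrace_mulC !mulmxA -[_ *m diag_mx _ *m diag_mx _]mulmxA mulmx_diag mxtrace_mul_diag.
by apply: eq_bigr => i _; rewrite -/(q i) !mxE mulrC expr2.
Qed.

Let traceP : \tr (top_proj *m Q) = \sum_(i < M) (i < r)%N%:R * q i.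
Proof.
rewrite /top_proj -mulmxA -mulmxA mxtrace_mulC pidE mulmxA.
rewrite -!mulmxA mxtrace_mulC mxtrace_mul_diag !mulmxA.
by apply: eq_bigr => i _; rewrite -/(q i) mxE mulrC.
Qed.

(** The trace is the squared Hilbert-Schmidt norm of (1 - P0) Q, the distance called [h2] later on:
    the mass that [Q] puts on the singular vectors beyond the first [r]. *)
Lemma hnorm_sum : \tr ((1%:M - top_proj) *m Q) = \sum_(i < M | (r <= i)%N) q i.
Proof.
rewrite mulmxBl mul1mx linearB /= traceP tQ -sumq -sumrB [RHS]big_mkcond /=.
by apply: eq_bigr => i _; rewrite ltnNge; case: (r <= i)%N; rewrite /= ?mul0r ?mul1r ?subr0 ?subrr.
Qed.

Lemma hnorm_ge0 : 0 <= \tr ((1%:M - top_proj) *m Q).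
Proof. by rewrite hnorm_sum sumr_ge0 // => i _; case/andP: (q01 i). Qed.

Lemma hnorm_le_r : \tr ((1%:M - top_proj) *m Q) <= r%:R.
Proof.
rewrite hnorm_sum -sumq big_mkcond; apply: ler_sum => i _; case: ifP => // _.
by case/andP: (q01 i).
Qed.

Lemma hnorm_le_Mr : \tr ((1%:M - top_proj) *m Q) <= (M - r)%:R.
Proof.
rewrite hnorm_sum (le_trans (y := \sum_(i < M | (r <= i)%N) 1)) //.
  by apply: ler_sum => i _; case/andP: (q01 i).
by rewrite (sum_ord_geq r M (fun=> 1)) sumr_const_nat.
Qed.

(** Both squared norms are traces against C C^T, which is diagonal in the basis [U]. The variable
    [n2] lets [erefl] turn the lemma into a rewrite rule. *)
Lemma hs_norm2_top_projC_ge n2 : n2 = hs_norm2 (top_proj *m C) - hs_norm2 (Q *m C) ->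
  n2 = \sum_(i < M) lam i.+1 ^+ 2 * ((i < r)%N%:R - q i).
Proof.
move=> ->; rewrite !hs_norm2_projM //; last exact: top_proj_is_proj.
rewrite traceC; under [RHS]eq_bigr => i _ do rewrite mulrBr; rewrite sumrB; congr (_ - _).
rewrite CE !trmx_mul trmxK !mulmxA -[_ *m V^T *m V]mulmxA V1 mulmx1 tr_diag_mx /top_proj.
rewrite mxtrace_mulC !mulmxA U1 mul1mx -[_ *m U^T *m U]mulmxA U1 mulmx1.
rewrite -[_ *m diag_mx _ *m diag_mx _]mulmxA mulmx_diag mxtrace_mul_diag.
apply: eq_bigr => i _; rewrite pidE !mxE eqxx mulr1n; ring.
Qed.

Let sum_deficit : \sum_(i < M) ((i < r)%N%:R - q i) = 0.
Proof.
rewrite sumrB sumq -(big_mkord xpredT (fun i => (i < r)%N%:R)) /=.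
rewrite (big_cat_nat (n := r)) //=.
have -> : \sum_(r <= i < M) (i < r)%N%:R = 0 :> R.
  by rewrite big_nat big1 // => i /andP[ri _]; rewrite ltnNge ri.
have -> : \sum_(0 <= i < r) (i < r)%N%:R = \sum_(0 <= i < r) 1 :> R.
  by rewrite [LHS]big_nat [RHS]big_nat; apply: eq_bigr => i /andP[_ ->].
by rewrite sumr_const_nat subn0 addr0 subrr.
Qed.

Lemma gap_spectral : (lam r ^+ 2 - lam r.+1 ^+ 2) * \tr ((1%:M - top_proj) *m Q) <=
  hs_norm2 (top_proj *m C) - hs_norm2 (Q *m C).
Proof.
rewrite (hs_norm2_top_projC_ge erefl) hnorm_sum mulr_sumr big_mkcond /=.
(* Adding [lam r ^+ 2] times the vanishing sum of deficits makes the inequality true term by term: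
   below [r] the difference is nonnegative, and from [r] on it is at least the gap times [q i]. *)
rewrite -[leLHS]add0r -[X in X + _ <= _](mulr0 (lam r ^+ 2)) -[X in _ * X + _]sum_deficit.
rewrite [X in X + _ <= _]mulr_sumr -big_split /=.
apply: ler_sum => i _; have /andP[q0 q1] := q01 i.
have [ri|ir] := leqP r i; rewrite ?ri //= ?leqNgt ?ir /=.
  have := lam2_anti svC (ltn0Sn r) (ri : (r.+1 <= i.+1)%N); nra.
have := lam2_anti svC (ltn0Sn i) ir; nra.
Qed.

(** Bathtub argument: [Q] has mass at most [r] beyond the first [r] singular vectors, at most 1 on
    each, so it collects no more than the [r] largest remaining squares, those of index r+1 to
    2r. *)
Lemma gap_tail : lam r ^+ 2 * \tr ((1%:M - top_proj) *m Q) -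
    \sum_(r.+1 <= i < r.*2.+1) lam i ^+ 2 <=
  hs_norm2 (top_proj *m C) - hs_norm2 (Q *m C).
Proof.
(* The level of the bathtub: the excess over [nu] is counted with full weight up to index 2r, and
   all the mass pays [nu] per unit, which the term [r%:R * nu] of [sumS] offsets. *)
set nu := lam r.*2 ^+ 2.
have nuP i : (r <= i < r.*2)%N -> 0 <= lam i.+1 ^+ 2 - nu.
  by move=> /andP[_ i2]; rewrite subr_ge0 (lam2_anti svC).
have sumS : \sum_(r <= i < r.*2) (lam i.+1 ^+ 2 - nu) =
    \sum_(r.+1 <= i < r.*2.+1) lam i ^+ 2 - r%:R * nu.
  by rewrite sumrB big_add1 /= sumr_const_nat -addnn addnK mulr_natl.
have tail : \sum_(i < M | (r <= i)%N) lam i.+1 ^+ 2 * q i <=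
    nu * \tr ((1%:M - top_proj) *m Q) + \sum_(r <= i < r.*2) (lam i.+1 ^+ 2 - nu).
  rewrite hnorm_sum mulr_sumr.
  apply: (@le_trans _ _ (\sum_(i < M | (r <= i)%N)
      (nu * q i + (i < r.*2)%N%:R * (lam i.+1 ^+ 2 - nu)))).
    apply: ler_sum => i ri; have /andP[q0 q1] := q01 i.
    have [i2|i2] := ltnP i r.*2; rewrite /= ?mul1r ?mul0r.
      have := nuP i; rewrite ri i2 => /(_ isT); nra.
    have r2 : (0 < r.*2)%N by rewrite double_gt0.
    have := lam2_anti svC r2 (leqW i2); rewrite -/nu; nra.
  rewrite big_split lerD2l /= (sum_ord_geq r M
      (fun i => (i < r.*2)%N%:R * (lam i.+1 ^+ 2 - nu))).
  have [Mr|rM2] := leqP M r.*2.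
    rewrite [leRHS](big_cat_nat (n := M)) //= -[leLHS]addr0 lerD //.
      rewrite big_nat_cond [leRHS]big_nat_cond; apply: ler_sum => i /andP[/andP[ri iM] _].
      by rewrite (leq_trans iM Mr) mul1r.
    rewrite big_nat_cond sumr_ge0 // => i /andP[/andP[Mi i2] _].
    by rewrite nuP // i2 (leq_trans rM).
  rewrite (big_cat_nat (n := r.*2)) ?(ltnW rM2) //=; last by rewrite -addnn leq_addr.
  have -> : \sum_(r.*2 <= i < M) (i < r.*2)%N%:R * (lam i.+1 ^+ 2 - nu) = 0.
    by rewrite big_nat big1 // => i /andP[i2 _]; rewrite ltnNge i2 mul0r.
  rewrite addr0.
  rewrite big_nat_cond [leRHS]big_nat_cond; apply: ler_sum => i /andP[/andP[ri i2] _].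
  by rewrite i2 mul1r.
have main : lam r ^+ 2 * \tr ((1%:M - top_proj) *m Q) -
    \sum_(i < M | (r <= i)%N) lam i.+1 ^+ 2 * q i <=
    \sum_(i < M) lam i.+1 ^+ 2 * ((i < r)%N%:R - q i).
  rewrite hnorm_sum mulr_sumr -sumrB big_mkcond /=.
  rewrite -[leLHS]add0r -[X in X + _ <= _](mulr0 (lam r ^+ 2)) -[X in _ * X + _]sum_deficit.
  rewrite [X in X + _ <= _]mulr_sumr -big_split /=.
  apply: ler_sum => i _; have /andP[q0 q1] := q01 i.
  have [ri|ir] := leqP r i; rewrite ?ri //= ?leqNgt ?ir /=.
    lra.
  have := lam2_anti svC (ltn0Sn i) ir; nra.
rewrite (hs_norm2_top_projC_ge erefl).
have := hnorm_le_r; have := hnorm_ge0; have nu0 : 0 <= nu by exact: sqr_ge0.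
rewrite sumS in tail; nra.
Qed.

End top_projection.

(** * Linear and quadratic noise terms for two projections of equal rank *)

Section perturbation.
Context {R : realType} {M : nat} (P Q C E : 'M[R]_M) (r : nat) (c e : R).
Hypotheses (pP : is_proj P) (pQ : is_proj Q) (rM : (r <= M)%N).
Hypotheses (tP : \tr P = r%:R) (tQ : \tr Q = r%:R) (c0 : 0 <= c) (e0 : 0 <= e).
Hypotheses (Cc : op_le C (c ^+ 2)) (Ee : op_le E (e ^+ 2)).

Let P' := 1%:M - P.
Let Q' := 1%:M - Q.
Let pP' : is_proj P'. Proof. exact: is_proj_compl. Qed.
Let pQ' : is_proj Q'. Proof. exact: is_proj_compl. Qed.
Let tP' : \tr P' = (M - r)%:R. Proof. by rewrite linearB /= mxtrace1 tP natrB. Qed.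
Let tQ' : \tr Q' = (M - r)%:R. Proof. by rewrite linearB /= mxtrace1 tQ natrB. Qed.
Let m := minn r (M - r).

Let dot_le n (A : 'M[R]_(n, M)) : `|hs_dot (A *m C) (A *m E)| <= c * e * hs_norm2 A.
Proof.
rewrite -ler_sqr ?nnegrE ?mulr_ge0 ?hs_norm2_ge0 // real_normK ?num_real //.
apply: le_trans (hs_CauchySchwarz _ _) _.
rewrite (_ : _ ^+ 2 = (c ^+ 2 * hs_norm2 A) * (e ^+ 2 * hs_norm2 A)); last by ring.
by apply: ler_pM; rewrite ?hs_norm2_ge0 //; exact: op_leM.
Qed.

Let crossE (A B : 'M[R]_M) : is_proj A -> is_proj B ->
  hs_dot (A *m C) (A *m E) - hs_dot (B *m C) (B *m E) = \tr ((A - B) *m (C *m E^T)).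
Proof. by move=> pA pB; rewrite !hs_dot_projM // mulmxBl linearB. Qed.

(** Only [Q - P] enters the difference and it equals [P' - Q'], so the complementary projections can
    be used when their rank is the smaller one; this produces the minimum [m]. *)
Lemma cross_term_le : hs_dot (Q *m C) (Q *m E) - hs_dot (P *m C) (P *m E) <=
  2 * m%:R * c * e.
Proof.
have bound (A B : 'M[R]_M) k : is_proj A -> is_proj B -> \tr A = k -> \tr B = k ->
    hs_dot (A *m C) (A *m E) - hs_dot (B *m C) (B *m E) <= 2 * k * c * e.
  move=> pA pB tA tB; have := dot_le A; have := dot_le B.
  rewrite !hs_norm2_proj // tA tB !ler_norml => /andP[+ _] /andP[_ +]; lra.
rewrite /m /minn; case: ifP => _; first exact: bound.
have -> : hs_dot (Q *m C) (Q *m E) - hs_dot (P *m C) (P *m E) =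
    hs_dot (P' *m C) (P' *m E) - hs_dot (Q' *m C) (Q' *m E).
  rewrite !crossE //; congr (\tr (_ *m _)); rewrite /P' /Q'.
  by apply/matrixP => i j; rewrite !mxE; ring.
exact: bound.
Qed.

Lemma noise_term_le : hs_norm2 (Q *m E) - hs_norm2 (P *m E) <= m%:R * e ^+ 2.
Proof.
have bound (A : 'M[R]_M) k : is_proj A -> \tr A = k -> hs_norm2 (A *m E) <= k * e ^+ 2.
  move=> pA tA; rewrite -tA -(hs_norm2_proj pA) mulrC; exact: op_leM.
rewrite /m /minn; case: ifP => _.
  by apply: le_trans (bound Q _ pQ tQ); rewrite gerBl hs_norm2_ge0.
apply: le_trans (bound P' _ pP' tP'); rewrite !hs_norm2_projM //.
rewrite -linearB /= -mulmxBl -subr_ge0 -linearB /= -mulmxBl.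
rewrite (_ : P' - (Q - P) = Q'); first by rewrite -hs_norm2_projM ?hs_norm2_ge0.
by rewrite /P' /Q' opprB addrA subrK.
Qed.

Let h2 := \tr (P' *m Q).

(** In the block form of [Q - P] along [P] and [P'] the diagonal blocks are of second order and
    contribute at most [h2 * c * e] each. The off-diagonal blocks have Hilbert-Schmidt norm at most
    the root of [h2] and meet only the off-diagonal blocks of [C *m E^T]. *)
Lemma cross_term_split (F1 F2 : R) : 0 <= F1 -> 0 <= F2 ->
  hs_norm2 (P' *m (C *m E^T) *m P) <= F1 ^+ 2 ->
  hs_norm2 (P *m (C *m E^T) *m P') <= F2 ^+ 2 ->
  hs_dot (Q *m C) (Q *m E) - hs_dot (P *m C) (P *m E) <=
  Num.sqrt h2 * (F1 + F2) + 2 * h2 * c * e.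
Proof.
move=> F10 F20 HF1 HF2; rewrite crossE //; set G := C *m E^T.
have QP2 : hs_norm2 (Q *m P') = h2.
  by rewrite hs_norm2_projM // /h2 mxtrace_mulC; case: pP' => -> ->.
have h20 : 0 <= h2 by rewrite -QP2 hs_norm2_ge0.
have Q'P2 : hs_norm2 (Q' *m P) = h2.
  rewrite hs_norm2_projM //; case: (pP) => -> ->.
  rewrite /h2 /Q' /P' !mulmxBl !mul1mx !linearB /= tP tQ; congr (_ - _).
  exact: mxtrace_mulC.
have hs : Num.sqrt h2 ^+ 2 = h2 by rewrite sqr_sqrtr.
case: (pP) => Pt PP; case: (pP') => P't P'P'.
have -> : Q - P = P' *m Q *m P' - P *m Q' *m P + P' *m Q *m P + P *m Q *m P'.
  rewrite /P' /Q' !(mulmxBl, mulmxBr, mul1mx, mulmx1) PP.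
  by apply/matrixP => i j; rewrite !mxE; ring.
rewrite 3!mulmxDl mulNmx 3!mxtraceD [X in _ + X + _ + _]linearN /=.
have diag (A B : 'M[R]_M) : is_proj A -> is_proj B -> hs_norm2 (A *m B) = h2 ->
    `|\tr (B *m A *m B *m G)| <= h2 * c * e.
  move=> pA pB AB; case: (pB) => Bt _.
  case: (pA) => At AA; have -> : \tr (B *m A *m B *m G) = hs_dot (A *m B *m C) (A *m B *m E).
    rewrite /hs_dot !trmx_mul At Bt /G !mulmxA [RHS]mxtrace_mulC !mulmxA AA.
    by rewrite [RHS]mxtrace_mulC !mulmxA.
  have := dot_le (A *m B); rewrite AB.
  by move=> H; apply: le_trans H _; rewrite le_eqVlt; apply/orP; left; apply/eqP; ring.
have off (A B : 'M[R]_M) (F : R) : is_proj A -> is_proj B -> 0 <= F ->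
    hs_norm2 (A *m Q *m B) <= h2 -> hs_norm2 (B *m G *m A) <= F ^+ 2 ->
    \tr (A *m Q *m B *m G) <= Num.sqrt h2 * F.
  move=> [At AA] [Bt BB] F0 H1 H2.
  have -> : \tr (A *m Q *m B *m G) = hs_dot (A *m Q *m B) (B *m G *m A)^T.
    by rewrite /hs_dot trmxK !mulmxA [RHS]mxtrace_mulC !mulmxA AA -(mulmxA _ B B) BB.
  apply: le_trans (ler_norm _) _; apply: hs_dot_le; rewrite ?sqrtr_ge0 ?hs ?hs_norm2_tr //.
have d1 := diag _ _ pQ pP' QP2; have d2 := diag _ _ pQ' pP Q'P2.
have o1 : \tr (P' *m Q *m P *m G) <= Num.sqrt h2 * F2.
  apply: off => //; rewrite -hs_norm2_tr !trmx_mul Pt P't; case: (pQ) => -> _.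
  by rewrite -QP2; exact: hs_norm2_projM_le.
have o2 : \tr (P *m Q *m P' *m G) <= Num.sqrt h2 * F1.
  by apply: off => //; rewrite -QP2 -mulmxA; exact: hs_norm2_projM_le.
move: d1 d2; rewrite !ler_norml => /andP[_ d1] /andP[d2 _]; lra.
Qed.

End perturbation.

(** * A three-point comparison matrix *)

Section three_point_matrix.
Context {R : realType}.

(* The uniform law on these three values is centered and its moments of order at
   least 2 are at least 1: it charges exactly the walks without simple edge. *)
Definition tri (c : 'I_3) : R := if c == ord0 then 2 else -1.

Lemma tri_sum (F : R -> R) : \sum_c F (tri c) = F 2 + F (-1) + F (-1).
Proof. by rewrite !big_ord_recl big_ord0 addr0 /tri /= addrA. Qed.

Definition tri_moment n : R := (\sum_c tri c ^+ n) / 3.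

Lemma tri_moment0 : tri_moment 0 = 1.
Proof. by rewrite /tri_moment (tri_sum (fun x => x ^+ 0)) !expr0; field. Qed.

Lemma tri_moment1 : tri_moment 1 = 0.
Proof. by rewrite /tri_moment (tri_sum (fun x => x ^+ 1)) !expr1; field. Qed.

Lemma tri_moment_ge1 n : (1 < n)%N -> 1 <= tri_moment n.
Proof.
rewrite /tri_moment (tri_sum (fun x => x ^+ n)) ler_pdivlMr // mul1r.
case: n => [|[|[|n]]] // _; first by rewrite sqrrN expr1n; lra.
have h : 8 <= 2 ^+ n.+3 :> R.
  rewrite !exprS !mulrA -[leLHS]mulr1 ler_pM //; first lra.
  by rewrite exprn_ege1 //; lra.
have : -1 <= (-1) ^+ n.+3 :> R by rewrite -signr_odd; case: odd; rewrite ?expr1 ?expr0; lra.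
lra.
Qed.

Definition tri_avg n (F : {ffun 'I_n * 'I_n -> 'I_3} -> R) : R :=
  (\sum_w F w) / 3 ^+ #|{: 'I_n * 'I_n}|.

Definition tri_mx n (w : {ffun 'I_n * 'I_n -> 'I_3}) : 'M[R]_n :=
  \matrix_(a, b) tri (w (a, b)).

Lemma tri_avg_sum n (I : Type) (s : seq I) (Q : pred I)
    (F : I -> {ffun 'I_n * 'I_n -> 'I_3} -> R) :
  tri_avg (fun w => \sum_(i <- s | Q i) F i w) = \sum_(i <- s | Q i) tri_avg (F i).
Proof. by rewrite /tri_avg exchange_big /= mulr_suml. Qed.

Lemma tri_avgZ n c (F : {ffun 'I_n * 'I_n -> 'I_3} -> R) :
  tri_avg (fun w => c * F w) = c * tri_avg F.
Proof. by rewrite /tri_avg -mulr_sumr mulrA. Qed.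

Lemma tri_avg_le n (F G : {ffun 'I_n * 'I_n -> 'I_3} -> R) :
  (forall w, F w <= G w) -> tri_avg F <= tri_avg G.
Proof.
by move=> FG; rewrite ler_pM2r ?invr_gt0 ?exprn_gt0 //; exact: ler_sum.
Qed.

Lemma tri_avg_prod n (phi : 'I_n * 'I_n -> 'I_3 -> R) :
  tri_avg (fun w => \prod_e phi e (w e)) = \prod_e ((\sum_c phi e c) / 3).
Proof.
by rewrite big_split /= bigA_distr_bigA /= prodr_const exprVn.
Qed.

Lemma walks_le_tri_avg p n : (0 < p)%N ->
  \sum_(i : {ffun 'I_p -> 'I_n}) \sum_(j : {ffun 'I_p -> 'I_n}) (no_simple_edge i j)%:R <=
  tri_avg (fun w : {ffun 'I_n * 'I_n -> 'I_3} => \tr ((tri_mx w *m (tri_mx w)^T) ^+ p)).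
Proof.
move=> p0.
have -> : tri_avg (fun w : {ffun 'I_n * 'I_n -> 'I_3} => \tr ((tri_mx w *m (tri_mx w)^T) ^+ p)) =
    \sum_(i : {ffun 'I_p -> 'I_n}) \sum_(j : {ffun 'I_p -> 'I_n})
      \prod_e tri_moment (count_mem e (walk_edges i j)).
  transitivity (tri_avg (fun w : {ffun 'I_n * 'I_n -> 'I_3} =>
    \sum_(i : {ffun 'I_p -> 'I_n}) \sum_(j : {ffun 'I_p -> 'I_n})
     \prod_e tri (w e) ^+ count_mem e (walk_edges i j))).
    congr tri_avg; apply/funext => w; rewrite mxtrace_walks //.
    apply: eq_bigr => i _; apply: eq_bigr => j _.
    rewrite (prod_count (F := fun e k => tri (w e) ^+ k)) // prodr_undup_exp_count.
    by apply: eq_bigr => -[a b] _; rewrite mxE.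
  rewrite tri_avg_sum; apply: eq_bigr => i _; rewrite tri_avg_sum; apply: eq_bigr => j _.
  by rewrite (tri_avg_prod (fun e c => tri c ^+ count_mem e (walk_edges i j))).
apply: ler_sum => i _; apply: ler_sum => j _.
have ge0 k : 0 <= tri_moment k.
  case: k => [|[|k]]; rewrite ?tri_moment0 ?tri_moment1 //.
  by apply: le_trans (tri_moment_ge1 _).
case: no_simple_edgeP => [ns|_]; last exact: prodr_ge0.
rewrite -[leLHS](expr1n _ #|{: 'I_n * 'I_n}|) -prodr_const.
apply: ler_prod => e _; rewrite ler01 /=; have := ns e.
by case: (count _ _) => [|[|k]] // _; rewrite ?tri_moment0 // tri_moment_ge1.
Qed.

(** Averaged over a centered law the linear term drops out and leaves a sub-Gaussian bound. For x >=
    1 use x <= 2 x^2; below 1, e^x is at most the inverse of (1 - x/2)^2 or of 1 - x, hence at most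
    1 + x + 2 x^2. *)
Lemma expR_le_sqr (x : R) : expR x <= x + expR (2 * x ^+ 2).
Proof.
have e1 y : 1 + y <= expR y :> R by exact: expR_ge1Dx.
have [x1|x1] := leP 1 x.
  have : expR x <= expR (2 * x ^+ 2) by rewrite ler_expR; nra.
  lra.
have [x0|x0] := leP 0 x.
  have h2 : expR x * (1 - x / 2) ^+ 2 <= 1.
    have h : expR (x / 2) * (1 - x / 2) <= 1.
      have := e1 (- (x / 2)); rewrite -(ler_pM2l (expR_gt0 (x / 2))) expRN divff ?gt_eqF ?expR_gt0 //.
    have -> : expR x = expR (x / 2) ^+ 2 by rewrite -expRM_natl; congr expR; field.
    rewrite -exprMn exprn_ile1 // mulr_ge0 ?expR_ge0 //; lra.
  have h3 : expR x <= 1 + x + 2 * x ^+ 2.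
    have q0 : 0 < (1 - x / 2) ^+ 2 by rewrite exprn_gt0 //; lra.
    rewrite -(ler_pM2r q0); apply: le_trans h2 _.
    have : 0 <= x ^+ 2 * ((1 - x) * (5 / 4 - x / 2)).
      by rewrite mulr_ge0 ?sqr_ge0 // mulr_ge0 //; lra.
    lra.
  have := e1 (2 * x ^+ 2); lra.
have h : expR x * (1 - x) <= 1.
  have := e1 (- x); rewrite -(ler_pM2l (expR_gt0 x)) expRN divff ?gt_eqF ?expR_gt0 //.
have h3 : expR x <= 1 + x + 2 * x ^+ 2.
  have q0 : 0 < 1 - x by lra.
  rewrite -(ler_pM2r q0); apply: le_trans h _.
  have : 0 <= x ^+ 2 * (1 - 2 * x) by rewrite mulr_ge0 ?sqr_ge0 //; lra.
  lra.
have := e1 (2 * x ^+ 2); lra.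
Qed.

Lemma tri_mgf (u : R) : (\sum_c expR (tri c * u)) / 3 <= expR (8 * u ^+ 2).
Proof.
rewrite (tri_sum (fun x => expR (x * u))) ler_pdivrMr //.
have := expR_le_sqr (2 * u); have := expR_le_sqr (-1 * u).
have : expR (2 * (-1 * u) ^+ 2) <= expR (8 * u ^+ 2) by rewrite ler_expR; nra.
have -> : 2 * (2 * u) ^+ 2 = 8 * u ^+ 2 by ring.
lra.
Qed.

Lemma tri_avg_mgf n (x y : 'rV[R]_n) :
  tri_avg (fun w => expR (hs_dot (x *m tri_mx w) y)) <=
  expR (8 * (hs_norm2 x * hs_norm2 y)).
Proof.
have dotE w : hs_dot (x *m tri_mx w) y = \sum_(e : 'I_n * 'I_n) tri (w e) * (x 0 e.1 * y 0 e.2).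
  transitivity (\sum_a \sum_b tri (w (a, b)) * (x 0 a * y 0 b)); last first.
    by rewrite pair_bigA; apply: eq_bigr => -[].
  rewrite hs_dotE big_ord1.
  rewrite exchange_big; apply: eq_bigr => b _; rewrite mxE mulr_suml.
  by apply: eq_bigr => a _; rewrite mxE; ring.
have -> : tri_avg (fun w => expR (hs_dot (x *m tri_mx w) y)) =
    tri_avg (fun w : {ffun 'I_n * 'I_n -> 'I_3} =>
      \prod_e expR (tri (w e) * (x 0 e.1 * y 0 e.2))).
  by congr tri_avg; apply/funext => w; rewrite dotE expR_sum.
rewrite (tri_avg_prod (fun e c => expR (tri c * (x 0 e.1 * y 0 e.2)))).
apply: (@le_trans _ _ (\prod_(e : 'I_n * 'I_n) expR (8 * (x 0 e.1 * y 0 e.2) ^+ 2))).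
  apply: ler_prod => e _; rewrite tri_mgf andbT.
  by rewrite divr_ge0 // sumr_ge0 // => c _; exact: expR_ge0.
rewrite -expR_sum ler_expR -mulr_sumr ler_pM2l // /hs_norm2 !big_ord1.
rewrite big_distrlr /= pair_bigA /= le_eqVlt; apply/orP; left; apply/eqP.
by apply: eq_bigr => e _; rewrite exprMn.
Qed.

(** * An integer grid in place of a net of the sphere *)

Section grid.
Variable n : nat.

(* Integer vectors, coordinatewise encoded by sign and absolute value. *)
Definition grid_vec (z : {ffun 'I_n -> bool * 'I_(2 * n).+1}) : 'rV[R]_n :=
  \row_i ((-1) ^+ (z i).1 * (z i).2%:R).

Definition in_grid (z : {ffun 'I_n -> bool * 'I_(2 * n).+1}) :=
  (\sum_i (z i).2 ^ 2 <= 4 * n)%N.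

Lemma hs_norm2_grid z : hs_norm2 (grid_vec z) = (\sum_i (z i).2 ^ 2)%:R.
Proof.
rewrite /hs_norm2 big_ord1 natr_sum; apply: eq_bigr => i _.
by rewrite mxE exprMn sqrr_sign mul1r natrX.
Qed.

(** Rounding in the direction of the sign of [v] never lowers the product, so passing to a grid
    vector loses nothing in a linear form; only the norm grows, and |k - x| <= 1 controls it. *)
Lemma round_up (x v : R) :
  exists k : int, x * v <= k%:~R * v /\ k%:~R ^+ 2 <= 2 * x ^+ 2 + 2.
Proof.
have f1 := floor_le x; have := floorD1_gt x; rewrite intrD; set F := (_ : int)%:~R => f2.
have [v0|v0] := leP 0 v.
  exists (Num.floor x + 1); rewrite intrD -/F; split; first by rewrite ler_wpM2r // ltW.
  have := sqr_ge0 (2 * x - (F + 1)); have : 0 <= (F + 1 - x) * (1 - (F + 1 - x)).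
    by rewrite mulr_ge0 //; lra.
  nra.
exists (Num.floor x); rewrite -/F; split; first by rewrite ler_wnM2r // ltW.
have := sqr_ge0 (2 * x - F); have : 0 <= (x - F) * (1 - (x - F)).
  by rewrite mulr_ge0 //; lra.
nra.
Qed.

Lemma grid_round (x v : 'rV[R]_n) : hs_norm2 x <= n%:R ->
  exists z, in_grid z /\ hs_dot x v <= hs_dot (grid_vec z) v.
Proof.
move=> xn; have [u Hu] := fin_all_exists (fun i => round_up (x 0 i) (v 0 i)).
have absE i : (`|u i| ^ 2)%N%:R = (u i)%:~R ^+ 2 :> R.
  by rewrite natrX natr_absz intr_norm real_normK ?num_real.
have sumu : (\sum_i `|u i| ^ 2 <= 4 * n)%N.
  rewrite -(ler_nat R) natr_sum; under eq_bigr => i _ do rewrite absE.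
  apply: (@le_trans _ _ (\sum_i (2 * x 0 i ^+ 2 + 2))).
    by apply: ler_sum => i _; case: (Hu i).
  rewrite big_split /= -mulr_sumr sumr_const card_ord -mulr_natr natrM.
  by move: xn; rewrite /hs_norm2 big_ord1; lra.
have ub i : (`|u i| < (2 * n).+1)%N.
  have : (`|u i| ^ 2 <= 4 * n)%N.
    by apply: leq_trans sumu; rewrite (bigD1 i) //= leq_addr.
  move: (n) (`|u i|%N) => a b; rewrite ltnS expnS expn1; nia.
exists [ffun i => (u i < 0, inord `|u i|)]; split.
  rewrite /in_grid (eq_bigr (fun i => `|u i| ^ 2)%N) // => i _.
  by rewrite ffunE /= inordK.
rewrite !hs_dotE !big_ord1; apply: ler_sum => i _; rewrite mxE ffunE /= inordK //.
have -> : (-1) ^+ (u i < 0)%R * `|u i|%N%:R = (u i)%:~R :> R.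
  by rewrite [in RHS](intEsign (u i)) intrM rmorph_sign.
by case: (Hu i).
Qed.

(** The form is linear in each argument, so the two vectors are rounded one after the other, each
    against the image of the other. General vectors are first scaled to squared norm [n]. *)
Lemma net_bound (A : 'M[R]_n) (N : R) : (0 < n)%N -> 0 <= N ->
  (forall z w, in_grid z -> in_grid w ->
     hs_dot (grid_vec z *m A) (grid_vec w) <= N) ->
  forall x y : 'rV[R]_n,
    hs_dot (x *m A) y ^+ 2 <= (N / n%:R) ^+ 2 * (hs_norm2 x * hs_norm2 y).
Proof.
move=> n0 N0 HN x y; have nR : 0 < n%:R :> R by rewrite ltr0n.
have le1 (a b : 'rV[R]_n) : hs_norm2 a <= n%:R -> hs_norm2 b <= n%:R ->
    hs_dot (a *m A) b <= N.
  move=> an bn; rewrite hs_dotMr; have [z [zg zle]] := grid_round (b *m A^T) an.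
  apply: le_trans zle _; rewrite -hs_dotMr hs_dotC.
  have [w [wg wle]] := grid_round (grid_vec z *m A) bn.
  by apply: le_trans wle _; rewrite hs_dotC HN.
have le2 (a b : 'rV[R]_n) : hs_norm2 a <= n%:R -> hs_norm2 b <= n%:R ->
    hs_dot (a *m A) b ^+ 2 <= N ^+ 2.
  move=> an bn; rewrite -real_normK ?num_real // lerXn2r ?nnegrE // ler_norml le1 // andbT.
  rewrite lerNl; have := le1 ((-1) *: a) b; rewrite -scalemxAl hs_dotZl mulN1r.
  by apply => //; rewrite hs_norm2Z sqrrN expr1n mul1r.
have [x0|x0] := eqVneq (hs_norm2 x) 0.
  by rewrite x0 (hs_norm2_eq0 x0) mul0mx hs_dotC /hs_dot trmx0 mulmx0 mxtrace0 expr0n mul0r mulr0.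
have [y0|y0] := eqVneq (hs_norm2 y) 0.
  by rewrite y0 (hs_norm2_eq0 y0) /hs_dot trmx0 mulmx0 mxtrace0 expr0n !mulr0.
have xp : 0 < hs_norm2 x by rewrite lt_def x0 hs_norm2_ge0.
have yp : 0 < hs_norm2 y by rewrite lt_def y0 hs_norm2_ge0.
have sc (v : 'rV[R]_n) : 0 < hs_norm2 v ->
    hs_norm2 (Num.sqrt (n%:R / hs_norm2 v) *: v) <= n%:R.
  move=> vp; rewrite hs_norm2Z sqr_sqrtr ?divr_ge0 ?hs_norm2_ge0 //.
  by rewrite divfK ?gt_eqF.
have := le2 _ _ (sc _ xp) (sc _ yp).
rewrite -scalemxAl hs_dotZl hs_dotC hs_dotZl hs_dotC mulrA exprMn (exprMn _ (Num.sqrt _)).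
rewrite !sqr_sqrtr ?divr_ge0 ?hs_norm2_ge0 // => H.
have c0 : 0 < n%:R / hs_norm2 x * (n%:R / hs_norm2 y) by rewrite mulr_gt0 ?divr_gt0.
rewrite -(ler_pM2l c0); apply: le_trans H _; rewrite le_eqVlt; apply/orP; left; apply/eqP.
by field; rewrite x0 y0 gt_eqF.
Qed.

(** On the grid the sum of the |z_i| is at most that of the z_i^2, hence at most 4n, so the product
    of the weights 16 / 2^|z_i| is at least 1. One coordinate sums to at most 64: the 16, two signs,
    and a geometric series below 2. *)
Lemma card_grid : \sum_z (in_grid z)%:R <= 64 ^+ n :> R.
Proof.
apply: (@le_trans _ _ (\sum_(z : {ffun 'I_n -> bool * 'I_(2 * n).+1})
    \prod_i (16 * 2^-1 ^+ (z i).2))).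
  apply: ler_sum => z _.
  have p0 : 0 <= \prod_i (16 * 2^-1 ^+ (z i).2) :> R.
    by apply: prodr_ge0 => i _; rewrite mulr_ge0 // exprn_ge0 // invr_ge0.
  case: (boolP (in_grid z)) => // zg; rewrite big_split /= prodr_const card_ord.
  have sk : (\sum_i (z i).2 <= 4 * n)%N.
    apply: leq_trans zg; apply: leq_sum => i _.
    by case: ((z i).2 : nat) => // k; rewrite expnS expn1 leq_pmulr.
  rewrite prodrXr exprVn ler_pdivlMr ?exprn_gt0 // mul1r.
  have -> : 16 = 2 ^+ 4 :> R by ring.
  by rewrite -exprM ler_weXn2l //; lra.
rewrite -(bigA_distr_bigA (fun=> fun c : bool * 'I_(2 * n).+1 => 16 * 2^-1 ^+ c.2)) /=.
rewrite prodr_const card_ord lerXn2r ?nnegrE //.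
  by apply: sumr_ge0 => c _; rewrite mulr_ge0 // exprn_ge0 // invr_ge0.
rewrite -mulr_sumr -(pair_bigA _ (fun (b : bool) (k : 'I_(2 * n).+1) => 2^-1 ^+ k)) /=.
rewrite big_bool /=; have := subrX1 (2^-1 : R) (2 * n).+1.
have : 0 <= 2^-1 ^+ (2 * n).+1 :> R by rewrite exprn_ge0 // invr_ge0.
lra.
Qed.

Lemma dot_pow_le (x : R) : x ^+ n.*2 <= n.*2`!%:R * (expR x + expR (- x)).
Proof.
have [->|n0] := eqVneq n 0%N.
  rewrite expr0 fact0 mul1r; have := expR_ge1Dx x; have := expR_ge1Dx (- x); lra.
have -> : x ^+ n.*2 = `|x| ^+ n.*2 by rewrite -mul2n !exprM real_normK ?num_real.
have k0 : (0 < n.*2)%N by rewrite double_gt0 lt0n.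
have := expR_ge1Dxn n.*2.-1 (normr_ge0 x); rewrite prednK // => H.
have f0 : 0 < n.*2`!%:R :> R by rewrite ltr0n fact_gt0.
rewrite mulrC -ler_pdivrMr //.
have : expR `|x| <= expR x + expR (- x).
  have [x0|x0] := leP 0 x; first by rewrite ger0_norm // lerDl expR_ge0.
  by rewrite ltr0_norm // lerDr expR_ge0.
lra.
Qed.

End grid.

Lemma tri_avg_dot_pow p (z w : {ffun 'I_p.*2 -> bool * 'I_(2 * p.*2).+1}) :
  (0 < p)%N -> in_grid z -> in_grid w ->
  tri_avg (fun y => hs_dot (grid_vec z *m tri_mx y) (grid_vec w) ^+ p.*2) <=
  2 * p.*2%:R ^+ p * p.*2%:R ^+ p.*2 * expR (128 * p.*2%:R).
Proof.
move=> p0 zg wg; set n := p.*2; have n0 : 0 < n%:R :> R by rewrite ltr0n double_gt0.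
(* With this scaling the exponent 8 |z|^2 |w|^2 / n is at most 8 (4n)(4n) / n = 128 n at grid
   points. *)
pose th : R := Num.sqrt n%:R; have th0 : 0 < th by rewrite sqrtr_gt0.
have th2 : th ^+ 2 = n%:R by rewrite sqr_sqrtr // ltW.
have mgf (c : R) : c ^+ 2 = n%:R^-1 ->
    tri_avg (fun y => expR (c * hs_dot (grid_vec z *m tri_mx y) (grid_vec w))) <=
    expR (128 * n%:R).
  move=> c2; apply: le_trans (_ : _ <= expR (8 * (hs_norm2 (c *: grid_vec z) *
      hs_norm2 (grid_vec w)))) _.
    apply: le_trans (tri_avg_mgf _ _); apply: tri_avg_le => y.
    by rewrite -scalemxAl hs_dotZl.
  rewrite ler_expR hs_norm2Z c2.
  have g1 : hs_norm2 (grid_vec z) <= 4 * n%:R by rewrite hs_norm2_grid -natrM ler_nat.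
  have g2 : hs_norm2 (grid_vec w) <= 4 * n%:R by rewrite hs_norm2_grid -natrM ler_nat.
  have g12 := ler_pM (hs_norm2_ge0 _) (hs_norm2_ge0 _) g1 g2.
  rewrite -mulrA (mulrCA 8) mulrC ler_pdivrMr //.
  apply: le_trans (ler_wpM2l _ g12) _; first lra.
  by rewrite le_eqVlt; apply/orP; left; apply/eqP; ring.
apply: (@le_trans _ _ (tri_avg (fun y => (n%:R ^+ p * n`!%:R) *
    (expR (th^-1 * hs_dot (grid_vec z *m tri_mx y) (grid_vec w)) +
     expR (- th^-1 * hs_dot (grid_vec z *m tri_mx y) (grid_vec w)))))).
  apply: tri_avg_le => y; set D := hs_dot _ _.
  have := dot_pow_le p (th^-1 * D); rewrite exprMn -mulNr -/n => H.
  have -> : D ^+ n = n%:R ^+ p * (th^-1 ^+ n * D ^+ n).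
    by rewrite mulrA -th2 -exprM mul2n -exprMn divff ?expr1n ?mul1r // gt_eqF.
  by rewrite -mulrA ler_wpM2l // exprn_ge0 // ltW.
have -> : 2 * n%:R ^+ p * n%:R ^+ n * expR (128 * n%:R) =
    (n%:R ^+ p * n%:R ^+ n) * (expR (128 * n%:R) + expR (128 * n%:R)) :> R by ring.
rewrite tri_avgZ; apply: ler_pM.
- by rewrite mulr_ge0 // exprn_ge0 // ltW.
- rewrite /tri_avg divr_ge0 ?exprn_ge0 //; apply: sumr_ge0 => y _.
  by rewrite addr_ge0 ?expR_ge0.
- rewrite ler_wpM2l ?exprn_ge0 ?(ltW n0) // -natrX ler_nat -ffactnn.
  exact: ffact_leq_expn.
have -> F G : tri_avg (fun y => F y + G y) = tri_avg F + tri_avg G :> R.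
  by rewrite /tri_avg big_split mulrDl.
by apply: lerD; apply: mgf; rewrite ?sqrrN exprVn th2.
Qed.

(** With n = 2p: 4 bounds the p-th root of 2n, [(64 ^+ 2) ^+ 2] counts pairs of grid points, 2 comes
    from n^p = 2^p p^p, and [expR 256] from the exponent 128 n. *)
Definition tri_const : R := 4 * (64 ^+ 2) ^+ 2 * 2 * expR 256.

(** An even power of the maximum over grid pairs is at most the sum of the powers, so the union
    bound takes place at the level of moments. It costs a factor exponential in p, which the p-th
    power of the constant absorbs. *)
Lemma tri_trace_le s (p := (2 ^ s)%N) :
  tri_avg (fun w : {ffun 'I_p.*2 * 'I_p.*2 -> 'I_3} =>
     \tr ((tri_mx w *m (tri_mx w)^T) ^+ p)) <= tri_const ^+ p * p%:R ^+ p.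
Proof.
have p0 : (0 < p)%N by rewrite expn_gt0.
set n := p.*2; have n0 : (0 < n)%N by rewrite double_gt0.
have nR : 0 < n%:R :> R by rewrite ltr0n.
pose gT := {ffun 'I_n -> bool * 'I_(2 * n).+1}.
pose D (q : gT * gT) (w : {ffun 'I_n * 'I_n -> 'I_3}) : R :=
  hs_dot (grid_vec q.1 *m tri_mx w) (grid_vec q.2).
pose g (q : gT * gT) := in_grid q.1 && in_grid q.2.
have tr_le w : \tr ((tri_mx w *m (tri_mx w)^T) ^+ p) <=
    n%:R / n%:R ^+ n * \sum_(q | g q) D q w ^+ n :> R.
  pose N : R := \big[Num.max/0]_(q | g q) D q w.
  have Nle q : g q -> D q w <= N by move=> gq; exact: (bigmax_sup q).
  have N0 : 0 <= N by rewrite /N; exact: bigmax_ge_id.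
  have ev (x : R) : 0 <= x ^+ n by rewrite /n -mul2n exprM exprn_ge0 // sqr_ge0.
  have NT : N ^+ n <= \sum_(q | g q) D q w ^+ n.
    apply: (big_ind (fun x => x ^+ n <= \sum_(q | g q) D q w ^+ n)).
    - by rewrite expr0n gtn_eqF //= sumr_ge0.
    - by move=> x y; rewrite /Num.max; case: ifP.
    - by move=> q gq; rewrite (bigD1 q) //= lerDl sumr_ge0.
  apply: le_trans (trace_pow_le s (N := (N / n%:R) ^+ 2) _ _) _.
  - exact: sqr_ge0.
  - by apply: net_bound => // z1 z2 g1 g2; apply: (Nle (z1, z2)); rewrite /g g1.
  rewrite -/p -exprM mul2n -/n exprMn exprVn -mulrA ler_wpM2l // mulrC.
  by rewrite ler_wpM2l // invr_ge0 exprn_ge0.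
apply: le_trans (tri_avg_le tr_le) _; rewrite tri_avgZ tri_avg_sum.
set B : R := 2 * n%:R ^+ p * n%:R ^+ n * expR (128 * n%:R).
have B0 : 0 <= B by rewrite !mulr_ge0 ?exprn_ge0 ?expR_ge0.
have le1 : \sum_(q | g q) tri_avg (fun w => D q w ^+ n) <= (64 ^+ n * 64 ^+ n) * B.
  apply: (@le_trans _ _ (\sum_(q | g q) B)).
    by apply: ler_sum => q /andP[g1 g2]; exact: tri_avg_dot_pow.
  have -> : \sum_(q | g q) B = (\sum_(q | g q) 1) * B.
    by rewrite mulr_suml; apply: eq_bigr => q _; rewrite mul1r.
  rewrite ler_wpM2r //.
  apply: (@le_trans _ _ ((\sum_z (@in_grid n z)%:R) * (\sum_z (@in_grid n z)%:R))).
    rewrite big_distrlr pair_bigA /= big_mkcond /=; apply: ler_sum => q _.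
    by rewrite /g; case: (in_grid q.1); case: (in_grid q.2); rewrite /= ?mulr1 ?mulr0.
  by apply: ler_pM; rewrite ?sumr_ge0 // card_grid.
apply: le_trans (ler_wpM2l _ le1) _; first by rewrite divr_ge0 ?exprn_ge0.
have -> : n%:R / n%:R ^+ n * (64 ^+ n * 64 ^+ n * B) =
    (2 * n%:R) * ((64 ^+ 2) ^+ 2) ^+ p * (2 ^+ p * p%:R ^+ p) * expR 256 ^+ p :> R.
  have -> : expR 256 ^+ p = expR (128 * n%:R) :> R.
    by rewrite -expRM_natr; congr expR; rewrite /n -mul2n natrM; ring.
  have -> : 2 ^+ p * p%:R ^+ p = n%:R ^+ p :> R by rewrite -exprMn -natrM mul2n.
  have -> : ((64 ^+ 2) ^+ 2) ^+ p = 64 ^+ n * 64 ^+ n :> R.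
    by rewrite -exprD -!exprM /n; congr (_ ^+ _); lia.
  rewrite /B; have := lt0r_neq0 (exprn_gt0 n nR) => ?; field.
  by [].
have p4 : 2 * n%:R <= 4 ^+ p :> R.
  rewrite -natrM -natrX ler_nat /n -mul2n mulnA; case: (p) p0 => // k _.
  by elim: k => // k IH; rewrite expnS; move: IH; rewrite !mulnS; lia.
have -> : tri_const ^+ p * p%:R ^+ p =
    4 ^+ p * ((64 ^+ 2) ^+ 2) ^+ p * (2 ^+ p * p%:R ^+ p) * expR 256 ^+ p.
  by rewrite /tri_const; move: ((64 ^+ 2) ^+ 2 : R) (expR 256) => a b; rewrite !(exprMn p); ring.
by rewrite 3?ler_wpM2r ?mulr_ge0 ?exprn_ge0 ?expR_ge0.
Qed.

End three_point_matrix.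

Local Open Scope classical_set_scope.
Local Open Scope ring_scope.

(** * Expectations and independence *)

(** The sum is the floor of [y], in a form that becomes a combination of indicators of
    half-lines. *)
Lemma count_le_approx (R : realType) (y : R) N : 0 <= y <= N%:R ->
  `|(\sum_(k < N) (k.+1%:R <= y)%R%:R) - y| <= 1.
Proof.
elim: N => [|N IH] /andP[y0 yN].
  have -> : y = 0 by apply/le_anti; rewrite y0 yN.
  by rewrite big_ord0 subrr normr0.
rewrite big_ord_recr /=; have [yN'|yN'] := leP y N%:R.
  have -> : (N.+1%:R <= y)%R = false.
    by apply/negbTE; rewrite -ltNge (le_lt_trans yN') ?ltr_nat.
  by rewrite addr0 IH // y0.
rewrite (eq_bigr (fun=> 1)) => [|k _]; last first.
  by rewrite (le_trans _ (ltW yN')) // ler_nat.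
rewrite sumr_const card_ord -natr1 in yN *.
by case: (leP _ y) => /= ?; rewrite ler_norml; apply/andP; split; lra.
Qed.

Section expectation_values.
Context {R : realType} {d : measure_display} {T : measurableType d} (P : probability T R).
Implicit Types (X Y : T -> R).

(** Pairs integrability with a real value, so that expectations combine in [R] without extended-real
    side conditions. *)
Definition hasE X (c : R) :=
  P.-integrable setT (EFin \o X) /\ (\int[P]_w (X w)%:E = c%:E)%E.

Lemma hasE_measurable X c : hasE X c -> measurable_fun setT X.
Proof. by move=> [/integrableP[/measurable_EFinP]]. Qed.

Lemma integrable_hasE X : P.-integrable setT (EFin \o X) -> exists c, hasE X c.
Proof.
move=> iX; exists (fine (\int[P]_w (X w)%:E)); split => //.
by rewrite fineK //; exact: integrable_fin_num.
Qed.

Lemma hasE_unique X a b : hasE X a -> hasE X b -> a = b.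
Proof. by move=> [_ Xa] [_]; rewrite Xa => -[]. Qed.

Lemma hasE_cst (c : R) : hasE (fun=> c) c.
Proof.
split; last by rewrite integral_cst //= probability_setT mule1.
by apply: finite_measure_integrable_cst.
Qed.

Lemma hasED X Y a b : hasE X a -> hasE Y b -> hasE (fun w => X w + Y w) (a + b).
Proof.
move=> [iX Xa] [iY Yb]; split.
  by have := integrableD measurableT iX iY.
by rewrite -[LHS]/(\int[P]_w ((EFin \o X) \+ (EFin \o Y)) w)%E integralD_EFin // Xa Yb.
Qed.

Lemma hasEZ k X a : hasE X a -> hasE (fun w => k * X w) (k * a).
Proof.
move=> [iX Xa]; split; first by have := integrableZl measurableT k iX.
rewrite -[LHS]/(\int[P]_w (k%:E * (EFin \o X) w))%E.
by rewrite integralZl // EFinM -Xa.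
Qed.

Lemma hasEB X Y a b : hasE X a -> hasE Y b -> hasE (fun w => X w - Y w) (a - b).
Proof.
move=> Xa Yb; have := hasED Xa (hasEZ (-1) Yb); rewrite mulN1r.
by congr hasE; apply/funext => w; rewrite mulN1r.
Qed.

Lemma hasE_sum (I : Type) (s : seq I) (Q : pred I) (X : I -> T -> R) (c : I -> R) :
  (forall i, Q i -> hasE (X i) (c i)) ->
  hasE (fun w => \sum_(i <- s | Q i) X i w) (\sum_(i <- s | Q i) c i).
Proof.
move=> Xc; elim: s => [|i s IH].
  by rewrite big_nil; under eq_fun do rewrite big_nil; exact: hasE_cst.
rewrite big_cons; under eq_fun do rewrite big_cons.
by case: ifPn => // Qi; apply: hasED => //; exact: Xc.
Qed.

Lemma hasE_le X Y a b : hasE X a -> hasE Y b -> (forall w, X w <= Y w) -> a <= b.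
Proof.
move=> [iX Xa] [iY Yb] XY; rewrite -lee_fin -Xa -Yb; apply: le_integral => //.
by move=> w _; rewrite lee_fin.
Qed.

Lemma hasE_ge0 X a : hasE X a -> (forall w, 0 <= X w) -> 0 <= a.
Proof. by move=> Xa; exact: hasE_le (hasE_cst 0) Xa. Qed.

Lemma hasE_dom X Y b : measurable_fun setT X -> (forall w, `|X w| <= Y w) -> hasE Y b ->
  exists c, hasE X c.
Proof.
move=> mX XY [iY _]; apply: integrable_hasE; apply: le_integrable iY => //.
  exact/measurable_EFinP.
by move=> w _ /=; rewrite lee_fin (le_trans (XY w)) // ler_norm.
Qed.

Lemma hasE_bounded X K : measurable_fun setT X -> (forall w, `|X w| <= K) ->
  exists c, hasE X c.
Proof. by move=> mX XK; exact: hasE_dom mX XK (hasE_cst K). Qed.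

Lemma hasE_norm_le X Y a b : hasE X a -> hasE Y b -> (forall w, `|X w| <= Y w) -> `|a| <= b.
Proof.
move=> Xa Yb XY; rewrite ler_norml lerNl.
have := hasEZ (-1) Xa; rewrite mulN1r => XN.
rewrite (hasE_le XN Yb) /=; last first.
  by move=> w; rewrite mulN1r (le_trans _ (XY w)) // -normrN ler_norm.
by apply: (hasE_le Xa Yb) => w; rewrite (le_trans _ (XY w)) // ler_norm.
Qed.

Lemma hasE_indic (A : set T) : measurable A -> hasE \1_A (fine (P A)).
Proof.
move=> mA; have PA : P A \is a fin_num by exact: fin_num_measure.
split; last by rewrite integral_indic // setIT fineK.
have [||c [//]] := @hasE_bounded \1_A 1; first exact/measurable_indicP.
by move=> w; rewrite indicE; case: (_ \in _); rewrite ?normr1 ?normr0.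
Qed.

(** Monotonicity is read off the integral of a nonnegative function as a supremum over the simple
    functions below it. This form covers a [Z] that is itself a supremum over all projections. *)
Lemma hasE_expectation (Z V : T -> R) c : (forall w, 0 <= Z w <= V w) -> hasE V c ->
  ('E_P[Z] <= c%:E)%E.
Proof.
move=> ZV [iV Vc]; rewrite unlock -Vc.
rewrite ge0_integralE; last by move=> w _; rewrite lee_fin; case/andP: (ZV w).
rewrite ge0_integralE; last first.
  by move=> w _; rewrite lee_fin; case/andP: (ZV w) => /le_trans; apply.
apply: ereal_sup_le => _ [h hZ <-]; exists h => // w.
apply: le_trans (hZ w) _; rewrite !patchE; case: ifP => // _.
by rewrite lee_fin; case/andP: (ZV w).
Qed.

Lemma hasE_dct (Xn : nat -> T -> R) X Y (cn : nat -> R) b :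
  (forall n, hasE (Xn n) (cn n)) -> measurable_fun setT X ->
  (forall w, Xn ^~ w @ \oo --> X w) -> (forall n w, `|Xn n w| <= Y w) -> hasE Y b ->
  exists2 c, hasE X c & cn @ \oo --> c.
Proof.
move=> Xc mX XX XY [iY Yb].
have [||||iX _ cv] := @dominated_convergence _ _ _ P setT measurableT
   (fun n w => (Xn n w)%:E) (EFin \o X) (EFin \o Y) _ _ _ iY _.
- by move=> n; apply/measurable_EFinP; exact: hasE_measurable (Xc n).
- exact/measurable_EFinP.
- by apply: aeW => w _; apply/cvg_EFin; [exact: nearW|exact: XX].
- by apply: aeW => w n _; rewrite /= lee_fin.
have [c [_ Xc']] := integrable_hasE iX; exists c; first by split.
move: cv; rewrite Xc' => /fine_cvgP[_ H].
rewrite (_ : cn = fine \o [sequence (\int[P]_x (Xn n x)%:E)%E]_n) //.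
by apply/funext => n /=; case: (Xc n) => _ ->.
Qed.

(* Uniform approximation of a bounded [f] by [floor (n f) / n], a finite
   combination of indicators. *)
Lemma hasE_mul_upgrade X (G : T -> R) (g KG : R) :
  measurable_fun setT X -> measurable_fun setT G -> (forall w, `|G w| <= KG) ->
  (forall B : set R, measurable B ->
     hasE (fun w => \1_B (X w) * G w) (fine (P (X @^-1` B)) * g)) ->
  forall (f : R -> R) (K c : R), measurable_fun setT f -> (forall x, `|f x| <= K) ->
  hasE (f \o X) c -> hasE (fun w => f (X w) * G w) (c * g).
Proof.
move=> mX mG GK HB f K c mf fK fc.
have KG0 : 0 <= KG by exact: le_trans (GK point).
have K0 : 0 <= K by exact: le_trans (fK 0).
have mfX : measurable_fun setT (f \o X) by exact: measurableT_comp.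
have [e fGe] : exists e, hasE (fun w => f (X w) * G w) e.
  apply: (@hasE_bounded _ (K * KG)); first exact: measurable_funM.
  by move=> w; rewrite normrM ler_pM.
suff -> : c * g = e by [].
apply/eqP; rewrite -subr_eq0 -normr_le0; apply/ler_addgt0Pr => eps eps0; rewrite add0r.
have [n nP] : exists n : nat, (`|g| + KG) / n.+1%:R <= eps.
  exists (Num.truncn ((`|g| + KG) / eps)).
  by rewrite ler_pdivrMr // mulrC -ler_pdivrMr // ltW // truncnS_gt.
set q : R := n.+1%:R in nP; have q0 : 0 < q by rewrite ltr0n.
pose m := (Num.truncn (q * K)).+1; have mK : q * K <= m%:R by rewrite ltW // truncnS_gt.
(* The shift by [m] makes [h] nonnegative; its floor is then the number of thresholds k + 1 that it
   reaches. *)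
pose h x := q * f x + m%:R.
have mh : measurable_fun setT h.
  by apply: measurable_funD => //; exact: measurable_funM.
pose B (k : nat) : set R := h @^-1` [set` `[k.+1%:R, +oo[].
have mB k : measurable (B k) by rewrite -[B k]setTI; exact: mh.
have BE k x : \1_(B k) x = (k.+1%:R <= h x)%R%:R :> R.
  rewrite indicE; congr (nat_of_bool _)%:R; apply/idP/idP.
    by rewrite inE /B /= in_itv /= andbT.
  by move=> H; rewrite inE /B /= in_itv /= andbT.
pose fn x := q^-1 * ((\sum_(k < m.*2) \1_(B k) x) - m%:R).
have fnP x : `|f x - fn x| <= q^-1.
  have hx : 0 <= h x <= m.*2%:R.
    have := fK x; rewrite ler_norml => /andP[f1 f2].
    have := ler_wpM2l (ltW q0) f1; have := ler_wpM2l (ltW q0) f2.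
    by rewrite /h -addnn natrD mulrN => ? ?; apply/andP; split; lra.
  have := count_le_approx hx; rewrite distrC => H.
  have -> : f x - fn x = q^-1 * (h x - \sum_(k < m.*2) (k.+1%:R <= h x)%R%:R).
    rewrite /fn (eq_bigr (fun k : 'I_m.*2 => (k.+1%:R <= h x)%R%:R)) => [|k _]; last exact: BE.
    by rewrite /h; field; rewrite gt_eqF.
  by rewrite normrM gtr0_norm ?invr_gt0 // ler_piMr // invr_ge0 ltW.
have hB k : hasE (\1_(B k) \o X) (fine (P (X @^-1` B k))).
  have : measurable (X @^-1` B k) by rewrite -[X in measurable X]setTI; exact: mX.
  by move=> /hasE_indic; congr hasE; apply/funext => w; rewrite /= !indicE.
pose cn := q^-1 * ((\sum_(k < m.*2) fine (P (X @^-1` B k))) - m%:R).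
have hfn : hasE (fn \o X) cn.
  by apply: hasEZ; apply: hasEB (hasE_cst _); apply: hasE_sum => k _; exact: hB.
have hG : hasE G g.
  have := HB _ measurableT; rewrite preimage_setT probability_setT mul1r.
  by congr hasE; apply/funext => w; rewrite indicE in_setT mul1r.
have hfnG : hasE (fun w => fn (X w) * G w) (cn * g).
  have := hasEZ q^-1 (hasEB (hasE_sum (index_enum 'I_m.*2) (Q := xpredT)
     (X := fun k w => \1_(B k) (X w) * G w) (fun k _ => HB _ (mB k))) (hasEZ m%:R hG)).
  rewrite -mulr_suml -mulrBl mulrA -/cn; congr hasE; apply/funext => w.
  by rewrite /fn -mulr_suml -mulrBl mulrA.
have d1 : `|c - cn| <= q^-1.
  by apply: (hasE_norm_le (hasEB fc hfn) (hasE_cst q^-1)) => w; exact: fnP.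
have d2 : `|e - cn * g| <= q^-1 * KG.
  apply: (hasE_norm_le (hasEB fGe hfnG) (hasE_cst _)) => w.
  by rewrite -mulrBl normrM ler_pM.
have -> : c * g - e = (c - cn) * g - (e - cn * g) by ring.
apply: le_trans (ler_normB _ _) _; apply: le_trans nP.
rewrite normrM mulrDl; apply: lerD; last by rewrite [leRHS]mulrC.
by rewrite mulrC ler_wpM2l.
Qed.


(** Induction on the list of coordinates at which the factor may be an arbitrary bounded function,
    the others carrying indicators. The empty list is the definition of independence, and
    [hasE_mul_upgrade] frees one coordinate at a time. *)
Lemma hasE_indep_prod (I : finType) (X : I -> T -> R) :
  (forall i, measurable_fun setT (X i)) -> mutually_independent P X ->
  forall (f : I -> R -> R) (K : I -> R) (c : I -> R),
  (forall i, measurable_fun setT (f i)) -> (forall i x, `|f i x| <= K i) ->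
  (forall i, hasE (f i \o X i) (c i)) ->
  hasE (fun w => \prod_i f i (X i w)) (\prod_i c i).
Proof.
move=> mX indep.
suff H (s : seq I) (f : I -> R -> R) (K : I -> R) (c : I -> R) :
    (forall i, measurable_fun setT (f i)) -> (forall i x, `|f i x| <= K i) ->
    (forall i, hasE (f i \o X i) (c i)) ->
    (forall i, i \notin s -> exists2 B : set R, measurable B & f i = \1_B) ->
    hasE (fun w => \prod_i f i (X i w)) (\prod_i c i).
  move=> f K c mf fK fc; apply: (H (enum I)) => // i; by rewrite mem_enum.
elim: s f K c => [|i s IH] f K c mf fK fc fs.
  have {}fs i : exists B : set R, measurable B /\ f i = \1_B.
    by have [B mB fB] := fs i isT; exists B.
  have [B HB] := choice fs.
  have mXB i : measurable (X i @^-1` B i).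
    by rewrite -[X in measurable X]setTI; apply: mX => //; case: (HB i).
  pose A := \bigcap_(i in [set i | i \in [set: I]%SET]) (X i @^-1` B i).
  have mA : measurable A.
    by apply: fin_bigcap_measurable => //; exact: finite_finset.
  have fE w : \prod_i f i (X i w) = \1_A w.
    rewrite indicE; case: (boolP (w \in A)) => [|wA].
      rewrite inE => wA; rewrite big1 // => i _; case: (HB i) => _ ->.
      by rewrite indicE mem_set //; apply: wA => /=; rewrite inE.
    have [i wi] : exists i, ~ B i (X i w).
      apply: contrapT => /forallNP H; move/negP: wA; apply; rewrite inE => i _.
      by apply: contrapT; exact: H.
    by rewrite (bigD1 i) //=; case: (HB i) => _ ->; rewrite indicE memNset // mul0r.
  have -> : (fun w => \prod_i f i (X i w)) = \1_A by exact/funext.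
  have cE i : c i = fine (P (X i @^-1` B i)).
    apply: (hasE_unique (fc i)); case: (HB i) => _ ->.
    by have := hasE_indic (mXB i); congr hasE; apply/funext => w; rewrite /= !indicE.
  suff -> : \prod_i c i = fine (P A) by exact: hasE_indic.
  rewrite /A indep; last by move=> j; case: (HB j).
  rewrite [RHS](_ : _ = fine (\prod_i (c i)%:E)%E).
    by rewrite prodEFin.
  congr fine; apply: eq_big => [j|j _]; first by rewrite inE.
  by rewrite cE fineK //; exact: fin_num_measure.
have [is_|is_] := boolP (i \in s).
  apply: (IH f K c) => // j js; apply: fs; rewrite inE negb_or js andbT.
  by apply: contraNN js => /eqP ->.
rewrite (bigD1 i) //=.
have -> : (fun w => \prod_j f j (X j w)) =
    (fun w => f i (X i w) * \prod_(j | j != i) f j (X j w)).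
  by apply/funext => w; rewrite (bigD1 i).
apply: (@hasE_mul_upgrade (X i) (fun w => \prod_(j | j != i) f j (X j w))
    _ (\prod_(j | j != i) K j) _ _ _ _ _ (K i)) => //.
- rewrite (_ : (fun w => _) = (fun w => \prod_(j <- [seq j <- index_enum I | j != i]) f j (X j w))).
    by apply: measurable_prod => j _; exact: measurableT_comp.
  by apply/funext => w; rewrite big_filter.
- by move=> w; rewrite normr_prod; apply: ler_prod => j _; rewrite normr_ge0 fK.
- move=> B mB.
  pose f' j := if j == i then (\1_B : R -> R) else f j.
  pose K' j := if j == i then 1 else K j.
  pose c' j := if j == i then fine (P (X i @^-1` B)) else c j.
  have <- : \prod_j c' j = fine (P (X i @^-1` B)) * \prod_(j | j != i) c j.
    rewrite (bigD1 i) //=; congr (_ * _); first by rewrite /c' eqxx.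
    by apply: eq_bigr => j ji; rewrite /c' (negbTE ji).
  rewrite (_ : (fun w => _ * _) = (fun w => \prod_j f' j (X j w))); last first.
    apply/funext => w; rewrite [RHS](bigD1 i) //=; congr (_ * _); first by rewrite /f' eqxx.
    by apply: eq_bigr => j ji; rewrite /f' (negbTE ji).
  apply: (IH f' K' c').
  + by move=> j; rewrite /f'; case: ifP => // _; exact/measurable_indicP.
  + move=> j x; rewrite /f' /K'; case: ifP => // _; rewrite indicE.
    by case: (_ \in _); rewrite ?normr1 ?normr0.
  + move=> j; rewrite /f' /c'; case: eqP => // ->.
    have : measurable (X i @^-1` B) by rewrite -[X in measurable X]setTI; exact: mX.
    by move=> /hasE_indic; congr hasE; apply/funext => w; rewrite /= !indicE.
  + move=> j js; rewrite /f'; case: eqP => [_|/eqP ji]; first by exists B.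
    by apply: fs; rewrite inE negb_or ji.
Qed.

(** Truncation reduces to bounded functions and dominated convergence removes it; the second moments
    supply the majorants 1 + f^2, 1 + g^2 and f^2 + g^2. *)
Lemma hasE_indep2 (I : finType) (X : I -> T -> R) :
  (forall i, measurable_fun setT (X i)) -> mutually_independent P X ->
  forall (i j : I) (f g : R -> R) (a b a2 b2 : R), i != j ->
  measurable_fun setT f -> measurable_fun setT g ->
  hasE (f \o X i) a -> hasE (g \o X j) b ->
  hasE (fun w => f (X i w) ^+ 2) a2 -> hasE (fun w => g (X j w) ^+ 2) b2 ->
  hasE (fun w => f (X i w) * g (X j w)) (a * b).
Proof.
move=> mX indep i j f g a b a2 b2 ij mf mg fa gb f2 g2.
pose tr (h : R -> R) (n : nat) x := h x * (`|h x| <= n%:R)%R%:R.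
have trK h n x : `|tr h n x| <= n%:R.
  by rewrite /tr normrM normr_nat; case: (leP `|h x| n%:R) => H; rewrite ?mulr1 ?mulr0.
have trle h n x : `|tr h n x| <= `|h x|.
  by rewrite /tr normrM normr_nat; case: (leP `|h x| n%:R) => H; rewrite ?mulr1 ?mulr0.
have mtr h n : measurable_fun setT h -> measurable_fun setT (tr h n).
  move=> mh; apply: measurable_funM => //.
  rewrite (_ : (fun x => _) = \1_(h @^-1` [set` `[- n%:R, n%:R]])).
    by apply/measurable_indicP; rewrite -[X in measurable X]setTI; exact: mh.
  apply/funext => x; rewrite indicE; congr (nat_of_bool _)%:R.
  apply/idP/idP; rewrite inE /= in_itv /= -ler_norml //.
have trcv h x : tr h n x @[n --> \oo] --> h x.
  apply: cvg_near_cst.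
  near=> n; rewrite /tr (_ : (`|h x| <= n%:R)%R = true) ?mulr1 //.
  by near: n; exact: nbhs_infty_ger.
have hn n : exists an bn, [/\ hasE (tr f n \o X i) an, hasE (tr g n \o X j) bn &
    hasE (fun w => tr f n (X i w) * tr g n (X j w)) (an * bn)].
  have bd h k : measurable_fun setT h -> exists c, hasE (tr h n \o X k) c.
    move=> mh; apply: (@hasE_bounded _ n%:R) => [|w]; last exact: trK.
    by apply: measurableT_comp => //; exact: mtr.
  have [an fan] := bd f i mf; have [bn gbn] := bd g j mg.
  exists an, bn; split => //.
  pose F k : R -> R := if k == i then tr f n else if k == j then tr g n else cst 1.
  pose c k : R := if k == i then an else if k == j then bn else 1.
  have := hasE_indep_prod mX indep (f := F) (K := fun=> n%:R + 1) (c := c).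
  have jj : j == i = false by rewrite eq_sym (negbTE ij).
  have split2 (A : I -> R) : (forall k, k != i -> k != j -> A k = 1) ->
      \prod_k A k = A i * A j.
    move=> A1; rewrite (bigD1 i) //= (bigD1 j) ?jj //= big1 ?mulr1 // => k /andP[].
    exact: A1.
  rewrite split2; last by move=> k ki kj; rewrite /c (negbTE ki) (negbTE kj).
  rewrite (_ : (fun w => \prod_k F k (X k w)) =
     (fun w => tr f n (X i w) * tr g n (X j w))); last first.
    apply/funext => w; rewrite split2; first by rewrite /F !eqxx jj.
    by move=> k ki kj; rewrite /F (negbTE ki) (negbTE kj).
  have -> : c i = an by rewrite /c eqxx.
  have -> : c j = bn by rewrite /c jj eqxx.
  apply.
  - by move=> k; rewrite /F; case: ifP => _; [exact: mtr|case: ifP => _; [exact: mtr|]].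
  - move=> k x; have n0 : 0 <= n%:R :> R by [].
    rewrite /F; case: ifP => _; first by rewrite (le_trans (trK _ _ _)) // lerDl.
    case: ifP => _; first by rewrite (le_trans (trK _ _ _)) // lerDl.
    by rewrite normr1 lerDr.
  - move=> k; rewrite /F /c; case: eqP => [->//|_]; case: eqP => [->//|_].
    exact: hasE_cst.
have [an {}hn] := choice hn; have [bn {}hn] := choice hn.
have dom (X' Y' : T -> R) a' b' : hasE X' a' -> hasE Y' b' ->
    hasE (fun w => X' w + Y' w) (a' + b') by exact: hasED.
have nle (x : R) : `|x| <= 1 + x ^+ 2.
  by have := sqr_ge0 (`|x| - 1); rewrite -(real_normK (num_real x)); nra.
have [c1 fc1 cv1] : exists2 c, hasE (f \o X i) c & an @ \oo --> c.
  apply: (hasE_dct (Xn := fun n => tr f n \o X i) _ (hasE_measurable fa) _ _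
    (hasED (hasE_cst 1) f2)) => [n|w|n w].
  - by case: (hn n).
  - exact: trcv.
  - by rewrite /= (le_trans (trle _ _ _)).
have [c2 gc2 cv2] : exists2 c, hasE (g \o X j) c & bn @ \oo --> c.
  apply: (hasE_dct (Xn := fun n => tr g n \o X j) _ (hasE_measurable gb) _ _
    (hasED (hasE_cst 1) g2)) => [n|w|n w].
  - by case: (hn n).
  - exact: trcv.
  - by rewrite /= (le_trans (trle _ _ _)).
have [c3 fgc3 cv3] : exists2 c, hasE (fun w => f (X i w) * g (X j w)) c &
    (fun n => an n * bn n) @ \oo --> c.
  apply: (hasE_dct (Xn := fun n w => tr f n (X i w) * tr g n (X j w)) _ _ _ _
    (hasED f2 g2)) => [n||w|n w].
  - by case: (hn n).
  - exact: measurable_funM (hasE_measurable fa) (hasE_measurable gb).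
  - exact: cvgM (trcv _ _) (trcv _ _).
  - rewrite normrM; have := ler_pM (normr_ge0 _) (normr_ge0 _) (trle f n (X i w)) (trle g n (X j w)).
    move=> /le_trans; apply; rewrite -(real_normK (num_real (f (X i w)))).
    rewrite -(real_normK (num_real (g (X j w)))).
    have := sqr_ge0 (`|f (X i w)| - `|g (X j w)|).
    have := normr_ge0 (f (X i w)); have := normr_ge0 (g (X j w)); nra.
have : c3 = c1 * c2.
  by apply: (cvg_unique _ cv3); [exact: norm_hausdorff|exact: cvgM].
by rewrite (hasE_unique fc1 fa) (hasE_unique gc2 gb) => <-.
Unshelve. all: by end_near. Qed.

End expectation_values.

(** * The operator norm of the noise *)

Section operator_bounds.
Context {R : realType}.

(* Avoids the [p]-th root of the trace: either [|xA|^2 <= c |x|^2], or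
   [|xA|^2 c^(p-1) |x|^(2p-2) <= |xA|^(2p)]. *)
Lemma op_le_of_trace s m n (A : 'M[R]_(m, n)) (c : R) : 0 < c ->
  op_le A (c + \tr ((A *m A^T) ^+ (2 ^ s)) / c ^+ (2 ^ s).-1).
Proof.
move=> c0 x; set p := (2 ^ s)%N; set t := \tr _.
have p0 : (0 < p)%N by rewrite expn_gt0.
have H := op_pow_trace s A x; rewrite -/p -/t in H.
have [x0|x0] := eqVneq (hs_norm2 x) 0.
  by rewrite x0 mulr0 (hs_norm2_eq0 x0) mul0mx /hs_norm2 big1 // => i _;
    rewrite big1 // => j _; rewrite mxE expr0n.
have xp : 0 < hs_norm2 x by rewrite lt_def x0 hs_norm2_ge0.
have t0 : 0 <= t.
  rewrite -(pmulr_lge0 _ (exprn_gt0 p xp)); apply: le_trans H.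
  by rewrite exprn_ge0 ?hs_norm2_ge0.
rewrite mulrDl; have [le1|gt1] := leP (hs_norm2 (x *m A)) (c * hs_norm2 x).
  by apply: le_trans le1 _; rewrite lerDl mulr_ge0 ?divr_ge0 ?exprn_ge0 ?(ltW c0) ?(ltW xp).
apply: ler_wpDl; first by rewrite mulr_ge0 ?ltW.
have cx : 0 < (c * hs_norm2 x) ^+ p.-1 by rewrite exprn_gt0 // mulr_gt0.
rewrite -(ler_pM2r cx); apply: (@le_trans _ _ (hs_norm2 (x *m A) ^+ p)).
  rewrite -[in leRHS](prednK p0) exprS ler_wpM2l ?hs_norm2_ge0 //.
  by rewrite lerXn2r ?nnegrE ?hs_norm2_ge0 ?mulr_ge0 ?ltW.
apply: le_trans H _; rewrite -[in leLHS](prednK p0) exprS exprMn le_eqVlt.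
by apply/orP; left; apply/eqP; field; rewrite expf_neq0 // gt_eqF.
Qed.

(** Cauchy-Schwarz with each |B_ij| split into two square roots: one factor gives a column sum, the
    other a row sum once the columns are summed. The squares in the hypotheses match the scale of
    [op_le]. *)
Lemma op_le_schur m n (B : 'M[R]_(m, n)) (q : R) : 0 <= q ->
  (forall i, (\sum_j `|B i j|) ^+ 2 <= q) -> (forall j, (\sum_i `|B i j|) ^+ 2 <= q) ->
  op_le B q.
Proof.
move=> q0 rowq colq x; pose a := Num.sqrt q.
have a0 : 0 <= a by exact: sqrtr_ge0.
have sq (y : R) : 0 <= y -> y ^+ 2 <= q -> y <= a.
  by move=> y0 yq; rewrite -(ger0_norm y0) -sqrtr_sqr ler_wsqrtr.
have rowa i : \sum_j `|B i j| <= a by apply: sq => //; exact: sumr_ge0.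
have cola j : \sum_i `|B i j| <= a by apply: sq => //; exact: sumr_ge0.
rewrite {1}/hs_norm2 big_ord1.
apply: (@le_trans _ _ (\sum_j a * \sum_i `|B i j| * x 0 i ^+ 2)).
  apply: ler_sum => j _; rewrite mxE.
  pose u : 'rV[R]_m := \row_i Num.sqrt `|B i j|.
  pose v : 'rV[R]_m := \row_i (Num.sqrt `|B i j| * `|x 0 i|).
  apply: (@le_trans _ _ (hs_dot u v ^+ 2)).
    rewrite -(real_normK (num_real (\sum_i _))) lerXn2r ?nnegrE //.
      by rewrite hs_dotE big_ord1 sumr_ge0 // => i _; rewrite !mxE !mulr_ge0 ?sqrtr_ge0.
    apply: le_trans (ler_norm_sum _ _ _) _; rewrite hs_dotE big_ord1; apply: ler_sum => i _.
    by rewrite !mxE mulrA -expr2 sqr_sqrtr // normrM mulrC.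
  apply: le_trans (hs_CauchySchwarz u v) _; apply: ler_pM; rewrite ?hs_norm2_ge0 //.
    apply: le_trans (cola j); rewrite /hs_norm2 big_ord1; apply: ler_sum => i _.
    by rewrite mxE sqr_sqrtr.
  rewrite /hs_norm2 big_ord1; apply: ler_sum => i _.
  by rewrite mxE exprMn sqr_sqrtr // real_normK ?num_real.
rewrite -mulr_sumr exchange_big /=; under eq_bigr => i _ do rewrite -mulr_suml.
have -> : q = a * a by rewrite -expr2 sqr_sqrtr.
rewrite -mulrA ler_wpM2l // /hs_norm2 big_ord1 mulr_sumr; apply: ler_sum => i _.
by rewrite ler_wpM2r ?sqr_ge0.
Qed.

End operator_bounds.

(** [p] occurs in the types of the summands; giving the power of two as an equation allows [p] to
    stay abstract. *)
Lemma tri_trace_le' (R : realType) s p : p = (2 ^ s)%N ->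
  tri_avg (fun w : {ffun 'I_p.*2 * 'I_p.*2 -> 'I_3} =>
     \tr ((tri_mx w *m (tri_mx w)^T) ^+ p)) <= tri_const ^+ p * p%:R ^+ p :> R.
Proof. by move=> ->; exact: tri_trace_le. Qed.

Lemma tri_const_gt0 (R : realType) : 0 < tri_const :> R.
Proof.
rewrite /tri_const; apply: mulr_gt0; last exact: expR_gt0.
by apply: mulr_gt0 => //; apply: mulr_gt0 => //; apply: exprn_gt0; exact: exprn_gt0.
Qed.

(** [8 ^+ 3] comes from 64 p^3 <= 8^3 M, [4 ^+ 4] from absorbing a stray [b ^+ 2] into a p-th
    power. *)
Definition bulk_const {R : realType} : R := 8 ^+ 3 * 4 ^+ 4 * tri_const.

Lemma bulk_const_gt0 (R : realType) : 0 < bulk_const :> R.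
Proof.
by rewrite /bulk_const; apply: mulr_gt0; [apply: mulr_gt0; exact: exprn_gt0|exact: tri_const_gt0].
Qed.

Section noise.
Context {R : realType} {d : measure_display} {T : measurableType d} (P : probability T R).
Context {M : nat} (E : 'I_M * 'I_M -> T -> R) (L s2 : R).
Hypotheses (M0 : (0 < M)%N) (mE : forall e, measurable_fun setT (E e)).
Hypotheses (indE : mutually_independent P E) (L0 : 0 < L) (s2L : s2 <= L ^+ 2).
Hypotheses (E1 : forall e, hasE P (E e) 0) (E2 : forall e, hasE P (fun w => E e w ^+ 2) s2).
Hypothesis E4 : forall e, hasE P (fun w => E e w ^+ 4) (L ^+ 4).

Let MR : 0 < M%:R :> R. Proof. by rewrite ltr0n. Qed.

(** * Truncated noise: mean, bulk and tail *)

Section truncation.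
Variables s p : nat.
Hypotheses (pE : p = (2 ^ s)%N) (Mp : (M <= 64 * p ^ 3)%N) (pM : (64 * p ^ 3 <= 8 ^ 3 * M)%N).

Let p0 : (0 < p)%N. Proof. by rewrite pE expn_gt0. Qed.
Let pR : 1 <= p%:R :> R. Proof. by rewrite ler1n. Qed.
(* The truncation level makes the discarded part of an entry of size [L / M] in L^1. *)
Let tau : R := 4 * p%:R * L.
Let tau0 : 0 < tau. Proof. by rewrite !mulr_gt0 // ltr0n. Qed.

Definition trunc_le (x : R) : R := x * (`|x| <= tau)%R%:R.
Definition trunc_gt (x : R) : R := x - trunc_le x.

Lemma trunc_le_measurable : measurable_fun setT trunc_le.
Proof.
apply: measurable_funM => //.
rewrite (_ : (fun x => _) = \1_([set` `[- tau, tau]])).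
  by apply/measurable_indicP; exact: measurable_itv.
apply/funext => x; rewrite indicE; congr (nat_of_bool _)%:R.
by apply/idP/idP; rewrite inE /= in_itv /= -ler_norml.
Qed.

Lemma trunc_gt_measurable : measurable_fun setT trunc_gt.
Proof. by apply: measurable_funB => //; exact: trunc_le_measurable. Qed.

Lemma trunc_le_bound x : `|trunc_le x| <= tau.
Proof.
rewrite /trunc_le normrM normr_nat; case: (leP `|x| tau) => H; rewrite ?mulr1 //.
by rewrite mulr0 ltW.
Qed.

Lemma trunc_le_norm x : `|trunc_le x| <= `|x|.
Proof.
by rewrite /trunc_le normrM normr_nat; case: (leP `|x| tau) => H; rewrite ?mulr1 ?mulr0.
Qed.

Lemma trunc_gt_norm x : `|trunc_gt x| <= `|x|.
Proof.
rewrite /trunc_gt /trunc_le; case: (leP `|x| tau) => H; rewrite ?mulr1 ?mulr0 ?subr0 //.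
by rewrite subrr normr0.
Qed.

Lemma trunc_gt_pow4 x : `|trunc_gt x| <= x ^+ 4 / tau ^+ 3.
Proof.
have x4 : x ^+ 4 = `|x| ^+ 4 by rewrite -[4%N]/(2 * 2)%N !exprM real_normK ?num_real.
rewrite /trunc_gt /trunc_le; case: (leP `|x| tau) => H; rewrite ?mulr1 ?mulr0 ?subr0.
  by rewrite subrr normr0 x4 divr_ge0 ?exprn_ge0 // ltW.
rewrite x4 ler_pdivlMr ?exprn_gt0 // (exprS `|x|) ler_wpM2l // lerXn2r ?nnegrE ?(ltW tau0) //.
exact: ltW.
Qed.

Lemma tail_first_moment e : exists2 c, hasE P (fun w => `|trunc_gt (E e w)|) c & c <= L / M%:R.
Proof.
have h4 := hasEZ (tau ^- 3) (E4 e).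
have [c hc] : exists c, hasE P (fun w => `|trunc_gt (E e w)|) c.
  apply: hasE_dom h4 => [|w]; last by rewrite normr_id mulrC trunc_gt_pow4.
  apply: measurableT_comp => //.
  by apply: measurableT_comp => //; exact: trunc_gt_measurable.
exists c => //; apply: (@le_trans _ _ (tau ^- 3 * L ^+ 4)).
  by apply: (hasE_le hc h4) => w; rewrite mulrC trunc_gt_pow4.
rewrite /tau ler_pdivlMr // mulrC.
have p3 : M%:R <= 64 * p%:R ^+ 3 :> R by rewrite -natrX -natrM ler_nat.
have t3 : (4 * p%:R * L) ^+ 3 = 64 * p%:R ^+ 3 * L ^+ 3 by ring.
rewrite t3 mulrCA mulrC ler_pdivrMr; last by rewrite !mulr_gt0 ?exprn_gt0 // ltr0n.
rewrite (_ : L * (64 * p%:R ^+ 3 * L ^+ 3) = 64 * p%:R ^+ 3 * L ^+ 4); last by ring.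
by rewrite ler_wpM2r // exprn_ge0 // ltW.
Qed.

Definition trunc_mean e : R := fine (\int[P]_w (trunc_le (E e w))%:E).

Lemma trunc_meanE e : hasE P (fun w => trunc_le (E e w)) (trunc_mean e).
Proof.
have [||c hc] := @hasE_bounded _ _ _ P (fun w => trunc_le (E e w)) tau.
- by apply: measurableT_comp => //; exact: trunc_le_measurable.
- by move=> w; exact: trunc_le_bound.
by rewrite /trunc_mean; case: (hc) => _ ->.
Qed.

(** An entry is centered, so the mean of its kept part is minus that of its discarded part. *)
Lemma trunc_mean_le e : `|trunc_mean e| <= L / M%:R.
Proof.
have [c hc cL] := tail_first_moment e; apply: le_trans cL.
have := hasEB (trunc_meanE e) (E1 e); rewrite subr0 => h.
by apply: (hasE_norm_le h hc) => w; rewrite distrC.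
Qed.

Lemma op_le_mean : op_le (\matrix_(i, j) trunc_mean (i, j) : 'M[R]_M) (L ^+ 2).
Proof.
apply: op_le_ext (op_le_trace _); rewrite /hs_norm2.
apply: (@le_trans _ _ (\sum_(i < M) \sum_(j < M) (L / M%:R) ^+ 2)).
  apply: ler_sum => i _; apply: ler_sum => j _; rewrite mxE.
  rewrite -(real_normK (num_real (trunc_mean _))) lerXn2r ?nnegrE ?trunc_mean_le //.
  by rewrite divr_ge0 // ltW.
have -> : \sum_(i < M) \sum_(j < M) (L / M%:R) ^+ 2 = M%:R * (M%:R * (L / M%:R) ^+ 2).
  by rewrite !sumr_const !card_ord !mulr_natl.
rewrite le_eqVlt.
by apply/orP; left; apply/eqP; field; rewrite gt_eqF.
Qed.

(** Centering at most doubles the bound [tau] = 4pL, so the centered kept entries are at most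
    [b * L]. *)
Let b : R := 8 * p%:R.
Let cen e x := trunc_le x - trunc_mean e.

Let cen_measurable e : measurable_fun setT (cen e).
Proof. by apply: measurable_funB => //; exact: trunc_le_measurable. Qed.

Let cen_bound e x : `|cen e x| <= b * L.
Proof.
have hm : `|trunc_mean e| <= tau.
  by apply: (hasE_norm_le (trunc_meanE e) (hasE_cst P tau)) => w; exact: trunc_le_bound.
have := trunc_le_bound x; move: hm; rewrite /cen => h1 h2.
apply: le_trans (ler_normB _ _) _; move: h1 h2; rewrite /tau /b; lra.
Qed.

Let cen_second e : exists2 c, hasE P (fun w => cen e (E e w) ^+ 2) c & c <= L ^+ 2.
Proof.
have [c hc] : exists c, hasE P (fun w => trunc_le (E e w) ^+ 2) c.
  apply: hasE_dom (E2 e) => [|w].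
    apply: measurable_funX; apply: measurableT_comp => //.
    exact: trunc_le_measurable.
  rewrite normrX -(real_normK (num_real (E e w))).
  by rewrite lerXn2r ?nnegrE ?trunc_le_norm.
have cs : c <= s2.
  apply: (hasE_le hc (E2 e)) => w; rewrite -(real_normK (num_real (E e w))).
  by rewrite -(real_normK (num_real (trunc_le _))) lerXn2r ?nnegrE ?trunc_le_norm.
exists (c - 2 * trunc_mean e * trunc_mean e + trunc_mean e ^+ 2).
  have := hasED (hasEB hc (hasEZ (2 * trunc_mean e) (trunc_meanE e)))
     (hasE_cst P (trunc_mean e ^+ 2)).
  by congr hasE; apply/funext => w; rewrite /cen; ring.
have := sqr_ge0 (trunc_mean e); move: cs s2L => h1 h2; nra.
Qed.

Let cen_moment e n : exists c, hasE P (fun w => cen e (E e w) ^+ n) c.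
Proof.
apply: (@hasE_bounded _ _ _ _ _ ((b * L) ^+ n)).
  by apply: measurable_funX; exact: measurableT_comp.
by move=> w; rewrite normrX lerXn2r ?nnegrE ?cen_bound // (le_trans _ (cen_bound e 0)).
Qed.

Let nu e n : R := fine (\int[P]_w (cen e (E e w) ^+ n)%:E).

Let nuE e n : hasE P (fun w => cen e (E e w) ^+ n) (nu e n).
Proof. by have [c hc] := cen_moment e n; rewrite /nu; case: (hc) => _ ->. Qed.

Let nu0 e : nu e 0%N = 1.
Proof. exact: hasE_unique (nuE e 0) (hasE_cst P 1). Qed.

Let nu1 e : nu e 1%N = 0.
Proof.
apply: (hasE_unique (nuE e 1)).
by have := hasEB (trunc_meanE e) (hasE_cst P (trunc_mean e)); rewrite subrr.
Qed.

Let b1 : 1 <= b. Proof. by move: pR; rewrite /b => h; lra. Qed.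

Let nun e n : (1 < n)%N -> `|nu e n| <= L ^+ n * b ^+ n / b ^+ 2.
Proof.
case: n => [|[|n]] // _; have [c hc cL] := cen_second e.
have bL0 : 0 <= b * L by rewrite mulr_ge0 ?(ltW L0) // (le_trans _ b1).
apply: (@le_trans _ _ ((b * L) ^+ n * c)).
  apply: (hasE_norm_le (nuE e _) (hasEZ ((b * L) ^+ n) hc)) => w.
  rewrite -addn2 exprD normrM [X in _ * X]ger0_norm ?sqr_ge0 // ler_wpM2r ?sqr_ge0 //.
  by rewrite normrX lerXn2r ?nnegrE.
apply: (@le_trans _ _ ((b * L) ^+ n * L ^+ 2)); first by rewrite ler_wpM2l ?exprn_ge0.
have b0 : b != 0 by rewrite gt_eqF // (lt_le_trans _ b1).
have eD (y : R) : y ^+ n.+2 = y ^+ n * y ^+ 2 by rewrite -exprD addn2.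
rewrite !eD exprMn le_eqVlt; apply/orP; left; apply/eqP.
by field.
Qed.

Definition bulk_mx w : 'M[R]_M := \matrix_(i, j) cen (i, j) (E (i, j) w).

(** Independence factorizes the expected weight of each walk, which leaves the single-entry moment
    bounds [nun] and the count of walks without simple edge. *)
Lemma bulk_trace : exists2 t, hasE P (fun w => \tr ((bulk_mx w *m (bulk_mx w)^T) ^+ p)) t &
  t <= (8 ^+ 3 * 4 ^+ 4 * tri_const * M%:R * L ^+ 2) ^+ p.
Proof.
exists (\sum_(i : {ffun 'I_p -> 'I_M}) \sum_(j : {ffun 'I_p -> 'I_M})
    \prod_e nu e (count_mem e (walk_edges i j))).
  rewrite (_ : (fun w => _) = (fun w => \sum_(i : {ffun 'I_p -> 'I_M})
     \sum_(j : {ffun 'I_p -> 'I_M})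
     \prod_e cen e (E e w) ^+ count_mem e (walk_edges i j))); last first.
    apply/funext => w; rewrite mxtrace_walks //.
    apply: eq_bigr => i _; apply: eq_bigr => j _.
    rewrite (prod_count (F := fun e k => cen e (E e w) ^+ k)) // prodr_undup_exp_count.
    by apply: eq_bigr => -[a c] _; rewrite mxE.
  apply: hasE_sum => i _; apply: hasE_sum => j _.
  apply: (hasE_indep_prod mE indE
    (f := fun e x => cen e x ^+ count_mem e (walk_edges i j))
    (K := fun e => (b * L) ^+ count_mem e (walk_edges i j))).
  - by move=> e; exact: measurable_funX.
  - move=> e x; rewrite normrX lerXn2r ?nnegrE ?cen_bound //.
    by rewrite (le_trans _ (cen_bound e 0)).
  - by move=> e; exact: nuE.
have b0 : 0 < b by rewrite (lt_le_trans _ b1).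
pose K : R := L ^+ p.*2 * b ^+ p.*2 * b ^+ 2.
have K0 : 0 <= K by rewrite !mulr_ge0 ?exprn_ge0 // ltW.
apply: (@le_trans _ _ (K * \sum_(i : {ffun 'I_p -> 'I_M}) \sum_(j : {ffun 'I_p -> 'I_M})
   ((no_simple_edge i j)%:R / (b ^+ 2) ^+ (#|codom i| + #|codom j|)))).
  rewrite mulr_sumr; apply: ler_sum => i _; rewrite mulr_sumr; apply: ler_sum => j _.
  by rewrite /K; apply: walk_moment_le.
(* The hypothesis of the transfer for a = b^2; this is where [p] must be at least of order
   M^(1/3). *)
have Mb : M%:R <= b ^+ 2 * p%:R :> R.
  have : M%:R <= 64 * p%:R ^+ 3 :> R by rewrite -natrX -natrM ler_nat.
  by move=> /le_trans; apply; rewrite le_eqVlt; apply/orP; left; apply/eqP; rewrite /b; ring.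
have tr := le_trans (walk_count_transfer p0 (exprn_gt0 2 b0) Mb)
  (le_trans (walks_le_tri_avg _ p0) (tri_trace_le' R pE)).
apply: le_trans (ler_wpM2l K0 tr) _; rewrite /K.
have -> : L ^+ p.*2 * b ^+ p.*2 * b ^+ 2 * (tri_const ^+ p * p%:R ^+ p) =
    b ^+ 2 * ((64 * p%:R ^+ 3) * tri_const * L ^+ 2) ^+ p.
  rewrite -!mul2n !exprM -!exprMn mulrAC -!exprMn mulrC; congr (_ * _ ^+ _).
  by rewrite /b; ring.
(* The factor [b ^+ 2] stands outside the p-th power; p <= 2^p and 64 <= 64^p bring it inside. *)
have p2 : b ^+ 2 <= (4 ^+ 4) ^+ p.
  have h : p%:R <= 2 ^+ p :> R by rewrite -natrX ler_nat ltnW // ltn_expl.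
  have h64 : 64 <= 64 ^+ p :> R by rewrite -[leLHS]expr1 ler_weXn2l //; lra.
  have -> : b ^+ 2 = 64 * p%:R ^+ 2 by rewrite /b; ring.
  apply: (@le_trans _ _ (64 ^+ p * (2 ^+ p) ^+ 2)).
    by apply: ler_pM => //; rewrite ?sqr_ge0 // lerXn2r ?nnegrE ?exprn_ge0.
  rewrite -exprM mulnC exprM -exprMn le_eqVlt; apply/orP; left; apply/eqP.
  by congr (_ ^+ _); ring.
have t0 := ltW (tri_const_gt0 R).
have L2 : 0 <= L ^+ 2 by exact: sqr_ge0.
apply: (@le_trans _ _ ((4 ^+ 4) ^+ p * ((8 ^+ 3 * M%:R) * tri_const * L ^+ 2) ^+ p)).
  have x0 (y : R) : 0 <= y -> 0 <= y * tri_const * L ^+ 2.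
    by move=> y0; rewrite mulr_ge0 // mulr_ge0.
  have p30 : 0 <= 64 * p%:R ^+ 3 :> R by rewrite mulr_ge0 // exprn_ge0.
  have M00 : 0 <= 8 ^+ 3 * M%:R :> R by rewrite mulr_ge0 // exprn_ge0.
  apply: ler_pM => //; [exact: sqr_ge0|exact/exprn_ge0/x0|].
  apply: lerXn2r; rewrite ?nnegrE ?x0 // ler_wpM2r // ler_wpM2r //.
  by rewrite -!natrX -!natrM ler_nat.
rewrite -exprMn le_eqVlt; apply/orP; left; apply/eqP.
by congr (_ ^+ _); ring.
Qed.

(** With [c] the p-th root of the trace bound, both terms of [op_le_of_trace] have mean at most
    [c]. *)
Lemma bulk_op : exists N n, [/\ forall w, op_le (bulk_mx w) (N w), hasE P N n &
  n <= 2 * (bulk_const * M%:R * L ^+ 2)].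
Proof.
have [t ht tle] := bulk_trace; set c := bulk_const * M%:R * L ^+ 2.
have c0 : 0 < c.
  by apply: mulr_gt0; [apply: mulr_gt0 => //; exact: bulk_const_gt0|exact: exprn_gt0].
exists (fun w => c + c ^- p.-1 * \tr ((bulk_mx w *m (bulk_mx w)^T) ^+ p)).
exists (c + c ^- p.-1 * t); split.
- by move=> w; rewrite mulrC pE; exact: op_le_of_trace.
- by apply: hasED; [exact: hasE_cst|exact: hasEZ].
- rewrite (_ : 2 * c = c + c); last by ring.
  by rewrite lerD2l mulrC ler_pdivrMr ?exprn_gt0 // -exprS prednK.
Qed.

Let beta (x : R) := `|trunc_gt x|.

Let beta_measurable : measurable_fun setT beta.
Proof. by apply: measurableT_comp => //; exact: trunc_gt_measurable. Qed.

Let tm e : R := fine (\int[P]_w (beta (E e w))%:E).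

Let tmE e : hasE P (fun w => beta (E e w)) (tm e).
Proof. by have [c hc _] := tail_first_moment e; rewrite /tm; case: (hc) => _ ->. Qed.

Let tm_le e : 0 <= tm e <= L / M%:R.
Proof.
have [c hc cL] := tail_first_moment e; rewrite (hasE_unique (tmE e) hc) cL andbT.
by apply: hasE_ge0 hc _ => w; exact: normr_ge0.
Qed.

Let beta_pair e e' : e != e' ->
  hasE P (fun w => beta (E e w) * beta (E e' w)) (tm e * tm e').
Proof.
have sq f : exists c, hasE P (fun w => beta (E f w) ^+ 2) c.
  apply: hasE_dom (E2 f) => [|w].
    by apply: measurable_funX; exact: measurableT_comp.
  rewrite normrX normr_id -(real_normK (num_real (E f w))).
  by rewrite lerXn2r ?nnegrE ?trunc_gt_norm.
move=> ee; have [c hc] := sq e; have [c' hc'] := sq e'.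
exact: (hasE_indep2 mE indE ee beta_measurable beta_measurable (tmE e) (tmE e') hc hc').
Qed.

Let dev (x : R) := x ^+ 2 - s2.

Let dev1 e : hasE P (fun w => dev (E e w)) 0.
Proof. by have := hasEB (E2 e) (hasE_cst P s2); rewrite subrr. Qed.

Let dev2 e : hasE P (fun w => dev (E e w) ^+ 2) (L ^+ 4 - s2 ^+ 2).
Proof.
have := hasED (hasEB (E4 e) (hasEZ (2 * s2) (E2 e))) (hasE_cst P (s2 ^+ 2)).
rewrite (_ : _ - _ + _ = L ^+ 4 - s2 ^+ 2); last by ring.
by congr hasE; apply/funext => w; rewrite /dev; ring.
Qed.

Let dev_pair e e' : e != e' -> hasE P (fun w => dev (E e w) * dev (E e' w)) 0.
Proof.
move=> ee; rewrite -[0](mulr0 0).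
have md : measurable_fun setT dev.
  by apply: measurable_funB => //; exact: measurable_funX.
exact: (hasE_indep2 mE indE ee md md (dev1 e) (dev1 e') (dev2 e) (dev2 e')).
Qed.

(** One integrable [Q] must dominate all squared row sums. Their off-diagonal products are summed
    over all rows: at most M^3 of them, of mean at most (L/M)^2. The diagonal part is at most the
    sum of the squared entries, whose deviation [D i] from M s2 has second moment at most M L^4. The
    map [sg] lets rows and columns share the argument. *)
Lemma tail_rows (sg : 'I_M -> 'I_M -> 'I_M * 'I_M) : (forall i, injective (sg i)) ->
  exists Q q, [/\ forall w i, (\sum_j beta (E (sg i j) w)) ^+ 2 <= Q w,
    hasE P Q q & q <= 3 * (M%:R * L ^+ 2)].
Proof.
move=> sgI; set c : R := M%:R * L ^+ 2.
have c0 : 0 < c by rewrite mulr_gt0 // exprn_gt0.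
pose D i w := \sum_j dev (E (sg i j) w).
pose S w := \sum_i \sum_j \sum_(k | k != j) beta (E (sg i j) w) * beta (E (sg i k) w).
pose Q w := (M%:R * s2 + c / 2) + (2 * c)^-1 * (\sum_i D i w ^+ 2) + S w.
have hD i : exists2 v, hasE P (fun w => D i w ^+ 2) v & v <= M%:R * L ^+ 4.
  exists (\sum_(j < M) \sum_(k < M) (if k == j then L ^+ 4 - s2 ^+ 2 else 0)).
    rewrite (_ : (fun w => _) = (fun w =>
      \sum_j \sum_k dev (E (sg i j) w) * dev (E (sg i k) w))); last first.
      by apply/funext => w; rewrite expr2 /D big_distrlr.
    apply: hasE_sum => j _; apply: hasE_sum => k _; case: eqVneq => [->|kj].
      by have := dev2 (sg i j); congr hasE; apply/funext => w; rewrite expr2.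
    by apply: dev_pair; rewrite (inj_eq (sgI i)) eq_sym.
  rewrite (eq_bigr (fun=> L ^+ 4 - s2 ^+ 2)); last first.
    by move=> j _; rewrite -big_mkcond big_pred1_eq.
  have -> : \sum_(j < M) (L ^+ 4 - s2 ^+ 2) = M%:R * (L ^+ 4 - s2 ^+ 2).
    by rewrite sumr_const card_ord mulr_natl.
  by rewrite ler_wpM2l // gerBl sqr_ge0.
pose v i := fine (\int[P]_w (D i w ^+ 2)%:E).
have vE i : hasE P (fun w => D i w ^+ 2) (v i).
  by have [x hx _] := hD i; rewrite /v; case: (hx) => _ ->.
have vle i : v i <= M%:R * L ^+ 4.
  by have [x hx xl] := hD i; rewrite (hasE_unique (vE i) hx).
pose St := \sum_i \sum_j \sum_(k | k != j) tm (sg i j) * tm (sg i k).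
have hS : hasE P S St.
  apply: hasE_sum => i _; apply: hasE_sum => j _; apply: hasE_sum => k kj.
  by apply: beta_pair; rewrite (inj_eq (sgI i)) eq_sym.
exists Q, ((M%:R * s2 + c / 2) + (2 * c)^-1 * (\sum_i v i) + St); split.
- move=> w i.
  have e1 : (\sum_j beta (E (sg i j) w)) ^+ 2 = \sum_j beta (E (sg i j) w) ^+ 2 +
      \sum_j \sum_(k | k != j) beta (E (sg i j) w) * beta (E (sg i k) w).
    rewrite expr2 big_distrlr /= -big_split /=; apply: eq_bigr => j _.
    by rewrite (bigD1 j) //= expr2.
  have e2 : \sum_j beta (E (sg i j) w) ^+ 2 <= M%:R * s2 + D i w.
    rewrite (_ : M%:R * s2 = \sum_(j < M) s2); last by rewrite sumr_const card_ord mulr_natl.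
    rewrite /D -big_split /=; apply: ler_sum => j _; rewrite /dev addrC subrK.
    rewrite /beta -[leRHS](real_normK (num_real _)).
    by rewrite lerXn2r ?nnegrE ?trunc_gt_norm.
  (* Completing the square with c = M L^2 trades the maximum of the [D i] for the sum of their
     squares, of mean at most M^2 L^4 = c^2. *)
  have e3 : D i w <= c / 2 + (2 * c)^-1 * D i w ^+ 2.
    have : 0 <= (2 * c)^-1 * (D i w - c) ^+ 2.
      by rewrite mulr_ge0 ?sqr_ge0 // invr_ge0 mulr_ge0 // ltW.
    rewrite (_ : _ * _ = (2 * c)^-1 * D i w ^+ 2 - D i w + c / 2); last first.
      by field; rewrite gt_eqF.
    lra.
  have e4 : D i w ^+ 2 <= \sum_i D i w ^+ 2.
    by rewrite [leRHS](bigD1 i) //= lerDl sumr_ge0 // => k _; exact: sqr_ge0.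
  have e5 : (2 * c)^-1 * D i w ^+ 2 <= (2 * c)^-1 * (\sum_i D i w ^+ 2).
    by rewrite ler_wpM2l // invr_ge0 mulr_ge0 // ltW.
  have e6 : \sum_j \sum_(k | k != j) beta (E (sg i j) w) * beta (E (sg i k) w) <= S w.
    rewrite /S [leRHS](bigD1 i) //= lerDl sumr_ge0 // => l _; rewrite sumr_ge0 // => j _.
    by rewrite sumr_ge0 // => k _; exact: mulr_ge0 (normr_ge0 _) (normr_ge0 _).
  rewrite e1 /Q; lra.
- by apply: hasED hS; apply: hasED; [exact: hasE_cst|apply: hasEZ; exact: hasE_sum].
have b1' : M%:R * s2 <= c by rewrite /c ler_wpM2l.
have b2' : (2 * c)^-1 * (\sum_i v i) <= c / 2.
  apply: (@le_trans _ _ ((2 * c)^-1 * (M%:R * (M%:R * L ^+ 4)))).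
    apply: ler_wpM2l; first by rewrite invr_ge0 mulr_ge0 // ltW.
    rewrite [leRHS](_ : _ = \sum_(i < M) (M%:R * L ^+ 4)); first exact: ler_sum.
    by rewrite sumr_const card_ord mulr_natl.
  rewrite le_eqVlt; apply/orP; left; apply/eqP; rewrite /c; field.
  by rewrite !gt_eqF.
have b3' : St <= c.
  have LM : 0 <= L / M%:R by rewrite divr_ge0 // ltW.
  apply: (@le_trans _ _ (\sum_(i < M) \sum_(j < M) \sum_(k < M) (L / M%:R) ^+ 2)).
    apply: ler_sum => i _; apply: ler_sum => j _; rewrite big_mkcond; apply: ler_sum => k _.
    case: ifP => _; last by rewrite sqr_ge0.
    by have /andP[? ?] := tm_le (sg i j); have /andP[? ?] := tm_le (sg i k);
      rewrite expr2 ler_pM.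
  have -> : \sum_(i < M) \sum_(j < M) \sum_(k < M) (L / M%:R) ^+ 2 =
      M%:R * (M%:R * (M%:R * (L / M%:R) ^+ 2)).
    by rewrite !sumr_const !card_ord !mulr_natl.
  rewrite le_eqVlt; apply/orP; left; apply/eqP; rewrite /c; field.
  by rewrite gt_eqF.
by move: b1' b2' b3' => ? ? ?; lra.
Qed.

Definition tail_mx w : 'M[R]_M := \matrix_(i, j) trunc_gt (E (i, j) w).

Lemma tail_op : exists N n, [/\ forall w, op_le (tail_mx w) (N w), hasE P N n &
  n <= 6 * (M%:R * L ^+ 2)].
Proof.
have [|Q1 [q1 [h1 e1 l1]]] := tail_rows (sg := fun i j => (i, j)).
  by move=> i j k [].
have [|Q2 [q2 [h2 e2 l2]]] := tail_rows (sg := fun i j => (j, i)).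
  by move=> i j k [].
exists (fun w => Q1 w + Q2 w), (q1 + q2); split.
- move=> w.
  have Q10 : 0 <= Q1 w by apply: le_trans (h1 w (Ordinal M0)); exact: sqr_ge0.
  have Q20 : 0 <= Q2 w by apply: le_trans (h2 w (Ordinal M0)); exact: sqr_ge0.
  apply: op_le_schur => [|i|j]; first exact: addr_ge0.
    by apply: ler_wpDr => //; under eq_bigr => j _ do rewrite mxE; exact: h1.
  by apply: ler_wpDl => //; under eq_bigr => i _ do rewrite mxE; exact: h2.
- exact: hasED.
- by move: l1 l2 => ? ?; lra.
Qed.

(** Mean, bulk and tail are recombined by two uses of [op_leD]: the bulk enters with factor 2 times
    2, and 4 (1 + 6) = 28 accounts for mean and tail. *)
Lemma noise_op_scale : exists N n,
  [/\ forall w, op_le (\matrix_(i, j) E (i, j) w : 'M[R]_M) (N w), hasE P N n &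
  n <= (4 * bulk_const + 28) * (M%:R * L ^+ 2)].
Proof.
have [N1 [n1 [h1 e1 l1]]] := bulk_op; have [N2 [n2 [h2 e2 l2]]] := tail_op.
exists (fun w => 2 * N1 w + 4 * (L ^+ 2 + N2 w)), (2 * n1 + 4 * (L ^+ 2 + n2)); split.
- move=> w.
  rewrite (_ : \matrix_(i, j) E (i, j) w = bulk_mx w +
     (\matrix_(i, j) trunc_mean (i, j) + tail_mx w)); last first.
    by apply/matrixP => i j; rewrite !mxE /cen /trunc_gt; ring.
  have := op_leD (h1 w) (op_leD op_le_mean (h2 w)); apply: op_le_ext; lra.
- by apply: hasED; [exact: hasEZ|apply: hasEZ; apply: hasED => //; exact: hasE_cst].
have : L ^+ 2 <= M%:R * L ^+ 2 by rewrite ler_peMl ?sqr_ge0 // ler1n.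
move: l1 l2 => ? ? ?; lra.
Qed.

End truncation.

Lemma noise_op : exists N n,
  [/\ forall w, op_le (\matrix_(i, j) E (i, j) w : 'M[R]_M) (N w), hasE P N n &
  n <= (4 * bulk_const + 28) * (M%:R * L ^+ 2)].
Proof.
have ex : exists s, (M <= 64 * (2 ^ s) ^ 3)%N.
  exists M; apply: leq_trans (ltnW (ltn_expl M (ltnSn 1))) _.
  have : (0 < 2 ^ M)%N by rewrite expn_gt0.
  by move: (2 ^ M)%N => x x0; rewrite !expnS expn0; nia.
case: (ex_minnP ex) => s sM smin.
apply: (@noise_op_scale s (2 ^ s)%N) => //.
(* For positive [s] minimality keeps 64 p^3 below 8 M. For s = 0 only M >= 1 is known, which the
   factor 8^3 accommodates. *)
case: s sM smin => [|s] sM smin; first by rewrite expn0 exp1n (_ : 8 ^ 3 = 512)%N //; lia.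
have : ~~ (M <= 64 * (2 ^ s) ^ 3)%N by apply/negP => /smin; rewrite ltnn.
rewrite -ltnNge => h; rewrite (expnS 2 s) expnMn; move: h.
by move: ((2 ^ s) ^ 3)%N => x; rewrite (_ : 8 ^ 3 = 512)%N // (_ : 2 ^ 3 = 8)%N //; lia.
Qed.

End noise.

(** * Expected excess risk *)

Section entry_moments.
Context {R : realType} {d : measure_display} {T : measurableType d} (P : probability T R).
Variables (X : {RV P >-> R}) (s m4 : R).
Hypotheses (X1 : ('E_P[X] = 0)%E) (X2 : variance P X = (s ^+ 2)%:E).
Hypothesis X4 : ('E_P[(fun w => (X w ^+ 4)%R)] = m4%:E)%E.

Let mX : measurable_fun setT X. Proof. exact: measurable_funPT. Qed.

Lemma hasE_fourth : hasE P (fun w => X w ^+ 4) m4.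
Proof.
have i4 : (\int[P]_w (X w ^+ 4)%:E = m4%:E)%E by move: X4; rewrite unlock.
split => //; apply/integrableP; split; first exact/measurable_EFinP/measurable_funX.
rewrite (eq_integral (fun w => (X w ^+ 4)%:E)); first by rewrite i4 ltry.
by move=> w _ /=; rewrite ger0_norm // -[4%N]/(2 * 2)%N exprM sqr_ge0.
Qed.

Lemma hasE_first : hasE P X 0.
Proof.
have [c hc] : exists c, hasE P X c.
  apply: (hasE_dom _ _ (hasED (hasE_cst P 1) hasE_fourth)) => // w.
  have := sqr_ge0 (X w ^+ 2 - 1); have := sqr_ge0 (`|X w| - 1).
  have -> : X w ^+ 2 = `|X w| ^+ 2 by rewrite real_normK ?num_real.
  have -> : X w ^+ 4 = `|X w| ^+ 4 by rewrite -[4%N]/(2 * 2)%N !exprM real_normK ?num_real.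
  have := normr_ge0 (X w); move: `|X w| => x; nra.
by case: (hc) => _ h; move: X1; rewrite unlock h => -[c0]; rewrite -c0.
Qed.

Lemma hasE_second : hasE P (fun w => X w ^+ 2) (s ^+ 2).
Proof.
have [c hc] : exists c, hasE P (fun w => X w ^+ 2) c.
  apply: (hasE_dom _ _ (hasED (hasE_cst P 1) hasE_fourth)) => [|w]; first exact: measurable_funX.
  rewrite ger0_norm ?sqr_ge0 //; have := sqr_ge0 (X w ^+ 2 - 1); have := sqr_ge0 (X w ^+ 2).
  have -> : X w ^+ 4 = (X w ^+ 2) ^+ 2 by rewrite -exprM.
  move: (X w ^+ 2) => x; nra.
suff <- : c = s ^+ 2 by [].
case: (hc) => _ h; have := X2; rewrite /variance unlock X1 /= unlock => -[].
rewrite (eq_integral (fun w => (X w ^+ 2)%:E)); first by rewrite h => -[].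
by move=> w _; congr EFin; rewrite -[LHS]/((X w - 0) * (X w - 0)) subr0 expr2.
Qed.

(** The variance of X^2 is nonnegative. This makes m4^(1/4) a single scale that dominates the
    standard deviation. *)
Lemma second_le_fourth : s ^+ 4 <= m4.
Proof.
have h := hasED (hasEB hasE_fourth (hasEZ (2 * s ^+ 2) hasE_second)) (hasE_cst P (s ^+ 4)).
have := hasE_ge0 h; rewrite (_ : _ - _ + _ = m4 - s ^+ 4); last by ring.
rewrite subr_ge0; apply => w.
by rewrite (_ : _ - _ + _ = (X w ^+ 2 - s ^+ 2) ^+ 2) ?sqr_ge0 //; ring.
Qed.

End entry_moments.

Section second_moments.
Context {R : realType} {d : measure_display} {T : measurableType d} (P : probability T R).
Context {M : nat} (E : 'I_M * 'I_M -> T -> R) (s2 : R).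
Hypotheses (mE : forall e, measurable_fun setT (E e)) (indE : mutually_independent P E).
Hypotheses (E1 : forall e, hasE P (E e) 0) (E2 : forall e, hasE P (fun w => E e w ^+ 2) s2).

Let Emx w : 'M[R]_M := \matrix_(i, j) E (i, j) w.

Lemma hasE_entry_pair e f : hasE P (fun w => E e w * E f w) (if f == e then s2 else 0).
Proof.
case: eqVneq => [->|fe].
  by have := E2 e; congr hasE; apply/funext => w; rewrite expr2.
rewrite -[0](mulr0 0); rewrite eq_sym in fe.
have mid : measurable_fun setT (@idfun R) by exact: measurable_id.
exact: (hasE_indep2 mE indE fe mid mid (E1 e) (E1 f) (E2 e) (E2 f)).
Qed.

(** Distinct entries are uncorrelated, so only the diagonal of the double sum survives. *)
Lemma hasE_sandwich m n (A : 'M[R]_(m, M)) (B : 'M[R]_(M, n)) :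
  hasE P (fun w => hs_norm2 (A *m Emx w *m B)) (s2 * (hs_norm2 A * hs_norm2 B)).
Proof.
pose c a b (e : 'I_M * 'I_M) := A a e.1 * B e.2 b.
have entry w a b : (A *m Emx w *m B) a b = \sum_e c a b e * E e w.
  transitivity (\sum_i \sum_j c a b (i, j) * E (i, j) w); last first.
    by rewrite pair_bigA; apply: eq_bigr => -[].
  rewrite exchange_big /= mxE; apply: eq_bigr => j _; rewrite mxE mulr_suml.
  by apply: eq_bigr => i _; rewrite mxE /c /=; ring.
have -> : s2 * (hs_norm2 A * hs_norm2 B) =
    \sum_a \sum_b \sum_e \sum_f (c a b e * c a b f) * (if f == e then s2 else 0).
  transitivity (\sum_a \sum_b \sum_(e : 'I_M * 'I_M) s2 * c a b e ^+ 2).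
    transitivity (\sum_a \sum_b \sum_i \sum_j s2 * (A a i ^+ 2 * B j b ^+ 2)).
      rewrite /hs_norm2 big_distrl mulr_sumr /=; apply: eq_bigr => a _.
      rewrite [X in _ * (_ * X)]exchange_big /= mulr_sumr mulr_sumr.
      apply: eq_bigr => b _; rewrite big_distrlr /= mulr_sumr.
      by apply: eq_bigr => i _; rewrite mulr_sumr.
    apply: eq_bigr => a _; apply: eq_bigr => b _; rewrite pair_bigA.
    by apply: eq_bigr => -[i j] _; rewrite /c exprMn.
  apply: eq_bigr => a _; apply: eq_bigr => b _; apply: eq_bigr => e _.
  rewrite (bigD1 e) //= eqxx big1 => [|f /negbTE ->]; last by rewrite mulr0.
  ring.
rewrite (_ : (fun w => _) = (fun w => \sum_a \sum_b \sum_e \sum_f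
    (c a b e * c a b f) * (E e w * E f w))); last first.
  apply/funext => w; apply: eq_bigr => a _; apply: eq_bigr => b _.
  rewrite entry expr2 big_distrlr; apply: eq_bigr => e _; apply: eq_bigr => f _.
  by rewrite mulrACA.
apply: hasE_sum => a _; apply: hasE_sum => b _; apply: hasE_sum => e _.
by apply: hasE_sum => f _; apply: hasEZ; exact: hasE_entry_pair.
Qed.

Lemma hasE_hs_dot (G : 'M[R]_M) : hasE P (fun w => hs_dot G (Emx w)) 0.
Proof.
rewrite (_ : (fun w => _) = (fun w => \sum_i \sum_j G i j * E (i, j) w)); last first.
  apply/funext => w; rewrite hs_dotE; apply: eq_bigr => i _; apply: eq_bigr => j _.
  by rewrite mxE.
have z : \sum_(i < M) \sum_(j < M) G i j * 0 = 0.
  by rewrite big1 // => i _; rewrite big1 // => j _; rewrite mulr0.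
have := @hasE_sum _ _ _ P _ (index_enum 'I_M) xpredT
  (fun i w => \sum_j G i j * E (i, j) w) (fun i => \sum_(j < M) G i j * 0).
by rewrite z; apply => i _; apply: hasE_sum => j _; exact: hasEZ.
Qed.

(** For a projection of rank r the noise contributes [s2] r M whatever its range, so two reference
    projections differ in mean only through [C]. *)
Lemma hasE_shifted (A C : 'M[R]_M) : hasE P (fun w => hs_norm2 (A *m (C + Emx w)))
  (hs_norm2 (A *m C) + s2 * (hs_norm2 A * hs_norm2 (1%:M : 'M[R]_M))).
Proof.
have h := hasED (hasED (hasE_cst P (hs_norm2 (A *m C)))
  (hasEZ 2 (hasE_hs_dot (A^T *m (A *m C))))) (hasE_sandwich A 1%:M).
move: h; rewrite mulr0 addr0; congr hasE; apply/funext => w.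
rewrite mulmx1 mulmxDr hs_norm2D; congr (_ + 2 * _ + _).
by rewrite hs_dotC -hs_dotMl hs_dotC.
Qed.

End second_moments.

(** * Excess risk at a fixed noise matrix *)

Section scalar_bounds.
Context {R : realType}.

(** Linearizes the root so that only the mean of [x] is needed afterwards; [k] is to be of the
    typical order of the root. *)
Lemma mean_sqrt_le (x k : R) : 0 < k -> 0 <= x -> Num.sqrt x <= (k^-1 * x + k) / 2.
Proof.
move=> k0 x0; have h := sqr_sqrtr x0.
have : 0 <= (2 * k)^-1 * (Num.sqrt x - k) ^+ 2.
  by rewrite mulr_ge0 ?sqr_ge0 // invr_ge0 mulr_ge0 // ltW.
rewrite (_ : _ * _ = (k^-1 * Num.sqrt x ^+ 2 + k) / 2 - Num.sqrt x); last first.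
  by field; rewrite gt_eqF.
by rewrite h subr_ge0.
Qed.

(** Half of the curvature [g * h2] absorbs the term linear in the root of [h2], the other half the
    term [4 * h2 * a * e], each by completing a square. *)
Lemma curvature_bound (h2 F a e g m y del : R) : 0 < g -> 0 <= h2 <= m -> g * h2 <= del ->
  y <= - del + 2 * Num.sqrt h2 * F + 4 * h2 * a * e + m * e ^+ 2 ->
  y <= 2 / g * F ^+ 2 + 8 / g * m * a ^+ 2 * e ^+ 2 + m * e ^+ 2.
Proof.
move=> g0 /andP[h0 hm] gd; have := sqr_sqrtr h0; set h := Num.sqrt h2 => hh yle.
have ig : 0 <= (2 * g)^-1 by rewrite invr_ge0 mulr_ge0 // ltW.
have t1 : 0 <= (2 * g)^-1 * (g * h - 2 * F) ^+ 2 by rewrite mulr_ge0 // sqr_ge0.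
rewrite (_ : (2 * g)^-1 * (g * h - 2 * F) ^+ 2 = g * h ^+ 2 / 2 - 2 * h * F + 2 / g * F ^+ 2) in t1; last first.
  by field; rewrite gt_eqF.
have t2 : 0 <= (2 * g)^-1 * (h2 * (g - 4 * (a * e)) ^+ 2).
  by rewrite mulr_ge0 // mulr_ge0 // sqr_ge0.
rewrite (_ : (2 * g)^-1 * (h2 * (g - 4 * (a * e)) ^+ 2) =
  g * h2 / 2 - 4 * h2 * a * e + h2 * (8 / g * a ^+ 2 * e ^+ 2)) in t2; last first.
  by field; rewrite gt_eqF.
have t3 : h2 * (8 / g * a ^+ 2 * e ^+ 2) <= m * (8 / g * a ^+ 2 * e ^+ 2).
  by rewrite ler_wpM2r // mulr_ge0 ?sqr_ge0 // mulr_ge0 ?sqr_ge0 // divr_ge0 // ltW.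
rewrite (_ : 8 / g * m * a ^+ 2 * e ^+ 2 = m * (8 / g * a ^+ 2 * e ^+ 2)); last by ring.
rewrite hh in t1; lra.
Qed.

(** Counterpart of [curvature_bound] for small [h2]: the curvature is dropped, and one root of [h2]
    is bounded by [q], the other by the root of [m]. *)
Lemma flat_bound (h2 F a e m y del q : R) : 0 <= h2 <= m -> 0 <= q -> h2 <= q ^+ 2 -> 0 <= del ->
  0 <= F -> 0 <= a -> 0 <= e ->
  y <= - del + 2 * Num.sqrt h2 * F + 4 * h2 * a * e + m * e ^+ 2 ->
  y <= 2 * q * F + 4 * q * Num.sqrt m * a * e + m * e ^+ 2.
Proof.
move=> /andP[h0 hm] q0 hq d0 F0 a0 e0; have := sqr_sqrtr h0; set h := Num.sqrt h2 => hh yle.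
have h00 : 0 <= h by exact: sqrtr_ge0.
have hq' : h <= q by rewrite -[q]ger0_norm // -sqrtr_sqr ler_wsqrtr.
have hsm : h <= Num.sqrt m by rewrite ler_wsqrtr.
have t1 : h * F <= q * F by rewrite ler_wpM2r.
have t2 : h2 * (a * e) <= q * Num.sqrt m * (a * e).
  by rewrite ler_wpM2r ?mulr_ge0 // -hh expr2 ler_pM.
lra.
Qed.

End scalar_bounds.

Section pointwise_bounds.
Context {R : realType} {M : nat} {C : 'M[R]_M} {lam : nat -> R} {U V : 'M[R]_M}.
Hypotheses (oU : orthogonal_mx U) (oV : orthogonal_mx V).
Hypothesis CE : C = U *m diag_mx (\row_(i < M) lam i.+1) *m V^T.
Hypothesis svC : singular_values C lam.
Variable r : nat.
Hypotheses (r1 : (1 <= r)%N) (rM : (r <= M)%N).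
Let P0 := @top_proj R M U r.
Let m : R := (minn r (M - r))%:R.
Variables (E : 'M[R]_M) (N : R).
Hypothesis EN : op_le E N.

Definition offdiag : R :=
  hs_norm2 ((1%:M - P0) *m (C *m E^T) *m P0) + hs_norm2 (P0 *m (C *m E^T) *m (1%:M - P0)).

Lemma offdiag_ge0 : 0 <= offdiag.
Proof. by rewrite addr_ge0 ?hs_norm2_ge0. Qed.

Lemma op_le_ge0 : 0 <= N.
Proof.
have M0 : (0 < M)%N by exact: leq_trans rM.
have := EN (delta_mx 0 (Ordinal M0)); rewrite (_ : hs_norm2 (delta_mx _ _) = 1) ?mulr1.
  by apply: le_trans; exact: hs_norm2_ge0.
rewrite /hs_norm2 big_ord1 (bigD1 (Ordinal M0)) //= mxE !eqxx expr1n big1 ?addr0 // => j j0.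
by rewrite mxE (negbTE j0) andbF expr0n.
Qed.

Let e := Num.sqrt N.
Let e0 : 0 <= e. Proof. exact: sqrtr_ge0. Qed.
Let e2 : e ^+ 2 = N. Proof. by rewrite sqr_sqrtr // op_le_ge0. Qed.
Let Ee : op_le E (e ^+ 2). Proof. by rewrite e2. Qed.
Let pP := top_proj_is_proj oU rM.
Let tP := top_proj_trace oU rM.
Let a := lam 1%N.
Let a0 : 0 <= a. Proof. exact: (lam_ge0 svC). Qed.
Let Ca : op_le C (a ^+ 2). Proof. exact: (op_le_singular oU oV CE svC). Qed.

Variable Q : 'M[R]_M.
Hypotheses (pQ : is_proj Q) (tQ : \tr Q = r%:R).
Let h2 := \tr ((1%:M - P0) *m Q).
Let y := hs_norm2 (Q *m (C + E)) - hs_norm2 (P0 *m (C + E)).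
Let del := hs_norm2 (P0 *m C) - hs_norm2 (Q *m C).

Let h2m : 0 <= h2 <= m.
Proof.
rewrite hnorm_ge0 //= /m /minn; case: ifP => _; first exact: hnorm_le_r.
exact: hnorm_le_Mr.
Qed.

Let yE : y = - del + 2 * (hs_dot (Q *m C) (Q *m E) - hs_dot (P0 *m C) (P0 *m E)) +
  (hs_norm2 (Q *m E) - hs_norm2 (P0 *m E)).
Proof. by rewrite /y /del !mulmxDr !hs_norm2D; ring. Qed.

Let noise := noise_term_le pP pQ rM tP tQ Ee.

Let ysplit : y <= - del + 2 * Num.sqrt h2 * Num.sqrt (2 * offdiag) + 4 * h2 * a * e + m * e ^+ 2.
Proof.
have c0 := @cross_term_split _ _ _ _ _ _ _ _ _ pP pQ tP tQ a0 e0 Ca Ee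
  (Num.sqrt (hs_norm2 ((1%:M - P0) *m (C *m E^T) *m P0)))
  (Num.sqrt (hs_norm2 (P0 *m (C *m E^T) *m (1%:M - P0)))) (sqrtr_ge0 _) (sqrtr_ge0 _).
rewrite !sqr_sqrtr ?hs_norm2_ge0 // in c0; have {}c0 := c0 (lexx _) (lexx _).
set F1 := Num.sqrt (hs_norm2 _) in c0; set F2 := Num.sqrt (hs_norm2 _) in c0.
have F12 : F1 + F2 <= Num.sqrt (2 * offdiag).
  have F0 : 0 <= F1 + F2 by rewrite addr_ge0 // sqrtr_ge0.
  rewrite -[leLHS]ger0_norm // -sqrtr_sqr ler_wsqrtr // /offdiag.
  rewrite -(sqr_sqrtr (hs_norm2_ge0 ((1%:M - P0) *m (C *m E^T) *m P0))).
  rewrite -(sqr_sqrtr (hs_norm2_ge0 (P0 *m (C *m E^T) *m (1%:M - P0)))) -/F1 -/F2.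
  by have := sqr_ge0 (F1 - F2); lra.
have h := ler_wpM2l (sqrtr_ge0 h2) F12.
by rewrite yE; move: c0 h noise; rewrite -/P0 -/h2 -/m => *; lra.
Qed.

Lemma excess_global : y <= 4 * m * a * e + m * e ^+ 2.
Proof.
have d0 : 0 <= del.
  apply: le_trans (gap_spectral oU oV CE svC rM pQ tQ); rewrite mulr_ge0 ?hnorm_ge0 //.
  by rewrite subr_ge0 (lam2_anti svC).
have c0 := cross_term_le pP pQ rM tP tQ a0 e0 Ca Ee.
by rewrite yE; move: c0 noise; rewrite -/P0 -/m => *; lra.
Qed.

Lemma excess_gap (g := lam r ^+ 2 - lam r.+1 ^+ 2) : 0 < g ->
  y <= 4 / g * offdiag + 8 / g * m * a ^+ 2 * N + m * N.
Proof.
move=> g0; have gd := gap_spectral oU oV CE svC rM pQ tQ.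
have := curvature_bound g0 h2m gd ysplit.
by rewrite sqr_sqrtr ?mulr_ge0 ?offdiag_ge0 // e2; lra.
Qed.

(** If 2 S <= lam_r^2 h2, half of the curvature survives the loss [S] of [gap_tail]. Otherwise [h2]
    is at most q^2 and [flat_bound] applies. *)
Lemma excess_tail (S := \sum_(r.+1 <= i < r.*2.+1) lam i ^+ 2)
    (q := Num.sqrt (2 * S) / lam r) : 0 < lam r ->
  y <= 8 / lam r ^+ 2 * offdiag + 16 / lam r ^+ 2 * m * a ^+ 2 * N + m * N +
    (2 * q * Num.sqrt (2 * offdiag) + 4 * q * Num.sqrt m * a * e).
Proof.
move=> l0; have l2 : 0 < lam r ^+ 2 by rewrite exprn_gt0.
have S0 : 0 <= S by rewrite sumr_ge0 // => i _; exact: sqr_ge0.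
have q0 : 0 <= q by rewrite divr_ge0 ?sqrtr_ge0 // ltW.
have gt := gap_tail oU oV CE svC r1 rM pQ tQ; rewrite -/P0 -/S -/h2 -/del in gt.
have d0 : 0 <= del.
  apply: le_trans (gap_spectral oU oV CE svC rM pQ tQ); rewrite mulr_ge0 ?hnorm_ge0 //.
  by rewrite subr_ge0 (lam2_anti svC).
(* Each case leaves out the terms of the other; their nonnegativity gives one bound for both. *)
have x1 : 0 <= 2 * q * Num.sqrt (2 * offdiag) + 4 * q * Num.sqrt m * a * e.
  apply: addr_ge0; first by rewrite mulr_ge0 ?sqrtr_ge0 // mulr_ge0.
  by rewrite mulr_ge0 // mulr_ge0 // mulr_ge0 ?sqrtr_ge0 // mulr_ge0.
have m0 : 0 <= m by exact: ler0n.
have x2 : 0 <= 8 / lam r ^+ 2 * offdiag + 16 / lam r ^+ 2 * m * a ^+ 2 * N.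
  apply: addr_ge0; first by rewrite mulr_ge0 ?offdiag_ge0 // divr_ge0 // ltW.
  rewrite mulr_ge0 ?op_le_ge0 // mulr_ge0 ?sqr_ge0 // mulr_ge0 //.
  by rewrite divr_ge0 // ltW.
have [big|small] := leP (2 * S) (lam r ^+ 2 * h2).
  have gd : lam r ^+ 2 / 2 * h2 <= del by lra.
  have g0 : 0 < lam r ^+ 2 / 2 by rewrite divr_gt0.
  have := curvature_bound g0 h2m gd ysplit.
  rewrite sqr_sqrtr ?mulr_ge0 ?offdiag_ge0 // e2.
  have -> : 2 / (lam r ^+ 2 / 2) = 4 / lam r ^+ 2 by field; rewrite gt_eqF.
  have -> : 8 / (lam r ^+ 2 / 2) = 16 / lam r ^+ 2 by field; rewrite gt_eqF.
  lra.
have hq : h2 <= q ^+ 2.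
  rewrite /q exprMn sqr_sqrtr ?mulr_ge0 // exprVn ler_pdivlMr // mulrC.
  exact: ltW.
have := flat_bound h2m q0 hq d0 (sqrtr_ge0 _) a0 e0 ysplit.
rewrite e2; lra.
Qed.

End pointwise_bounds.

Section expected_excess.
Context {R : realType} {d : measure_display} {T : measurableType d} (P : probability T R).
Context {M : nat} {C : 'M[R]_M} {lam : nat -> R} {U V : 'M[R]_M}.
Hypotheses (oU : orthogonal_mx U) (oV : orthogonal_mx V).
Hypothesis CE : C = U *m diag_mx (\row_(i < M) lam i.+1) *m V^T.
Hypothesis svC : singular_values C lam.
Variable r : nat.
Hypotheses (r1 : (1 <= r)%N) (rM : (r <= M)%N).
Variables (E : 'I_M * 'I_M -> T -> R) (L s2 : R) (pi_r : 'M[R]_M).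
Hypotheses (mE : forall e, measurable_fun setT (E e)) (indE : mutually_independent P E).
Hypotheses (L0 : 0 < L) (s2L : 0 <= s2 <= L ^+ 2).
Hypotheses (E1 : forall e, hasE P (E e) 0) (E2 : forall e, hasE P (fun w => E e w ^+ 2) s2).
Hypothesis (ppi : pi_r \in @proj_rank R M r).
Hypothesis maxpi : forall pi' : 'M[R]_M, pi' \in @proj_rank R M r ->
  hs_norm (pi' *m C) <= hs_norm (pi_r *m C).

Let P0 := @top_proj R M U r.
Let Emx w : 'M[R]_M := \matrix_(i, j) E (i, j) w.
Let X w := C + Emx w.
Let Z w := sup [set hs_norm (pi' *m X w) ^+ 2 - hs_norm (pi_r *m X w) ^+ 2
               | pi' in @proj_rank R M r].

Let rankP (Q : 'M[R]_M) : Q \in @proj_rank R M r -> is_proj Q /\ \tr Q = r%:R.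
Proof.
by rewrite inE => -[Qt [QQ Qr]]; split => //; rewrite mxtrace_idem // Qr.
Qed.

Let pP := top_proj_is_proj oU rM.
Let tP := top_proj_trace oU rM.

(* [pi_r] may be traded for the spectral projection [P0]: the difference of the two
   reference terms has nonpositive expectation. *)
Lemma expected_sup_le (Vb : T -> R) v :
  (forall w Q, is_proj Q -> \tr Q = r%:R ->
     hs_norm2 (Q *m X w) - hs_norm2 (P0 *m X w) <= Vb w) ->
  hasE P Vb v -> ('E_P[Z] <= v%:E)%E.
Proof.
move=> HV hV; have [pp tp] := rankP ppi.
have hD := hasEB (hasE_shifted mE indE E1 E2 P0 C) (hasE_shifted mE indE E1 E2 pi_r C).
rewrite !(hs_norm2_proj pp) !(hs_norm2_proj pP) tp tP in hD.
rewrite opprD addrACA subrr addr0 in hD.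
have P0in : P0 \in @proj_rank R M r.
  by rewrite inE; case: pP => ? ?; split => //; split => //; rewrite top_proj_rank.
have d0 : hs_norm2 (P0 *m C) - hs_norm2 (pi_r *m C) <= 0.
  rewrite subr_le0 -!hs_normX2 lerXn2r ?nnegrE ?sqrtr_ge0 //.
  exact: maxpi.
have hVD := hasED hV hD.
apply: (@le_trans _ _ ((v + (hs_norm2 (P0 *m C) - hs_norm2 (pi_r *m C)))%:E)); last first.
  by rewrite lee_fin gerDl.
apply: hasE_expectation hVD => w.
have ub : ubound [set hs_norm (pi' *m X w) ^+ 2 - hs_norm (pi_r *m X w) ^+ 2
               | pi' in @proj_rank R M r]
    (Vb w + (hs_norm2 (P0 *m X w) - hs_norm2 (pi_r *m X w))).
  move=> _ [Q Qr <-]; have [pQ tQ] := rankP (mem_set Qr); rewrite !hs_normX2.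
  by have := HV w Q pQ tQ; lra.
have in0 : [set hs_norm (pi' *m X w) ^+ 2 - hs_norm (pi_r *m X w) ^+ 2
               | pi' in @proj_rank R M r] 0.
  by exists pi_r; [exact: set_mem|rewrite subrr].
apply/andP; split; last by apply: ge_sup => //; exists 0.
by apply: ub_le_sup => //; eexists; exact: ub.
Qed.

Let Nr : R := (r * (M - r))%:R.
Let m : R := (minn r (M - r))%:R.
Let a := lam 1%N.
Let a0 : 0 <= a. Proof. exact: (lam_ge0 svC). Qed.
Let m0 : 0 <= m. Proof. exact: ler0n. Qed.
Let M0 : (0 < M)%N. Proof. exact: leq_trans rM. Qed.
Let MR : 0 < M%:R :> R. Proof. by rewrite ltr0n. Qed.
Let sM : R := Num.sqrt M%:R.
Let sM0 : 0 < sM. Proof. by rewrite sqrtr_gt0. Qed.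
Let sM2 : sM ^+ 2 = M%:R. Proof. by rewrite sqr_sqrtr // ltW. Qed.
(** The order of the root of [N], used as the weight in [mean_sqrt_le]. *)
Let kap := sM * L.
Let kap0 : 0 < kap. Proof. exact: mulr_gt0. Qed.
Let kap2 : kap ^+ 2 = M%:R * L ^+ 2. Proof. by rewrite exprMn sM2. Qed.

(** The larger of r and M - r is at least M/2. *)
Let mM : m * M%:R <= 2 * Nr.
Proof.
rewrite /m /Nr -!natrM ler_nat; move: rM.
rewrite /minn; case: ltnP; move: r M => x y; nia.
Qed.

Let Nr0 : 0 <= Nr. Proof. exact: ler0n. Qed.

Variables (N : T -> R) (n K : R).
Hypotheses (K0 : 0 <= K) (hN : forall w, op_le (Emx w) (N w)) (eN : hasE P N n).
Hypothesis nK : n <= K * (M%:R * L ^+ 2).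

Let N0 w : 0 <= N w. Proof. exact: (op_le_ge0 r1 rM (hN w)). Qed.
Let n0 : 0 <= n. Proof. exact: hasE_ge0 eN N0. Qed.

Let mn : m * n <= 2 * K * Nr * L ^+ 2.
Proof.
apply: le_trans (ler_wpM2l m0 nK) _.
rewrite (_ : m * (K * (M%:R * L ^+ 2)) = K * L ^+ 2 * (m * M%:R)); last by ring.
rewrite (_ : 2 * K * Nr * L ^+ 2 = K * L ^+ 2 * (2 * Nr)); last by ring.
by rewrite ler_wpM2l // mulr_ge0 // sqr_ge0.
Qed.

Let kn : kap^-1 * n + kap <= (K + 1) * kap.
Proof.
have h : kap^-1 * n <= K * kap.
  rewrite mulrC ler_pdivrMr //; apply: le_trans nK _.
  by rewrite -kap2 expr2 mulrA.
lra.
Qed.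

Let phi w := @offdiag R M C U r (Emx w).

(** Transposition brings each off-diagonal block to the form of [hasE_sandwich]. One projection
    contributes its rank, the other its rank times [a ^+ 2], whence r (M - r). *)
Let hphi : exists2 x, hasE P phi x & x <= 2 * L ^+ 2 * a ^+ 2 * Nr.
Proof.
have trE (A B : 'M[R]_M) w : hs_norm2 (A *m (C *m (Emx w)^T) *m B) =
    hs_norm2 (B^T *m Emx w *m (C^T *m A^T)).
  by rewrite -[LHS]hs_norm2_tr !trmx_mul trmxK !mulmxA.
have h (A B : 'M[R]_M) x y : is_proj A -> is_proj B -> \tr A = x -> \tr B = y ->
    x * y = Nr -> 0 <= y -> exists2 v, hasE P (fun w => hs_norm2 (A *m (C *m (Emx w)^T) *m B)) v &
      v <= L ^+ 2 * a ^+ 2 * Nr.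
  move=> pA pB tA tB xy y0; exists (s2 * (hs_norm2 B^T * hs_norm2 (C^T *m A^T))).
    have := hasE_sandwich mE indE E1 E2 B^T (C^T *m A^T); congr hasE.
    by apply/funext => w; rewrite trE.
  have nB : hs_norm2 B^T = y by rewrite hs_norm2_tr hs_norm2_proj.
  have nA : hs_norm2 (C^T *m A^T) <= a ^+ 2 * x.
    rewrite -trmx_mul hs_norm2_tr -tA -(hs_norm2_proj pA).
    exact/op_leM/(op_le_singular oU oV CE svC).
  rewrite nB -xy; case/andP: s2L => s20 sL.
  apply: (@le_trans _ _ (s2 * (y * (a ^+ 2 * x)))).
    by rewrite ler_wpM2l // ler_wpM2l.
  rewrite (_ : L ^+ 2 * a ^+ 2 * (x * y) = L ^+ 2 * (y * (a ^+ 2 * x))); last by ring.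
  rewrite ler_wpM2r // mulr_ge0 //; apply: le_trans nA; exact: hs_norm2_ge0.
have pP' := is_proj_compl pP.
have tP' : \tr (1%:M - P0) = (M - r)%:R by rewrite linearB /= mxtrace1 tP natrB.
have [|//|v1 e1 l1] := h _ _ _ _ pP' pP tP' tP; first by rewrite /Nr natrM mulrC.
have [|//|v2 e2 l2] := h _ _ _ _ pP pP' tP tP'; first by rewrite /Nr natrM.
exists (v1 + v2); first exact: hasED.
by move: l1 l2 => *; lra.
Qed.

Lemma expected_I : ('E_P[Z] <= (40 * (K + 1) * Nr * (L ^+ 2 + a / sM * L))%:E)%E.
Proof.
pose Vb w := 2 * m * a * (kap^-1 * N w + kap) + m * N w.
have hV : hasE P Vb (2 * m * a * (kap^-1 * n + kap) + m * n).
  apply: hasED; last exact: hasEZ.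
  by apply: hasEZ; apply: hasED; [exact: hasEZ|exact: hasE_cst].
apply: le_trans (expected_sup_le _ hV) _ => [w Q pQ tQ|].
  have := excess_global oU oV CE svC r1 rM (hN w) pQ tQ; rewrite -/P0 -/m -/a sqr_sqrtr //.
  have t1 := ler_wpM2l (mulr_ge0 m0 a0) (mean_sqrt_le kap0 (N0 w)).
  by rewrite /Vb; move: t1 => *; lra.
rewrite lee_fin.
have mk : m * kap <= 2 * Nr * (L / sM).
  rewrite (_ : m * kap = m * M%:R * (L / sM)); last first.
    by rewrite /kap -sM2; field; rewrite gt_eqF.
  by rewrite ler_wpM2r // divr_ge0 // ltW.
have t1 : 2 * m * a * (kap^-1 * n + kap) <= 4 * (K + 1) * Nr * (a / sM * L).
  apply: (@le_trans _ _ (2 * m * a * ((K + 1) * kap))).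
    by rewrite ler_wpM2l // mulr_ge0 // mulr_ge0.
  rewrite (_ : _ * _ = 2 * a * (K + 1) * (m * kap)); last by ring.
  rewrite (_ : 4 * _ * _ * _ = 2 * a * (K + 1) * (2 * Nr * (L / sM))); last by ring.
  by rewrite ler_wpM2l // mulr_ge0 ?addr_ge0 // mulr_ge0.
have x1 : 0 <= (K + 1) * Nr * (a / sM * L).
  by rewrite !mulr_ge0 ?addr_ge0 ?invr_ge0 // ltW.
have x2 : 0 <= K * Nr * L ^+ 2 by rewrite mulr_ge0 ?sqr_ge0 // mulr_ge0.
have x3 : 0 <= Nr * L ^+ 2 by rewrite mulr_ge0 ?sqr_ge0.
by move: mn t1 => *; lra.
Qed.

Lemma expected_II : lam r.+1 < lam r ->
  ('E_P[Z] <= (40 * (K + 1) * Nr * (a ^+ 2 / (lam r ^+ 2 - lam r.+1 ^+ 2) * L ^+ 2))%:E)%E.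
Proof.
move=> llt; set g := lam r ^+ 2 - lam r.+1 ^+ 2.
have g0 : 0 < g by rewrite subr_gt0 ltrXn2r ?nnegrE ?(lam_ge0 svC).
have [x hx xle] := hphi.
pose Vb w := 4 / g * phi w + 8 / g * m * a ^+ 2 * N w + m * N w.
have hV : hasE P Vb (4 / g * x + 8 / g * m * a ^+ 2 * n + m * n).
  by apply: hasED; [apply: hasED|]; exact: hasEZ.
apply: le_trans (expected_sup_le _ hV) _ => [w Q pQ tQ|].
  exact: (excess_gap oU oV CE svC r1 rM (hN w) pQ tQ g0).
rewrite lee_fin; set c := a ^+ 2 / g.
(* This lets the pure noise term [m * n] be charged to the same bound as the others. *)
have c1 : 1 <= c.
  rewrite ler_pdivlMr // mul1r /g; have := lam2_anti svC (ltn0Sn 0) r1.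
  have := sqr_ge0 (lam r.+1); rewrite /a; lra.
have t1 : 4 / g * x <= 8 * Nr * (c * L ^+ 2).
  rewrite (_ : 8 * Nr * (c * L ^+ 2) = 4 / g * (2 * L ^+ 2 * a ^+ 2 * Nr)); last first.
    by rewrite /c; ring.
  by rewrite ler_wpM2l // divr_ge0 // ltW.
have t2 : 8 / g * m * a ^+ 2 * n <= 16 * K * Nr * (c * L ^+ 2).
  rewrite (_ : _ * n = 8 * c * (m * n)); last by rewrite /c; ring.
  rewrite (_ : 16 * K * _ * _ = 8 * c * (2 * K * Nr * L ^+ 2)); last by ring.
  by rewrite ler_wpM2l // mulr_ge0 // (le_trans _ c1).
have t3 : m * n <= 2 * K * Nr * (c * L ^+ 2).
  apply: le_trans mn _; rewrite (_ : 2 * K * Nr * (c * L ^+ 2) = c * (2 * K * Nr * L ^+ 2)); last by ring.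
  by rewrite ler_peMl // mulr_ge0 ?sqr_ge0 // mulr_ge0 // mulr_ge0.
have x2 : 0 <= Nr * (c * L ^+ 2).
  by apply: mulr_ge0 => //; apply: mulr_ge0; [exact: le_trans ler01 c1|exact: sqr_ge0].
have x1 : 0 <= K * Nr * (c * L ^+ 2) by rewrite -mulrA; exact: mulr_ge0.
by move: t1 t2 t3 => *; lra.
Qed.

Lemma expected_III (S := \sum_(r.+1 <= i < r.*2.+1) lam i ^+ 2) : 0 < lam r -> (r < M)%N ->
  ('E_P[Z] <= (40 * (K + 1) * (Nr * (a ^+ 2 / lam r ^+ 2 * L ^+ 2) +
     Nr * Num.sqrt (a ^+ 2 * S / (Nr * lam r ^+ 2)) * L))%:E)%E.
Proof.
move=> l0 rltM; have l2 : 0 < lam r ^+ 2 by rewrite exprn_gt0.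
have S0 : 0 <= S by rewrite sumr_ge0 // => i _; exact: sqr_ge0.
have Np : 0 < Nr by rewrite ltr0n muln_gt0 r1 subn_gt0.
have ap : 0 < a by apply: lt_le_trans l0 _; exact: (lam_anti svC).
set sN := Num.sqrt Nr; have sN0 : 0 < sN by rewrite sqrtr_gt0.
have sN2 : sN ^+ 2 = Nr by rewrite sqr_sqrtr.
set sS := Num.sqrt S; have sS0 : 0 <= sS by exact: sqrtr_ge0.
have sS2 : sS ^+ 2 = S by rewrite sqr_sqrtr.
(* By [hphi], the order of the root of [phi]; it is the weight for [mean_sqrt_le]. *)
pose f := sN * a * L; have f0 : 0 < f by rewrite mulr_gt0 // mulr_gt0.
pose q := Num.sqrt (2 * S) / lam r.
have q0 : 0 <= q by rewrite divr_ge0 ?sqrtr_ge0 // ltW.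
have [x hx xle] := hphi.
pose Vb w := (8 / lam r ^+ 2 * phi w + 16 / lam r ^+ 2 * m * a ^+ 2 * N w + m * N w) +
  (q * (f^-1 * (2 * phi w) + f) + 2 * q * Num.sqrt m * a * (kap^-1 * N w + kap)).
have hV : hasE P Vb ((8 / lam r ^+ 2 * x + 16 / lam r ^+ 2 * m * a ^+ 2 * n + m * n) +
  (q * (f^-1 * (2 * x) + f) + 2 * q * Num.sqrt m * a * (kap^-1 * n + kap))).
  apply: hasED; first by apply: hasED; [apply: hasED|]; exact: hasEZ.
  apply: hasED; apply: hasEZ; apply: hasED; try exact: hasE_cst.
    by apply: hasEZ; exact: hasEZ.
  exact: hasEZ.
apply: le_trans (expected_sup_le _ hV) _ => [w Q pQ tQ|].
  have := excess_tail oU oV CE svC r1 rM (hN w) pQ tQ l0.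
  rewrite -/P0 -/m -/a -/S -/q -/(phi w).
  have p0 : 0 <= 2 * phi w by rewrite mulr_ge0 // offdiag_ge0.
  have t1 := ler_wpM2l q0 (mean_sqrt_le f0 p0).
  have qm : 0 <= q * Num.sqrt m * a by rewrite mulr_ge0 // mulr_ge0 // sqrtr_ge0.
  have t2 := ler_wpM2l qm (mean_sqrt_le kap0 (N0 w)).
  by rewrite /Vb; move: t1 t2 => *; lra.
rewrite lee_fin; set c := a ^+ 2 / lam r ^+ 2.
have c1 : 1 <= c by rewrite ler_pdivlMr // mul1r; exact: (lam2_anti svC).
have t1 : 8 / lam r ^+ 2 * x <= 16 * (Nr * (c * L ^+ 2)).
  rewrite (_ : 16 * _ = 8 / lam r ^+ 2 * (2 * L ^+ 2 * a ^+ 2 * Nr)); last by rewrite /c; ring.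
  by rewrite ler_wpM2l // divr_ge0 // ltW.
have t2 : 16 / lam r ^+ 2 * m * a ^+ 2 * n <= 32 * K * (Nr * (c * L ^+ 2)).
  rewrite (_ : _ * n = 16 * c * (m * n)); last by rewrite /c; ring.
  rewrite (_ : 32 * K * _ = 16 * c * (2 * K * Nr * L ^+ 2)); last by ring.
  by rewrite ler_wpM2l // mulr_ge0 // (le_trans _ c1).
have t3 : m * n <= 2 * K * (Nr * (c * L ^+ 2)).
  apply: le_trans mn _; rewrite (_ : 2 * K * (Nr * _) = c * (2 * K * Nr * L ^+ 2)); last by ring.
  by rewrite ler_peMl // mulr_ge0 ?sqr_ge0 // mulr_ge0 // mulr_ge0.
have t4 : q * (f^-1 * (2 * x) + f) <= 5 * (q * f).
  rewrite (_ : 5 * _ = q * (5 * f)); last by ring.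
  rewrite ler_wpM2l // -lerBrDr mulrC ler_pdivrMr //.
  rewrite (_ : (5 * f - f) * f = 4 * L ^+ 2 * a ^+ 2 * Nr); last by rewrite /f -sN2; ring.
  by move: xle; lra.
have t5 : 2 * q * Num.sqrt m * a * (kap^-1 * n + kap) <= 4 * (K + 1) * (q * f).
  apply: (@le_trans _ _ (2 * q * Num.sqrt m * a * ((K + 1) * kap))).
    by rewrite ler_wpM2l // mulr_ge0 // mulr_ge0 ?sqrtr_ge0 // mulr_ge0.
  have sm : Num.sqrt m * sM <= 2 * sN.
    rewrite -ler_sqr ?nnegrE ?mulr_ge0 ?sqrtr_ge0 // ?(ltW sM0) ?(ltW sN0) //.
    by rewrite !exprMn sM2 sN2 sqr_sqrtr //; move: mM; lra.
  rewrite (_ : _ * _ = 2 * q * a * L * (K + 1) * (Num.sqrt m * sM)); last by rewrite /kap; ring.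
  rewrite (_ : 4 * _ * _ = 2 * q * a * L * (K + 1) * (2 * sN)); last by rewrite /f; ring.
  apply: ler_wpM2l => //; apply: mulr_ge0; last by rewrite addr_ge0.
  by rewrite mulr_ge0 ?(ltW L0) // mulr_ge0 // mulr_ge0.
have Gq : Nr * Num.sqrt (a ^+ 2 * S / (Nr * lam r ^+ 2)) * L = sS / lam r * f.
  have -> : a ^+ 2 * S / (Nr * lam r ^+ 2) = (a * sS / (sN * lam r)) ^+ 2.
    by rewrite -sS2 -sN2; field; rewrite !gt_eqF.
  rewrite sqrtr_sqr ger0_norm; last first.
    by rewrite divr_ge0 ?mulr_ge0 // ltW.
  by rewrite -sN2 /f; field; rewrite !gt_eqF.
have qG : q * f <= 2 * (sS / lam r * f).
  rewrite mulrA ler_wpM2r ?(ltW f0) // /q mulrA ler_wpM2r ?invr_ge0 ?(ltW l0) //.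
  rewrite -ler_sqr ?nnegrE ?mulr_ge0 ?sqrtr_ge0 //.
  by rewrite exprMn sS2 sqr_sqrtr ?mulr_ge0 //; move: S0; lra.
rewrite Gq; set G := sS / lam r * f.
have G0 : 0 <= G by rewrite mulr_ge0 ?(ltW f0) // divr_ge0 // ltW.
have x2 : 0 <= Nr * (c * L ^+ 2).
  by apply: mulr_ge0 => //; apply: mulr_ge0; [exact: le_trans ler01 c1|exact: sqr_ge0].
have x1 : 0 <= K * (Nr * (c * L ^+ 2)) by exact: mulr_ge0.
have x3 : 0 <= K * G by rewrite mulr_ge0.
have x4 : (K + 1) * (q * f) <= (K + 1) * (2 * G) by rewrite ler_wpM2l // addr_ge0.
apply: le_trans (lerD (lerD (lerD t1 t2) t3) (lerD t4 t5)) _.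
move: qG x4 x1 x2 x3 G0; rewrite -/G.
by move: G (Nr * (c * L ^+ 2)) (q * f) => y z u *; lra.
Qed.

End expected_excess.

Theorem theorem3 (R : realType) :
  exists K : R, 0 < K /\
  forall (d : measure_display) (T : measurableType d) (P : probability T R)
    (M r : nat) (C : 'M[R]_M) (lam : nat -> R)
    (E : 'I_M -> 'I_M -> {RV P >-> R}) (sigma m4 : R) (pi_r : 'M[R]_M),
    (1 <= r <= M)%N ->
    singular_values C lam ->
    mutually_independent P (fun ij : 'I_M * 'I_M => (E ij.1 ij.2 : T -> R)) ->
    (forall (i j i' j' : 'I_M), same_law P (E i j) (E i' j')) ->
    (forall (i j : 'I_M), ('E_P[E i j] = 0)%E) ->
    0 < sigma ->
    (forall (i j : 'I_M), variance P (E i j) = (sigma ^+ 2)%:E) ->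
    (forall (i j : 'I_M),
       ('E_P[(fun w => ((E i j w) ^+ 4)%R)] = m4%:E)%E) ->
    pi_r \in @proj_rank R M r ->
    (forall pi' : 'M[R]_M, pi' \in @proj_rank R M r ->
       hs_norm (pi' *m C) <= hs_norm (pi_r *m C)) ->
    let X := fun w => C + \matrix_(i, j) E i j w in
    let Z := fun w => sup [set hs_norm (pi' *m X w) ^+ 2 - hs_norm (pi_r *m X w) ^+ 2
                          | pi' in @proj_rank R M r] in
    let N := (r * (M - r))%:R : R in
    let I := sigma ^+ 2 + Num.sqrt m4
             + lam 1%N / Num.sqrt M%:R * (sigma + Num.sqrt (Num.sqrt m4)) in
    let II := lam 1%N ^+ 2 / (lam r ^+ 2 - lam r.+1 ^+ 2) * (sigma ^+ 2 + Num.sqrt m4) in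
    let III := lam 1%N ^+ 2 / lam r ^+ 2 * (sigma ^+ 2 + Num.sqrt m4)
               + Num.sqrt (lam 1%N ^+ 2 * (\sum_(r.+1 <= i < r.*2.+1) lam i ^+ 2)
                           / ((r * (M - r))%:R * lam r ^+ 2))
                 * (sigma + Num.sqrt (Num.sqrt m4)) in
    ('E_P[Z] <= (K * N * I)%:E)%E /\
    (lam r.+1 < lam r -> ('E_P[Z] <= (K * N * II)%:E)%E) /\
    (0 < lam r -> ('E_P[Z] <= (K * N * III)%:E)%E).
Proof.
pose Ko : R := 4 * bulk_const + 28; have Ko0 : 0 < Ko.
  by rewrite addr_gt0 // mulr_gt0 // bulk_const_gt0.
have K40 : 0 < 40 * (Ko + 1) by rewrite mulr_gt0 // addr_gt0.
exists (40 * (Ko + 1)); split=> // d T P M r C lam E sigma m4 pi_r.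
move=> /andP[r1 rM] svC indE _ E1 s0 V2 E4 ppi maxpi X Z N I II III.
have [_ [_ [_ [U [V [oU [oV CE]]]]]]] := svC.
pose E' (e : 'I_M * 'I_M) : T -> R := E e.1 e.2.
have mE e : measurable_fun setT (E' e) by exact: measurable_funPT.
have M0 : (0 < M)%N by exact: leq_trans rM.
pose o := Ordinal M0; have s4 := second_le_fourth (E1 o o) (V2 o o) (E4 o o).
have m40 : 0 < m4 by apply: lt_le_trans s4; rewrite exprn_gt0.
pose L := Num.sqrt (Num.sqrt m4); have L0 : 0 < L by rewrite !sqrtr_gt0.
have L2 : L ^+ 2 = Num.sqrt m4 by rewrite sqr_sqrtr ?sqrtr_ge0.
have L4 : L ^+ 4 = m4 by rewrite -[4%N]/(2 * 2)%N exprM L2 sqr_sqrtr // ltW.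
have s2L : sigma ^+ 2 <= L ^+ 2.
  by rewrite -ler_sqr ?nnegrE ?sqr_ge0 // -!exprM L4.
have s2L' : 0 <= sigma ^+ 2 <= L ^+ 2 by rewrite sqr_ge0.
have e1 e : hasE P (E' e) 0 by exact: hasE_first (E1 e.1 e.2) (E4 e.1 e.2).
have e2 e : hasE P (fun w => E' e w ^+ 2) (sigma ^+ 2).
  exact: hasE_second (E1 e.1 e.2) (V2 e.1 e.2) (E4 e.1 e.2).
have e4 e : hasE P (fun w => E' e w ^+ 4) (L ^+ 4).
  by rewrite L4; exact: hasE_fourth (E4 e.1 e.2).
have [Nw [n [opN hN nle]]] := noise_op M0 mE indE L0 s2L e1 e2 e4.
have bI := expected_I oU oV CE svC r1 rM mE indE L0 s2L' e1 e2 ppi maxpi (ltW Ko0) opN hN nle.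
have bII := expected_II oU oV CE svC r1 rM mE indE L0 s2L' e1 e2 ppi maxpi (ltW Ko0) opN hN nle.
have bIII := expected_III oU oV CE svC r1 rM mE indE L0 s2L' e1 e2 ppi maxpi (ltW Ko0) opN hN nle.
have N0 : 0 <= N by exact: ler0n.
have KN0 : 0 <= 40 * (Ko + 1) * N by exact: mulr_ge0 (ltW K40) N0.
have a0 : 0 <= lam 1%N by exact: (lam_ge0 svC).
have l1 : L ^+ 2 <= sigma ^+ 2 + Num.sqrt m4 by rewrite L2 lerDr sqr_ge0.
have l2 : L <= sigma + Num.sqrt (Num.sqrt m4) by rewrite -/L lerDr ltW.
split; [|split=> [llt|l0]].
- apply: le_trans bI _; rewrite lee_fin; apply: ler_wpM2l => //; apply: lerD => //.
  by apply: ler_wpM2l => //; apply: divr_ge0 => //; exact: sqrtr_ge0.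
- apply: le_trans (bII llt) _; rewrite lee_fin; apply: ler_wpM2l => //.
  apply: ler_wpM2l => //; apply: divr_ge0; first exact: sqr_ge0.
  by rewrite subr_ge0 (lam2_anti svC).
(* For r = M the root in [III] divides by zero, but the prefactor [N] vanishes as well and the bound
   by [I] already gives 0. *)
have [rltM|Mr] := ltnP r M.
  apply: le_trans (bIII l0 rltM) _; rewrite lee_fin -[leRHS]mulrA.
  apply: ler_wpM2l; first exact: ltW.
  rewrite -[X in _ + X]mulrA -mulrDr; apply: ler_wpM2l => //; apply: lerD; apply: ler_wpM2l => //.
  by apply: divr_ge0; exact: sqr_ge0.
have Nz : N = 0 by rewrite /N; have -> : (M - r = 0)%N by [apply/eqP; rewrite subn_eq0]; rewrite muln0.
by apply: le_trans bI _; rewrite lee_fin -/N Nz !mulr0 !mul0r.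
Qed.
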